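(* Let $q\ge2$. For $d\ge1$ let $M^{(d)}$ have the uniform Multinomial$(d,(1/q))$ distribution and write $M^{(d)}=d/q+\sqrt d\,\mathfrak M^{(d)}$ (coordinatewise), so that as $d\to\infty$ $\mathfrak M^{(d)}$ converges weakly to a multivariate normal vector $\mathfrak M=(\mathfrak M[0],\ldots,\mathfrak M[q-1])$ with zero means and $\mathrm{Cov}(\mathfrak M[a],\mathfrak M[b])=\frac1q\big(\delta_{ab}-\frac1q\big)$. For $l=(l_1,\ldots,l_{q-1})\in\mathbb N^{q-1}$ and $\mathfrak m=(\mathfrak m[0],\ldots,\mathfrak m[q-1])\in\mathbb R^q$ with $\sum_j\mathfrak m[j]=0$, let $$Q_l(\mathfrak m,(\theta_j);\infty)=\lim_{d\to\infty}Q_l\big(d/q+\sqrt d\,\mathfrak m;(\theta_j),d\big)\,d^{-|l|/2}.$$ Then: (i) $\big(Q_l(\mathfrak m,(\theta_j);\infty)\big)$, $\big(\overline{Q_l(\mathfrak m,(\theta_j);\infty)}\big)$ is a biorthogonal system of polynomials on $\mathfrak M$ with $$\mathbb E\big[Q_l(\mathfrak M,(\theta_j);\infty)\,\overline{Q_{l'}(\mathfrak M,(\theta_j);\infty)}\big]=\frac{\delta_{ll'}}{l_1!\cdots l_{q-1}!}.$$ (ii) $Q_l(\mathfrak m,(\theta_j);\infty)$ is the coefficient of $\mathfrak w^l=\mathfrak w_1^{l_1}\cdots\mathfrak w_{q-1}^{l_{q-1}}$ in the generating function $$G(\mathfrak m,\mathfrak w,(\theta_j);\infty)=\exp\Big\{-\frac1{2q}\sum_{j=0}^{q-1}\Big(\sum_{k=1}^{q-1}\mathfrak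 w_k\theta_k^j\Big)^2+\sum_{j=0}^{q-1}\mathfrak m[j]\sum_{k=1}^{q-1}\mathfrak w_k\theta_k^j\Big\}.$$ (iii) An explicit expression is $$Q_l(\mathfrak m,(\theta_j);\infty)=\sum_{a\in\mathbb N^q,\ |a|=|l|}\ \prod_{j=0}^{q-1}\frac1{a[j]!}H_{a[j]}(\mathfrak m[j];q)\times\frac{a[0]!\cdots a[q-1]!}{l[0]!\,l[1]!\cdots l[q-1]!}\,Q_{a^+}(l;(\theta_k),|l|),$$ where $a=(a[0],\ldots,a[q-1])$, $|a|=\sum_{j=0}^{q-1}a[j]$, $a^+=(a[1],\ldots,a[q-1])$, $l[k]=l_k$ for $k\ge1$, $l[0]=0$, and in $Q_{a^+}(l;(\theta_k),|l|)$ the argument $l$ is the count vector $(0,l_1,\ldots,l_{q-1})$ of total $|l|$.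
   Context: $\theta_l=e^{2\pi i l/q}$, $\mathbb N=\{0,1,2,\ldots\}$, $|l|=l_1+\cdots+l_{q-1}$. The uniform Multinomial$(d,(1/q))$ distribution has probabilities $\frac{d!}{m[0]!\cdots m[q-1]!}q^{-d}$ on vectors $m=(m[0],\ldots,m[q-1])$ of non-negative integers with sum $d$. The multivariate Krawtchouk polynomial $Q_l(m;(\theta_k),d)$, for $m=(m[0],\ldots,m[q-1])$ with $\sum_jm[j]=d$, is the coefficient of $w_1^{l_1}\cdots w_{q-1}^{l_{q-1}}$ in $\prod_{j=0}^{q-1}\big(1+\sum_{k=1}^{q-1}w_k\theta_k^j\big)^{m[j]}$; for real (non-integer) $m$ it is defined by the same power-series coefficient. $\big(H_k(x;q)\big)_{k\ge0}$ are the Hermite–Chebycheff polynomials orthogonal on the $N(0,1/q)$ distribution, with generating function $\sum_{k=0}^\infty\frac1{k!}z^kH_k(x;q)=\exp\{-\frac1{2q}z^2+xz\}$. *)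

(* Defs.v *)
From HB Require Import structures.
From mathcomp Require Import all_boot all_order all_algebra.
From mathcomp Require Import complex.
(* The notations of [mpoly] clash with those of MathComp-Analysis. *)
From mathcomp Require Import -(notations) mpoly.
From mathcomp Require Import all_classical all_reals all_analysis.

Set Implicit Arguments.
Unset Strict Implicit.
Unset Printing Implicit Defensive.

Import Order.TTheory GRing.Theory Num.Theory numFieldNormedType.Exports.

Local Open Scope classical_set_scope.
Local Open Scope complex_scope.
Local Open Scope ring_scope.

(* The terms of degree at most [N] in [P] of the substitution of [P] in the
   power series [\sum_i c i z^i].  If [P] has no constant term, then [P ^+ i]
   has no monomial of degree less than [i], so that the coefficients of total
   degree at most [N] of [psubst N c P] are those of the formal power series
   [\sum_i c i P^i]. *)
Definition psubst (K : nzRingType) (A : lalgType K) (N : nat) (c : nat -> K)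
  (P : A) : A := \sum_(i < N.+1) c i *: P ^+ i.

(* [gbinom x n] is the coefficient of [z^n] in [(1 + z)^x]. *)
Definition gbinom (R : realType) (x : R) (n : nat) : R :=
  (\prod_(i < n) (x - i%:R)) / n`!%:R.

Section Krawtchouk.
Variables (R : realType) (q : nat).
Local Notation C := R[i].

Definition theta (k : nat) : C :=
  let t := 2 * pi * k%:R / q%:R in cos t +i* sin t.

(* The indices 1, ..., q - 1 are represented by 'I_q.-1, with a shift by 1:
   [l k] stands for l_(k+1), and ['X_k] for the variable w_(k+1). *)
Lemma shift_subproof (k : 'I_q.-1) : (k.+1 < q)%N.
Proof. by rewrite -ltn_predRL. Qed.

Definition shift (k : 'I_q.-1) : 'I_q := Ordinal (shift_subproof k).

(* \sum_(1 <= k < q) w_k theta_k^j *)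
Definition wform (j : 'I_q) : mpoly q.-1 C :=
  \sum_(k < q.-1) theta (shift k) ^+ j *: mpolyX C (mnm1 k).

(* The coefficient of w^l in the formal power series
   \prod_j (1 + \sum_k w_k theta_k^j)^(m j), for real m.  The usual argument d
   is omitted: it is the sum of the m j.  See [krawtchouk_nat] for integer m. *)
Definition krawtchouk (l : multinom q.-1) (m : 'I_q -> R) : C :=
  mcoeff l
    (\prod_(j < q) psubst (mdeg l) (fun i => (gbinom (m j) i)%:C) (wform j)).

(* [C^o] carries the topology given by the complex modulus. *)
Definition krawtchouk_seq (l : multinom q.-1) (m : 'I_q -> R) : nat -> C^o :=
  fun d =>
    krawtchouk l (fun j => d%:R / q%:R + Num.sqrt d%:R * m j)
    * (d%:R `^ (- ((mdeg l)%:R / 2)))%:C.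

Definition krawtchouk_lim (l : multinom q.-1) (m : 'I_q -> R) : C :=
  lim (krawtchouk_seq l m @ \oo).

Definition gf_exponent (m : 'I_q -> R) : mpoly q.-1 C :=
  - (2 * q%:R)^-1 *: (\sum_(j < q) wform j ^+ 2)
  + \sum_(j < q) (m j)%:C *: wform j.

(* The coefficient of w^l in the formal power series exp (gf_exponent m). *)
Definition gf_coeff (m : 'I_q -> R) (l : multinom q.-1) : C :=
  mcoeff l (psubst (mdeg l) (fun i => i`!%:R^-1) (gf_exponent m)).

(* k! times the coefficient of z^k in exp (- z^2 / (2 q) + x z). *)
Definition hermite (k : nat) (x : R) : R :=
  k`!%:R * (psubst k (fun i => i`!%:R^-1)
              (- (2 * q%:R)^-1 *: 'X^2 + x *: 'X : {poly R}))`_k.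

(* (0, l_1, ..., l_(q-1)) *)
Definition count_vector (l : multinom q.-1) (j : 'I_q) : nat :=
  nth 0%N (0%N :: l) j.

(* (a[1], ..., a[q-1]) *)
Definition mplus (a : multinom q) : multinom q.-1 :=
  Multinom [tuple a (shift k) | k < q.-1].

(* [bmultinom q N] is the finite type of the a in N^q with |a| < N. *)
Definition krawtchouk_lim_formula (l : multinom q.-1) (m : 'I_q -> R) : C :=
  \sum_(a : bmultinom q (mdeg l).+1 | mdeg a == mdeg l)
    (\prod_(j < q) ((a j)`!%:R^-1 * hermite (a j) (m j)))%:C
    * ((\prod_(j < q) (a j)`!)%:R / (\prod_(j < q) (count_vector l j)`!)%:R)
    * krawtchouk (mplus a) (fun j => (count_vector l j)%:R).

End Krawtchouk.

Section KrawtchoukNat.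
Variables (R : realType) (q : nat).

Let agree (N : nat) (p1 p2 : mpoly q.-1 R[i]) : Prop :=
  forall h, (mdeg h <= N)%N -> mcoeff h p1 = mcoeff h p2.

Let agreeM N p1 p2 r1 r2 :
  agree N p1 p2 -> agree N r1 r2 -> agree N (p1 * r1) (p2 * r2).
Proof.
move=> hp hr h hN; rewrite !mcoeffM; apply: eq_bigr => k /eqP hk.
have := congr1 (@mdeg _) hk; rewrite mdegD => hd.
have := leq_addr (mdeg k.2) (mdeg k.1); have := leq_addl (mdeg k.1) (mdeg k.2).
by rewrite -hd => h2 h1; rewrite hp ?hr // (leq_trans _ hN).
Qed.

Let mcoeff_wform_exp (j : 'I_q) i h :
  (mdeg h < i)%N -> mcoeff h (wform R j ^+ i) = 0.
Proof.
elim: i h => // i IH h hi; rewrite exprS mcoeffM big1 // => k /eqP hk.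
have := congr1 (@mdeg _) hk; rewrite mdegD => hd.
have [k1|k1] := posnP (mdeg k.1).
  rewrite /wform raddf_sum big1 ?mul0r // => x _ /=.
  rewrite mcoeffZ mcoeffX; case: eqP => [e|_]; last by rewrite mulr0.
  by move: k1; rewrite -e mdeg1.
have : (mdeg k.2 < mdeg k.1 + mdeg k.2)%N by rewrite -{1}[mdeg k.2]add0n ltn_add2r.
by rewrite -hd => h2; rewrite IH ?mulr0 // (leq_trans h2).
Qed.

Let gbinom_nat (m n : nat) : gbinom (m%:R : R) n = ('C(m, n))%:R.
Proof.
rewrite /gbinom; apply: (canLR (mulfK _)); first by rewrite pnatr_eq0 -lt0n fact_gt0.
rewrite -natrM bin_ffact; elim: n => [|n IH]; first by rewrite big_ord0.
rewrite big_ord_recr /= IH ffactnSr natrM.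
have [nm|mn] := leqP n m; first by rewrite natrB.
by rewrite ffact_small // !mul0r.
Qed.

Lemma krawtchouk_nat (l : multinom q.-1) (m : 'I_q -> nat) :
  krawtchouk l (fun j => (m j)%:R : R)
  = mcoeff l (\prod_(j < q) (1 + wform R j) ^+ m j).
Proof.
rewrite /krawtchouk; set N := mdeg l; move: (leqnn (mdeg l)); rewrite -/N.
move: l @N => l N; suff : agree N
    (\prod_(j < q) psubst N (fun i => (gbinom ((m j)%:R : R) i)%:C) (wform R j))
    (\prod_(j < q) (1 + wform R j) ^+ m j) by apply.
apply: (big_ind2 (agree N)) => [//|p1 r1 p2 r2 h1 h2|j _ h hN]; first exact: agreeM.
rewrite exprDn /psubst !raddf_sum /=.
pose F i : R[i] := 'C(m j, i)%:R * mcoeff h (wform R j ^+ i).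
transitivity (\sum_(i < (N + m j).+1) F i).
  rewrite (big_ord_widen (N + m j).+1
    (fun i => mcoeff h ((gbinom ((m j)%:R : R) i)%:C *: wform R j ^+ i))); last first.
    by rewrite ltnS leq_addr.
  rewrite big_mkcond /=; apply: eq_bigr => i _; rewrite mcoeffZ gbinom_nat rmorph_nat.
  case: ifPn => //; rewrite -leqNgt => hi.
  by rewrite /F mcoeff_wform_exp ?mulr0 // (leq_ltn_trans hN).
rewrite (big_ord_widen (N + m j).+1
    (fun i => mcoeff h (1 ^+ (m j - i) * wform R j ^+ i *+ 'C(m j, i)))); last by rewrite ltnS leq_addl.
rewrite [RHS]big_mkcond /=; apply: eq_bigr => i _; rewrite expr1n mul1r mcoeffMn -mulr_natl.
by case: ifPn => //; rewrite -leqNgt => hi; rewrite /F bin_small // mul0r.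
Qed.

End KrawtchoukNat.

Section Probability.
Context (R : realType) (q : nat) (disp : measure_display)
  (T : measurableType disp) (P : probability T R).

Definition uniform_multinomial (d : nat) (X : 'I_q -> {RV P >-> R}) : Prop :=
  forall m : 'I_q -> nat, (\sum_(j < q) m j)%N = d ->
    P [set w | forall j, X j w = (m j)%:R]
    = (d`!%:R / (\prod_(j < q) (m j)`!)%:R * q%:R ^- d)%:E.

(* [normal_prob] is only meaningful for a nonzero standard deviation. *)
Definition univ_normal (mu sigma : R) (A : set R) : \bar R :=
  if sigma == 0 then dirac mu A else normal_prob mu sigma A.

(* Every linear combination of the coordinates is normal, possibly degenerate;
   this allows singular covariance matrices. *)
Definition multivariate_normal (X : 'I_q -> {RV P >-> R}) : Prop :=
  forall t : 'I_q -> R, exists mu sigma : R,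
    forall A : set R, measurable A ->
      P ((fun w => \sum_(j < q) t j * X j w) @^-1` A) = univ_normal mu sigma A.

Definition rvec (X : 'I_q -> T -> R) (w : T) : 'rV[R]_q := \row_j X j w.

Definition cintegrable (f : T -> R[i]) : Prop :=
  P.-integrable setT (EFin \o (fun w => complex.Re (f w))) /\
  P.-integrable setT (EFin \o (fun w => complex.Im (f w))).

Definition cexpectation (f : T -> R[i]) : R[i] :=
  fine 'E_P[fun w => complex.Re (f w)] +i* fine 'E_P[fun w => complex.Im (f w)].

End Probability.

Definition weak_cvg (R : realType) (q : nat)
  (dispn : nat -> measure_display) (Tn : forall d, measurableType (dispn d))
  (Pn : forall d, probability (Tn d) R) (Xn : forall d, 'I_q -> Tn d -> R)
  (disp : measure_display) (T : measurableType disp) (P : probability T R)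
  (X : 'I_q -> T -> R) : Prop :=
  forall f : 'rV[R]_q -> R, continuous f -> [bounded f x | x in setT] ->
    ('E_(Pn d)[f \o rvec (Xn d)])%E @[d --> \oo] --> ('E_P[f \o rvec X])%E.

(* Main.v *)
(* Since \sum_j w_j = 0 for the linear forms w_j = \sum_k w_k theta_k^j, the
   product over j of (1 + w_j)^(m j) does not change when its factors are
   multiplied by exp (- sqrt d * w_j / q).  After the rescaling of w by s =
   1 / sqrt d, the coefficients u_n of the j-th factor are determined by
   (1 + s z) u' = (x - z / q) u and u 0 = 1, hence are polynomials in s; at
   s = 0 they are those of exp (x z - z^2 / (2 q)), which yields (ii).  For
   (iii), the coefficient of w^l in \prod_j w_j^(a j) is read off the bilinear
   form \sum_(j, k) v_j w_k theta_k^j in two ways.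
   For (i), comparing Taylor coefficients in E exp (u Y) = exp (v u^2 / 2), for
   Y = \sum_j t_j X_j of variance v, gives the moments of Y as polynomials in t.
   As a real polynomial that vanishes everywhere is zero, the t_j can be replaced
   with elements of a commutative algebra, in particular with the sums of w_j and
   of the conjugate of w'_j; then the expectation of the product of the generating
   function at w with its conjugate at w' is exp (\sum_k w_k w'_k).
   For the weak convergence, the expectations of trigonometric polynomials
   converge.  A bounded continuous f is approximated by the Bernstein polynomials
   in the variables (1 + sin (x_j / L)) / 2 of a function that agrees with f on a
   large box; outside of the box the error is controlled by the exponential
   moments, which are bounded uniformly in d. *)

Require Import Defs.
From HB Require Import structures.
From mathcomp Require Import all_boot all_order all_algebra.
From mathcomp Require Import complex.
From mathcomp Require Import -(notations) mpoly.
From mathcomp Require Import all_classical all_reals all_analysis.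
From mathcomp Require Import measurable_realfun normal_distribution random_variable.
From mathcomp Require Import ring lra zify.

Import Order.TTheory GRing.Theory Num.Theory numFieldNormedType.Exports.

Local Open Scope classical_set_scope.
Local Open Scope complex_scope.
Local Open Scope ring_scope.

Set Implicit Arguments.
Unset Strict Implicit.
Unset Printing Implicit Defensive.

(** * Power series as sequences of coefficients *)

(** Everything is graded by one auxiliary variable z: [w_j] enters as z w_j, so the coefficient of
    z^n is the part of degree n in w, and the coefficient of w^l is read at z^|l| alone. A series is
    then a sequence with values in an algebra. Identities and limits are settled by a recursion on
    two consecutive terms, whose parameters a and b add up under products. The compensating
    exponentials shape the first half: the separate factors (1 + z / sqrt d)^(d / q + sqrt d x) have
    divergent coefficients, and only their product over j converges. On the Gaussian side the
    covariance is singular, so there is no density to integrate against, and only the laws of real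
    linear combinations are given. This is why the moments are organised into polynomial identities
    in t, proved at real t and then evaluated in an algebra over the complex numbers. For the weak
    convergence, tightness and approximation are merged into one estimate: the error is a small
    multiple of 1 + sum_j (exp x_j + exp (- x_j)), whose expectation is bounded along the
    sequence. *)

Section Convolution.
Variable A : comNzRingType.
Implicit Types (u v w : nat -> A) (s a b : A) (n N : nat).

Definition conv u v n : A := \sum_(i < n.+1) u i * v (n - i)%N.

Definition conv1 n : A := (n == 0%N)%:R.

(** The coefficient of z^n involves only the first n + 1 terms, so the ring laws of [conv] are
    inherited from polynomials truncated at any N > n. *)
Lemma coefM_poly u v N n : (n < N)%N ->
  ((\poly_(i < N) u i) * (\poly_(i < N) v i))`_n = conv u v n.
Proof.
move=> nN; rewrite coefM; apply: eq_bigr => i _.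
have iN : (i < N)%N by apply: leq_trans nN; exact: ltn_ord.
by rewrite !coef_poly iN (leq_ltn_trans (leq_subr _ _) nN).
Qed.

Lemma coefM_eq (p p' r r' : {poly A}) N :
  (forall n, (n < N)%N -> p`_n = p'`_n) -> (forall n, (n < N)%N -> r`_n = r'`_n) ->
  forall n, (n < N)%N -> (p * r)`_n = (p' * r')`_n.
Proof.
move=> hp hr n nN; rewrite !coefM; apply: eq_bigr => i _.
rewrite hp ?hr // ?(leq_ltn_trans (leq_subr _ _) nN) //.
by apply: leq_trans nN; exact: ltn_ord.
Qed.

Lemma coef_poly_conv u v N n : (n < N)%N ->
  (\poly_(i < N) conv u v i)`_n = ((\poly_(i < N) u i) * (\poly_(i < N) v i))`_n.
Proof. by move=> nN; rewrite coef_poly nN coefM_poly. Qed.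

Lemma convC : commutative conv.
Proof.
by move=> u v; apply/funext => n; rewrite -!(@coefM_poly _ _ n.+1) // mulrC.
Qed.

Lemma convA : associative conv.
Proof.
move=> u v w; apply/funext => n; rewrite -!(@coefM_poly _ _ n.+1) //.
rewrite (@coefM_eq _ (\poly_(i < n.+1) u i) _
  ((\poly_(i < n.+1) v i) * (\poly_(i < n.+1) w i)) n.+1) //; last first.
  by move=> k kn; rewrite coef_poly_conv.
rewrite mulrA; apply: (@coefM_eq _ _ _ _ n.+1) => // k kn.
by rewrite coef_poly_conv.
Qed.

Lemma conv1l : left_id conv1 conv.
Proof.
move=> u; apply/funext => n; rewrite /conv big_ord_recl /conv1 eqxx mul1r subn0.
by rewrite big1 ?addr0 // => i _; rewrite mul0r.
Qed.

HB.instance Definition _ :=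
  Monoid.isComLaw.Build (nat -> A) conv1 conv convA convC conv1l.

(* The power series u satisfies (1 + s z) u' = (a - b z) u and u 0 = 1. *)
Definition ode s a b u :=
  [/\ u 0%N = 1, u 1%N = a &
     forall n, u n.+2 *+ n.+2 = (a - s *+ n.+1) * u n.+1 - b * u n].

Let shift_seq u n : A := if n is m.+1 then u m else 0.
Let deriv_seq u n : A := u n.+1 *+ n.+1.

(** The value at 1 and the recursion are the coefficients of z^0 and z^(n+1) in one equation between
    series; in that form Leibniz' rule applies to products. *)
Lemma odeE s a b u : ode s a b u <-> u 0%N = 1 /\ forall n,
  deriv_seq u n + s * shift_seq (deriv_seq u) n = a * u n - b * shift_seq u n.
Proof.
split=> [[u0 u1 us]|[u0 us]]; rewrite /deriv_seq /shift_seq.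
  split=> // -[|n]; first by rewrite mulr1n !mulr0 subr0 addr0 u0 u1 mulr1.
  by rewrite us mulrBl mulrnAl mulrnAr addrAC subrK.
split=> // [|n].
  by have /= := us 0%N; rewrite /deriv_seq mulr1n !mulr0 subr0 addr0 u0 mulr1.
have := us n.+1; rewrite /deriv_seq /shift_seq /= => /(canRL (addrK _)) ->.
by rewrite mulrBl mulrnAl mulrnAr addrAC.
Qed.

Let conv_deriv u v n :
  deriv_seq (conv u v) n = conv (deriv_seq u) v n + conv u (deriv_seq v) n.
Proof.
rewrite /deriv_seq -(@coefM_poly u v n.+2) // -coef_deriv derivM coefD !coefM.
congr +%R; apply: eq_bigr => i _; rewrite !coef_deriv !coef_poly.
  by rewrite ltnS (ltn_ord i) ltnS (leq_trans (leq_subr _ _)) // leqnSn.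
by rewrite !ltnS leq_subr (leq_trans (ltnW (ltn_ord i))).
Qed.

Let conv_shift u v n : shift_seq (conv u v) n = conv (shift_seq u) v n.
Proof.
case: n => [|n]; first by rewrite /conv big_ord1 mul0r.
by rewrite /conv big_ord_recl /= mul0r add0r.
Qed.


(** The logarithmic derivatives (a - b z) / (1 + s z) add up, which requires the shared denominator
    1 + s z. *)
Lemma ode_conv s a b a' b' u v :
  ode s a b u -> ode s a' b' v -> ode s (a + a') (b + b') (conv u v).
Proof.
move=> /odeE[u0 hu] /odeE[v0 hv]; apply/odeE; split.
  by rewrite /conv big_ord1 u0 v0 mulr1.
move=> n; rewrite conv_deriv.
have -> : shift_seq (deriv_seq (conv u v)) n =
    conv (shift_seq (deriv_seq u)) v n + conv (shift_seq (deriv_seq v)) u n.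
  rewrite -!conv_shift; case: n => [|n] /=; first by rewrite addr0.
  by rewrite conv_deriv [conv u _]convC.
rewrite [conv u (deriv_seq v)]convC mulrDr addrACA.
have -> : conv (deriv_seq u) v n + s * conv (shift_seq (deriv_seq u)) v n =
    a * conv u v n - b * conv (shift_seq u) v n.
  rewrite /conv !big_distrr /= -big_split -sumrB; apply: eq_bigr => i _ /=.
  by rewrite !mulrA -mulrDl hu mulrBl.
have -> : conv (deriv_seq v) u n + s * conv (shift_seq (deriv_seq v)) u n =
    a' * conv v u n - b' * conv (shift_seq v) u n.
  rewrite /conv !big_distrr /= -big_split -sumrB; apply: eq_bigr => i _ /=.
  by rewrite !mulrA -mulrDl hv mulrBl.
rewrite -!conv_shift [conv v u]convC; ring.
Qed.

Lemma ode_conv1 s : ode s 0 0 conv1.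
Proof. by split=> // n; rewrite /conv1 /= mul0rn mulr0 mul0r subr0. Qed.

Lemma ode_bigconv s I (r : seq I) (P : pred I) (a b : I -> A) (u : I -> nat -> A) :
  (forall i, P i -> ode s (a i) (b i) (u i)) ->
  ode s (\sum_(i <- r | P i) a i) (\sum_(i <- r | P i) b i)
    (\big[conv/conv1]_(i <- r | P i) u i).
Proof.
move=> h; apply: (big_ind3 (ode s)) => //; first exact: ode_conv1.
by move=> *; exact: ode_conv.
Qed.

Lemma bigconv_coef q (u : 'I_q -> nat -> A) N n : (n < N)%N ->
  (\big[conv/conv1]_(j < q) u j) n = (\prod_(j < q) \poly_(i < N) u j i)`_n.
Proof.
pose rel v (p : {poly A}) := forall n, (n < N)%N -> v n = p`_n.
move: n; suff : rel (\big[conv/conv1]_(j < q) u j)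
  (\prod_(j < q) \poly_(i < N) u j i) by [].
apply: (big_ind2 rel) => [n nN|v p w r hv hw n nN|j _ n nN].
- by rewrite coef1.
- rewrite -(@coefM_poly _ _ N) //; apply: (@coefM_eq _ _ _ _ N) => // k kN.
    by rewrite coef_poly kN hv.
  by rewrite coef_poly kN hw.
- by rewrite coef_poly nN.
Qed.

Lemma coef_prod_poly q (u : 'I_q -> nat -> A) N n :
  (\prod_(j < q) \poly_(i < N) u j i)`_n =
  \sum_(f : {ffun 'I_q -> 'I_N} | (\sum_j f j)%N == n) \prod_(j < q) u j (f j).
Proof.
under eq_bigr do rewrite poly_def.
rewrite bigA_distr_bigA /= coef_sum [RHS]big_mkcond /=; apply: eq_bigr => f _.
rewrite (eq_bigr (fun j => (u j (f j))%:P * 'X^(f j))); last first.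
  by move=> j _; rewrite mul_polyC.
rewrite big_split /= -rmorph_prod -expr_sum coefCM coefXn eq_sym.
by case: eqP => _; rewrite ?mulr1 ?mulr0.
Qed.

Lemma bigconv_ffun q (u : 'I_q -> nat -> A) N n : (n < N)%N ->
  (\big[conv/conv1]_(j < q) u j) n =
  \sum_(f : {ffun 'I_q -> 'I_N} | (\sum_j f j)%N == n) \prod_(j < q) u j (f j).
Proof. by move=> nN; rewrite (@bigconv_coef _ _ N) // coef_prod_poly. Qed.

(** The index type is that of [krawtchouk_lim_formula], with which the expansion must eventually
    agree. *)
Lemma bigconvE q (u : 'I_q -> nat -> A) N n : (n < N)%N ->
  (\big[conv/conv1]_(j < q) u j) n =
  \sum_(a : bmultinom q N | mdeg a == n) \prod_(j < q) u j (a j).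
Proof.
move=> nN; rewrite (@bigconv_ffun _ _ N) //.
(* Each entry of a is at most |a| < N, and a vector of sum n has degree below N: neither this
   [insubd] nor the one in [G] takes its default value where it matters. *)
pose F (a : bmultinom q N) : {ffun 'I_q -> 'I_N} :=
  [ffun j => insubd (Ordinal (leq_ltn_trans (leq0n _) nN)) (a j)].
have FE (a : bmultinom q N) j : F a j = a j :> nat.
  rewrite ffunE val_insubd (leq_ltn_trans _ (bmdeg a)) // mdegE.
  by rewrite (bigD1 j) //= leq_addr.
have bij : {on [pred f : {ffun 'I_q -> 'I_N} | (\sum_j f j)%N == n], bijective F}.
  have hG (f : {ffun 'I_q -> 'I_N}) : (\sum_j f j)%N == n ->
      (mdeg (Multinom [tuple (f j : nat) | j < q]) < N)%N.
    move=> /eqP fn; rewrite mdegE (eq_bigr (fun j => f j : nat)) ?fn //.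
    by move=> j _; rewrite mnm_tnth tnth_mktuple.
  have h0 : (mdeg (@mnm0 q) < N)%N by rewrite mdeg0 (leq_ltn_trans _ nN).
  pose G (f : {ffun 'I_q -> 'I_N}) : bmultinom q N :=
    insubd (BMultinom h0) (Multinom [tuple (f j : nat) | j < q]).
  have GE (f : {ffun 'I_q -> 'I_N}) : (\sum_j f j)%N == n -> forall j, G f j = f j.
    by move=> fn j; rewrite /G val_insubd hG // mnm_tnth tnth_mktuple.
  exists G => [a|f]; rewrite inE => hn.
    by apply/val_inj/mnmP => j; rewrite GE // FE.
  by apply/ffunP => j; apply/val_inj; rewrite /= FE GE.
rewrite (reindex F) //=; apply: eq_big => [a|a _].
  by rewrite mdegE; under eq_bigr do rewrite FE.
by apply: eq_bigr => j _; rewrite FE.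
Qed.

Lemma bigconvZ q (u : 'I_q -> nat -> A) s n :
  (\big[conv/conv1]_(j < q) (fun i => s ^+ i * u j i)) n =
  s ^+ n * (\big[conv/conv1]_(j < q) u j) n.
Proof.
rewrite !(@bigconv_ffun _ _ n.+1) // big_distrr /=; apply: eq_bigr => f /eqP fn.
by rewrite big_split /= -expr_sum fn.
Qed.

End Convolution.

Lemma ode_rmorph (A B : comNzRingType) (f : {rmorphism A -> B}) s a b u :
  ode s a b u -> ode (f s) (f a) (f b) (f \o u).
Proof.
move=> [u0 u1 us]; split=> [||n] /=; first by rewrite u0 rmorph1.
  by rewrite u1.
by rewrite -rmorphMn us rmorphB !rmorphM rmorphB rmorphMn.
Qed.

Lemma regular_scaleE (K : pzRingType) (a b : K) : a *: (b : K^o) = a * b.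
Proof. by []. Qed.

Section ExponentialSequences.
Variables (K : numFieldType) (A : comAlgType K).
Implicit Types (u v : nat -> A) (x y a b s : A) (n N : nat).

Lemma natmul_inj n x y : x *+ n.+1 = y *+ n.+1 -> x = y.
Proof.
rewrite -(scaler_nat n.+1 x) -(scaler_nat n.+1 y) => /(congr1 (GRing.scale (n.+1%:R^-1 : K))).
by rewrite !scalerA mulVf ?pnatr_eq0 // !scale1r.
Qed.

(** The recursion yields u (n+2) multiplied by n + 2, which determines u (n+2) in an algebra over a
    field of characteristic 0. Identities between series are reduced to this uniqueness. *)
Lemma ode_uniq s a b u v : ode s a b u -> ode s a b v -> u = v.
Proof.
move=> [u0 u1 us] [v0 v1 vs]; apply/funext => n.
suff : u n = v n /\ u n.+1 = v n.+1 by case.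
elim: n => [|n [IH1 IH2]]; first by rewrite u0 v0 u1 v1.
by split=> //; apply: (@natmul_inj n.+1); rewrite us vs IH1 IH2.
Qed.

Definition expseq x n : A := (n`!%:R^-1 : K) *: x ^+ n.

(** The coefficients of exp (x z^2). *)
Definition expseq2 x n : A := if odd n then 0 else expseq x n./2.

(* The coefficients of the power series exp (x z - y z^2 / 2). *)
Definition hermite_seq x y : nat -> A :=
  conv (expseq x) (expseq2 (- (2^-1 : K) *: y)).

Lemma expseqS x n : expseq x n.+1 *+ n.+1 = x * expseq x n.
Proof.
rewrite /expseq -(scaler_nat n.+1) scalerA factS natrM invfM mulrA mulfV ?mul1r.
  by rewrite exprS -scalerAr.
by rewrite pnatr_eq0.
Qed.

(** An exponential solves the equation for every s, as (1 + s z) x = x + s x z; it can therefore be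
    multiplied with a power of 1 + s z. *)
Lemma ode_expseq s x : ode s x (- (s * x)) (expseq x).
Proof.
split=> [||n]; rewrite ?expr0 ?expr1 /expseq ?invr1 ?scale1r // -/(expseq _ _).
rewrite expseqS mulNr opprK mulrBl mulrnAl -mulrnAr expseqS; ring.
Qed.

Lemma ode_expseq2 y : ode 0 0 y (expseq2 (- (2^-1 : K) *: y)).
Proof.
split=> [|//|n]; first by rewrite /expseq2 /expseq /= invr1 scale1r.
rewrite mul0rn subr0 mul0r sub0r /expseq2 /= negbK.
case: ifPn => [_|nodd]; first by rewrite mul0rn mulr0 oppr0.
have -> : n.+2 = (2 * n./2.+1)%N.
  by rewrite mulnS mul2n even_halfK.
rewrite mulnC mulrnA expseqS -mulNr -mulrnAl scaleNr mulNrn.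
by rewrite scalerMnl -(mulr_natr (2^-1)) mulVf ?scale1r ?pnatr_eq0.
Qed.

Lemma ode_hermite_seq x y : ode 0 x y (hermite_seq x y).
Proof.
have := ode_conv (ode_expseq 0 x) (ode_expseq2 y).
by rewrite mul0r oppr0 addr0 add0r.
Qed.

Lemma expseq0 : expseq 0 = @conv1 A.
Proof.
apply/funext => -[|n]; rewrite /expseq /conv1 ?invr1 ?scale1r //.
by rewrite expr0n /= scaler0.
Qed.

Lemma bigconv_expseq q (x : 'I_q -> A) :
  \big[@conv A/@conv1 A]_(j < q) expseq (x j) = expseq (\sum_(j < q) x j).
Proof.
apply: (@ode_uniq 0 (\sum_(j < q) x j) 0).
  have := @ode_bigconv A 0 _ (index_enum 'I_q) xpredT _ _ _
    (fun j _ => ode_expseq 0 (x j)).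
  by rewrite [X in ode _ _ X]big1 // => j _; rewrite mul0r oppr0.
by have := ode_expseq 0 (\sum_(j < q) x j); rewrite mul0r oppr0.
Qed.

Lemma bigconv_hermite_seq q (x y : 'I_q -> A) :
  \big[@conv A/@conv1 A]_(j < q) hermite_seq (x j) (y j) =
  hermite_seq (\sum_(j < q) x j) (\sum_(j < q) y j).
Proof.
apply: ode_uniq (ode_hermite_seq _ _).
by apply: ode_bigconv => j _; exact: ode_hermite_seq.
Qed.

(** The multinomial theorem with each power divided by its factorial: the exponential of a sum is
    the product of the exponentials. *)
Lemma sum_expr_fact q (x : 'I_q -> A) N n : (n < N)%N ->
  \sum_(a : bmultinom q N | mdeg a == n)
    \prod_(j < q) expseq (x j) (a j) = expseq (\sum_(j < q) x j) n.
Proof. by move=> nN; rewrite -bigconv_expseq (bigconvE _ nN). Qed.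

(** Substitution of y z for z, which turns a scalar series into one over the algebra; b, being the
    coefficient of z, takes a second factor y. *)
Lemma ode_scale (k : nat -> K) (s0 a0 b0 : K) y :
  ode s0 a0 b0 k ->
  ode (s0 *: y) (a0 *: y) (b0 *: y ^+ 2) (fun n => k n *: y ^+ n).
Proof.
move=> [k0 k1 ks]; split=> [||n]; first by rewrite k0 scale1r expr0.
  by rewrite k1 expr1.
rewrite scalerMnl ks [in LHS]scalerBl scalerMnl -[in RHS]scalerBl.
by rewrite -!scalerAl -!scalerAr !scalerA -exprS -exprD.
Qed.

(** The truncated exponential G of P satisfies G' = P' (G - P^N / N!). Since P^N has no term of
    degree below N, G obeys the recursion of exp P up to degree N. *)
Lemma psubst_hermite_seq x y N n : (n <= N)%N ->
  (\sum_(i < N.+1) (i`!%:R^-1 : K)%:A%:P *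
     (x *: 'X + (- (2^-1 : K) *: y) *: 'X^2) ^+ i)`_n = hermite_seq x y n.
Proof.
set P := _ + _; set G := \sum_(i < _) _ => nN.
have PE : P = 'X * (x%:P + (- (2^-1 : K) *: y) *: 'X).
  by rewrite /P mulrDr -!mul_polyC [in RHS]mulrCA -expr2 ['X * x%:P]mulrC.
have coefXPn i k : (k < i)%N -> (P ^+ i)`_k = 0.
  by move=> ki; rewrite PE exprMn coefXnM ki.
have dP : P^`() = x%:P - y *: 'X.
  rewrite /P derivD !derivZ derivX derivXn /= alg_polyC -!mul_polyC; congr (_ + _).
  rewrite expr1 mulrnAr -mulrnAl -rmorphMn -mulNr -rmorphN /=.
  congr (_%:P * _); rewrite scaleNr mulNrn scalerMnl -(mulr_natr (2^-1)).
  by rewrite mulVf ?pnatr_eq0 // scale1r.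
have dG : G^`() = P^`() * (G - (N`!%:R^-1 : K)%:A%:P * P ^+ N).
  rewrite [in RHS]/G big_ord_recr /= addrK /G raddf_sum big_ord_recl /=.
  rewrite expr0 mulr1 derivC add0r big_distrr /=.
  apply: eq_bigr => i _; rewrite derivM derivC mul0r add0r deriv_exp /= /bump /=.
  rewrite mulrnAr -mulrnAl -rmorphMn /= scalerMnl mulrCA; congr (_ * (_%:A%:P * _)).
  by rewrite factS natrM invfM -mulr_natr mulrAC mulVf ?mul1r // pnatr_eq0.
have recG k : (k < N)%N -> G`_k.+1 *+ k.+1 = x * G`_k - y * (if k is j.+1 then G`_j else 0).
  move=> kN; rewrite -coef_deriv dG dP mulrBl coefB coefCM coefB.
  rewrite coefCM coefXPn // mulr0 subr0 -scalerAl coefZ coefXM.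
  case: k kN => [|k] kN //=; rewrite coefB coefCM coefXPn ?mulr0 ?subr0 //.
  exact: ltnW.
have [h0 h1 hS] := ode_hermite_seq x y.
have G0 : G`_0 = 1.
  rewrite /G coef_sum big_ord_recl /= expr0 mulr1 coefC eqxx invr1 scale1r.
  by rewrite big1 ?addr0 // => i _; rewrite coefCM coefXPn ?mulr0.
move: nN; suff : ((n <= N)%N -> G`_n = hermite_seq x y n) /\
  ((n < N)%N -> G`_n.+1 = hermite_seq x y n.+1) by case.
elim: n => [|n [IH1 IH2]]; split=> [nN|nN]; first by rewrite G0 h0.
- by rewrite h1 -[LHS]mulr1n recG // G0 mulr1 mulr0 subr0.
- exact: IH2.
- apply: (@natmul_inj n.+1); rewrite recG // hS mul0rn subr0.
  by rewrite IH1 ?IH2 // ltnW // ltnW.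
Qed.

End ExponentialSequences.

(** * The limit of the Krawtchouk polynomials *)

Section Cis.
Variable R : realType.
Implicit Types x y : R.

Definition cis x : R[i] := cos x +i* sin x.

Lemma cis0 : cis 0 = 1.
Proof. by rewrite /cis cos0 sin0. Qed.

Lemma cisD x y : cis (x + y) = cis x * cis y.
Proof.
apply/eqP; rewrite eq_complex /= cosD sinD eqxx /=.
by rewrite [sin x * _ + _]addrC.
Qed.

Lemma conj_cis x : (cis x)^*%C = cis (- x).
Proof. by rewrite /cis cosN sinN. Qed.

Lemma cisX x n : cis x ^+ n = cis (n%:R * x).
Proof.
elim: n => [|n IH]; first by rewrite expr0 mul0r cis0.
by rewrite exprS IH -cisD -natr1; congr cis; ring.
Qed.

Lemma cis_sum (I : finType) (F : I -> R) : cis (\sum_i F i) = \prod_i cis (F i).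
Proof. by apply: (big_morph cis); [exact: cisD|exact: cis0]. Qed.

Lemma norm_cis x : `|cis x| = 1.
Proof. by rewrite normc_def /= cos2Dsin2 sqrtr1. Qed.

Lemma cis_2pi n : cis (n%:R * (2 * pi)) = 1.
Proof.
rewrite -cisX /cis [2 * pi]mulr_natl cos2pi sin2pi.
by rewrite (_ : 1 +i* 0 = 1) // expr1n.
Qed.

(** By the half-angle formula, cos x = 1 forces sin (x / 2) = 0, whereas x / 2 lies strictly between
    0 and pi. *)
Lemma cis_neq1 x : 0 < x < 2 * pi -> cis x != 1.
Proof.
move=> /andP[x0 xpi]; rewrite eq_complex /= negb_and; apply/orP; left.
have -> : x = (x / 2) *+ 2 by rewrite -mulr_natr divfK ?pnatr_eq0.
rewrite cos_mulr2n cos2sin2 mulrnBl; apply/eqP => h.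
have : sin (x / 2) ^+ 2 = 0 by lra.
apply/eqP; rewrite expf_eq0 /=; apply: lt0r_neq0; apply: sin_gt0_pi.
by rewrite divr_gt0 //= ltr_pdivrMr // mulrC.
Qed.

Lemma thetaE q k : theta R q k = cis (2 * pi * k%:R / q%:R).
Proof. by []. Qed.

Lemma thetaX q k j : theta R q k ^+ j = theta R q (j * k).
Proof. by rewrite !thetaE cisX natrM; congr cis; ring. Qed.

Lemma theta_sym q k j : theta R q k ^+ j = theta R q j ^+ k.
Proof. by rewrite !thetaX mulnC. Qed.

Lemma thetaXq q k : theta R q k ^+ q = 1.
Proof.
have [->|q0] := eqVneq q 0%N; first by rewrite expr0.
rewrite thetaE cisX -[RHS](cis_2pi k); congr cis.
by rewrite mulrCA mulfV ?mulr1 ?pnatr_eq0 // mulrC.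
Qed.

Lemma theta0 q : theta R q 0 = 1.
Proof. by rewrite thetaE mulr0 mul0r cis0. Qed.

Lemma thetaD q a b : theta R q (a + b) = theta R q a * theta R q b.
Proof. by rewrite !thetaE -cisD natrD; congr cis; ring. Qed.

Lemma thetaq q : theta R q q = 1.
Proof. by rewrite -[X in theta _ _ X]muln1 -thetaX thetaXq. Qed.

Lemma theta_neq1 q k : (0 < k < q)%N -> theta R q k != 1.
Proof.
move=> /andP[k0 kq]; apply: cis_neq1.
have q0 : (0 : R) < q%:R by rewrite ltr0n (leq_trans _ kq).
have pi0 : (0 : R) < 2 * pi by rewrite mulr_gt0 ?pi_gt0.
apply/andP; split; last by rewrite ltr_pdivrMr // ltr_pM2l // ltr_nat.
by rewrite divr_gt0 // mulr_gt0 ?ltr0n.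
Qed.

Lemma conj_theta q k : (k <= q)%N -> (theta R q k)^*%C = theta R q (q - k).
Proof.
move=> kq; have [q0|q0] := posnP q.
  by move: kq; rewrite q0 leqn0 => /eqP ->; rewrite theta0 conjc1.
rewrite !thetaE conj_cis natrB // -[LHS]mulr1 -(cis_2pi 1) -cisD.
by congr cis; field; rewrite pnatr_eq0 -lt0n.
Qed.

Lemma sum_unity_root (z : R[i]) q : z ^+ q = 1 -> z != 1 -> \sum_(j < q) z ^+ j = 0.
Proof.
move=> zq z1; have := subrX1 z q; rewrite zq subrr => /esym/eqP.
by rewrite mulf_eq0 subr_eq0 (negbTE z1) => /eqP.
Qed.

Lemma sum_theta q k : (0 < k < q)%N -> \sum_(j < q) theta R q k ^+ j = 0.
Proof. by move=> kq; rewrite sum_unity_root ?thetaXq ?theta_neq1. Qed.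

(** Orthogonality of the characters of Z/q. The product of the two roots is theta at k + (q - k'), a
    natural number that is k - k' modulo q and hence not a multiple of q when k and k' differ. *)
Lemma sum_theta_conj q (k k' : 'I_q) :
  \sum_(j < q) theta R q k ^+ j * (theta R q k')^*%C ^+ j = q%:R * (k == k')%:R.
Proof.
have k'q : (k' <= q)%N by rewrite ltnW.
under eq_bigr do rewrite -exprMn conj_theta // -thetaD.
have [->|kk'] := eqVneq k k'.
  rewrite subnKC // (eq_bigr (fun=> 1)) ?sumr_const ?card_ord ?mulr1 // => j _.
  by rewrite thetaq expr1n.
rewrite mulr0 sum_unity_root ?thetaXq //.
have := ltn_ord k; have := ltn_ord k' => k'q' kq'.
have [kk''|kk''|/val_inj kk''] := ltngtP k k'; last by rewrite kk'' eqxx in kk'.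
  by apply: theta_neq1; lia.
have -> : (k + (q - k'))%N = (q + (k - k'))%N by lia.
by rewrite thetaD thetaq mul1r; apply: theta_neq1; lia.
Qed.

End Cis.

(** * Homogeneous components of the generating functions *)

Section Graded.
Variables (n : nat) (K : idomainType).
Local Notation A := (mpoly n K).
Implicit Types P Q : {poly A}.

Definition graded P := forall i, P`_i \is @ishomog1 n K i mdeg.

Lemma gradedM P Q : graded P -> graded Q -> graded (P * Q).
Proof.
move=> hP hQ i; rewrite coefM; apply: rpred_sum => k _.
by have := dhomogM (hP k) (hQ (i - k)%N); rewrite subnKC // -ltnS.
Qed.

Lemma graded_prod I (r : seq I) (p : pred I) (P : I -> {poly A}) :
  (forall i, p i -> graded (P i)) -> graded (\prod_(i <- r | p i) P i).
Proof.
move=> h; apply: (big_ind graded) => //; last exact: gradedM.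
by move=> [|i]; rewrite coef1 ?dhomog1 // dhomog0.
Qed.

Lemma gradedX P i : graded P -> graded (P ^+ i).
Proof.
by move=> h; rewrite -(card_ord i) -prodr_const; exact: graded_prod.
Qed.

(** Setting z = 1 merges the homogeneous parts, but the monomial l occurs only in degree |l|. This
    links the definitions, which have no z, to series in z. *)
Lemma mcoeff_graded P l : graded P -> mcoeff l P.[1] = mcoeff l P`_(mdeg l).
Proof.
move=> h; rewrite horner_coef raddf_sum /=.
have [lP|lP] := ltnP (mdeg l) (size P).
  rewrite (bigD1 (Ordinal lP)) //= expr1n mulr1 big1 ?addr0 // => i il.
  rewrite expr1n mulr1 (dhomog_nemf_coeff (h i)) // eq_sym.
  by apply: contra il => /eqP il; apply/eqP/val_inj.
rewrite nth_default // mcoeff0 big1 // => i _.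
rewrite expr1n mulr1 (dhomog_nemf_coeff (h i)) // gtn_eqF //.
by rewrite (leq_trans (ltn_ord i)).
Qed.

End Graded.

Section Forms.
Variables (R : realType) (q : nat).
Local Notation C := R[i].
Local Notation A := (mpoly q.-1 C).
Implicit Types (l : multinom q.-1) (m : 'I_q -> R).

Lemma dhomog_wform (j : 'I_q) : wform R j \is @ishomog1 q.-1 C 1 mdeg.
Proof. by apply: rpred_sum => k _; rewrite dhomogZ // dhomogX /= mdeg1. Qed.

Lemma dhomog_wformX (j : 'I_q) i : wform R j ^+ i \is @ishomog1 q.-1 C i mdeg.
Proof. by rewrite -[X in ishomog1 X]mul1n dhomogMn // dhomog_wform. Qed.

Lemma sum_wform : \sum_(j < q) wform R j = 0.
Proof.
rewrite /wform exchange_big big1 //= => k _.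
by rewrite -scaler_suml sum_theta ?scale0r //= shift_subproof.
Qed.

(** These are the weights of the Hermite products in (iii); [krawtchouk_dual] identifies them with
    the Krawtchouk values of the formula. *)
Definition wcoeff l (a : 'I_q -> nat) : C := mcoeff l (\prod_(j < q) wform R j ^+ a j).

(** The product over j of the series c_j taken at z w_j. *)
Definition wseries (c : 'I_q -> nat -> C) : nat -> A :=
  \big[@conv A/@conv1 A]_(j < q) (fun i => c j i *: wform R j ^+ i).

Lemma mcoeff_wseries l (c : 'I_q -> nat -> C) n :
  mcoeff l (wseries c n) =
  \sum_(a : bmultinom q n.+1 | mdeg a == n) (\prod_(j < q) c j (a j)) * wcoeff l a.
Proof.
rewrite /wseries (bigconvE _ (ltnSn n)) raddf_sum /=.
by apply: eq_bigr => a _; rewrite scaler_prod mcoeffZ.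
Qed.

Lemma wseries_conv (c d : 'I_q -> nat -> C) :
  wseries (fun j => conv (c j) (d j)) = conv (wseries c) (wseries d).
Proof.
rewrite /wseries -big_split /=; apply: eq_bigr => j _; apply/funext => n.
rewrite /conv scaler_suml; apply: eq_bigr => i _.
rewrite -scalerAl -scalerAr scalerA -exprD subnKC //.
by rewrite -ltnS.
Qed.

Lemma krawtchoukE l m :
  krawtchouk l m = mcoeff l (wseries (fun j i => (gbinom (m j) i)%:C) (mdeg l)).
Proof.
rewrite /wseries (bigconv_coef _ (ltnSn (mdeg l))) -mcoeff_graded.
  rewrite horner_prod /krawtchouk; congr mcoeff; apply: eq_bigr => j _.
  by rewrite horner_poly; apply: eq_bigr => i _; rewrite expr1n mulr1.
apply: graded_prod => j _ i; rewrite coef_poly; case: ifP => _; last exact: dhomog0.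
by rewrite dhomogZ // dhomog_wformX.
Qed.

(** The linear part of the exponent is given the factor z and the quadratic part z^2, which makes
    its powers graded; z = 1 gives back [gf_exponent]. *)
Lemma gf_coeffE m l : gf_coeff m l =
  mcoeff l (hermite_seq (\sum_(j < q) (m j)%:C *: wform R j)
                        (\sum_(j < q) (q%:R^-1 : C) *: wform R j ^+ 2) (mdeg l)).
Proof.
rewrite -(@psubst_hermite_seq C A _ _ (mdeg l)) // -mcoeff_graded.
  rewrite horner_sum /gf_coeff /psubst; congr mcoeff; apply: eq_bigr => i _.
  rewrite hornerM hornerC horner_exp hornerD !hornerZ hornerX hornerXn expr1n !mulr1.
  rewrite mulr_algl; congr (_ *: _ ^+ _); rewrite /gf_exponent addrC; congr (_ + _).
  by rewrite -scaler_sumr scalerA invfM mulNr.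
have hL : graded ((\sum_(j < q) (m j)%:C *: wform R j) *: 'X + (- (2^-1 : C) *: (\sum_(j < q) (q%:R^-1 : C) *: wform R j ^+ 2)) *: 'X^2).
  move=> i; rewrite coefD !coefZ coefX coefXn.
  apply: dhomogD.
    have [->|_] := eqVneq i 1%N; last by rewrite mulr0 dhomog0.
    by rewrite mulr1; apply: rpred_sum => j _; rewrite dhomogZ // dhomog_wform.
  have [->|_] := eqVneq i 2%N; last by rewrite mulr0 dhomog0.
  rewrite mulr1 dhomogZ //; apply: rpred_sum => j _.
  by rewrite dhomogZ // dhomog_wformX.
move=> k; rewrite coef_sum; apply: rpred_sum => i _.
by rewrite coefCM mulr_algl dhomogZ // gradedX.
Qed.

Lemma hermiteE n (x : R) :
  n`!%:R^-1 * hermite q n x = @hermite_seq R R^o x q%:R^-1 n.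
Proof.
rewrite /hermite mulKf ?pnatr_eq0 -?lt0n ?fact_gt0 //.
rewrite -(@psubst_hermite_seq R R^o _ _ n) // /psubst.
apply: (congr1 (fun p : {poly R} => p`_n)).
apply: eq_bigr => i _; rewrite mul_polyC.
rewrite (_ : (i`!%:R^-1)%:A = i`!%:R^-1); last exact: mulr1.
by rewrite addrC invfM -mulNr; congr (_ *: _ ^+ _).
Qed.

Lemma ode_hermite (x : R) :
  ode 0 x q%:R^-1 (fun n => (n`!%:R)^-1 * hermite q n x).
Proof.
under eq_fun do rewrite hermiteE.
exact: ode_hermite_seq.
Qed.

(** The exponent is a sum over j, so its exponential splits into the Hermite generating functions
    taken at z w_j. This is the passage from (ii) to the sum over a of (iii). *)
Lemma hermite_wseries m :
  hermite_seq (\sum_(j < q) (m j)%:C *: wform R j)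
    (\sum_(j < q) (q%:R^-1 : C) *: wform R j ^+ 2) =
  wseries (fun j n => ((n`!%:R)^-1 * hermite q n (m j))%:C).
Proof.
rewrite -bigconv_hermite_seq; apply: eq_bigr => j _.
apply: ode_uniq (ode_hermite_seq _ _) _.
have := ode_scale (wform R j) (ode_rmorph (real_complex R) (ode_hermite (m j))).
by rewrite rmorph0 scale0r fmorphV rmorph_nat.
Qed.

End Forms.

Section FiniteLimits.
Variables (T : Type) (F : set_system T) (FF : Filter F).

Lemma cvg_sum_fin (K : numFieldType) (V : normedModType K) (I : Type) (r : seq I)
    (P : pred I) (f : I -> T -> V) (a : I -> V) :
  (forall i, P i -> f i x @[x --> F] --> a i) ->
  (\sum_(i <- r | P i) f i x) @[x --> F] --> \sum_(i <- r | P i) a i.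
Proof. by move=> h; apply: cvg_big => //; exact: add_continuous. Qed.

Lemma cvg_prod_fin (K : numFieldType) (I : Type) (r : seq I)
    (P : pred I) (f : I -> T -> K) (a : I -> K) :
  (forall i, P i -> f i x @[x --> F] --> a i) ->
  (\prod_(i <- r | P i) f i x) @[x --> F] --> \prod_(i <- r | P i) a i.
Proof. by move=> h; apply: cvg_big => //; exact: mul_continuous. Qed.

Lemma cvg_real_complex (R : realType) (f : T -> R) (a : R) :
  f x @[x --> F] --> a -> ((f x)%:C : R[i]^o) @[x --> F] --> (a%:C : R[i]^o).
Proof.
move=> /cvgrPdist_lt h; apply/cvgrPdist_lt => /= -[e e'].
(* A positive element for the order on complex numbers is real, so e reduces to its real part. *)
rewrite ltcE /= => /andP[/eqP -> e0]; near=> x.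
rewrite -rmorphB /= normc_def /= expr0n addr0 sqrtr_sqr ltcR.
by near: x; exact: h.
Unshelve. all: by end_near.
Qed.

End FiniteLimits.

Lemma cvg_sqrtV (R : realType) : (Num.sqrt d%:R)^-1 @[d --> \oo] --> (0 : R).
Proof.
have h : (d%:R : R)^-1 @[d --> \oo] --> (0 : R).
  rewrite (@gtr0_cvgV0 _ _ \oo _ (fun d : nat => (d%:R : R))); first exact: cvgr_idn.
  by near=> d; rewrite ltr0n; near: d; exact: nbhs_infty_gt.
rewrite -(sqrtr0 R); under eq_fun => d do rewrite -sqrtrV ?ler0n //.
exact: (continuous_cvg _ (@sqrt_continuous R 0) h).
Unshelve. all: by end_near.
Qed.

Section KrawtchoukLimit.
Variables (R : realType) (q : nat).
Hypothesis q0 : (0 < q)%N.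
Local Notation C := R[i].
Implicit Types (l : multinom q.-1) (m : 'I_q -> R).

Lemma ode_gbinom (x s : R) : ode s (x * s) 0 (fun i => gbinom x i * s ^+ i).
Proof.
split=> [||n]; rewrite /gbinom.
- by rewrite big_ord0 expr0 divr1 mulr1.
- by rewrite big_ord1 subr0 expr1 divr1.
rewrite mul0r subr0 big_ord_recr /= factS natrM -[LHS]mulr_natl.
rewrite exprS -(mulr_natl s).
have : n.+2%:R != 0 :> R by rewrite pnatr_eq0.
have : n.+1`!%:R != 0 :> R by rewrite pnatr_eq0 -lt0n fact_gt0.
by move: (n.+2%:R) (n.+1`!%:R) => a b b0 a0; field; rewrite a0 b0.
Qed.

(* The coefficients of (1 + s z) ^ (x / s + 1 / (q s ^ 2)) * exp (- z / (q s)). *)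
Definition centered_binom (s x : R) : nat -> R :=
  conv (fun i => gbinom (x / s + (q%:R * s ^+ 2)^-1) i * s ^+ i)
       (@expseq R R^o (- (q%:R * s)^-1)).

(** The binomial factor contributes x + 1 / (q s) to a and the exponential - 1 / (q s): the terms
    that blow up as s tends to 0 cancel. The exponential also contributes s / (q s) = 1 / q to b.
    Only the parameter s of the equation still depends on d. *)
Lemma ode_centered_binom s x : s != 0 -> ode s x q%:R^-1 (centered_binom s x).
Proof.
move=> s0.
have := ode_conv (ode_gbinom (x / s + (q%:R * s ^+ 2)^-1) s)
  (@ode_expseq R R^o s (- (q%:R * s)^-1)).
congr ode; first by field; rewrite s0 pnatr_eq0 -lt0n.
by rewrite add0r mulrN opprK invfM mulrCA mulfV // mulr1.
Qed.

(** Induction on two consecutive indices: the recursion expresses each coefficient continuously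
    through s and the two previous ones. The equation is assumed eventually because d = 0 gives s =
    0, which [ode_centered_binom] excludes. *)
Lemma cvg_ode (s : nat -> R) a b (u : nat -> nat -> R) (h : nat -> R) :
  (\forall d \near \oo, ode (s d) a b (u d)) -> s @ \oo --> 0 -> ode 0 a b h ->
  forall n, u d n @[d --> \oo] --> h n.
Proof.
move=> odeu s0 [h0 h1 hS] n.
suff : u d n @[d --> \oo] --> h n /\ u d n.+1 @[d --> \oo] --> h n.+1 by case.
elim: n => [|n [IH1 IH2]].
  by split; apply: (@cvg_trans _ _ (nbhs _)) => //; [rewrite h0|rewrite h1];
    apply: cvg_near_cst; near=> d; have [] : ode (s d) a b (u d) by near: d.
split=> //.
have -> : h n.+2 = ((a - 0 *+ n.+1) * h n.+1 - b * h n) / n.+2%:R.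
  by rewrite -hS -[h _ *+ _]mulr_natr mulfK ?pnatr_eq0.
apply: (@cvg_trans _ ((((a - s d *+ n.+1) * u d n.+1 - b * u d n) / n.+2%:R) @[d --> \oo])).
  apply: near_eq_cvg; near=> d.
  have [_ _ <-] : ode (s d) a b (u d) by near: d.
  by rewrite -[u _ _ *+ _]mulr_natr mulfK ?pnatr_eq0.
apply: cvgMr_tmp; apply: cvgB; last exact: cvgMl_tmp.
apply: cvgM => //; apply: cvgB; first exact: cvg_cst.
rewrite -(mulr_natr 0); under eq_fun => d do rewrite -(mulr_natr (s d)).
exact: cvgMr_tmp.
Unshelve. all: by end_near.
Qed.

Lemma wseries_expseq (y : R) :
  wseries (fun _ : 'I_q => real_complex R \o @expseq R R^o y) = @conv1 (mpoly q.-1 C).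
Proof.
have -> : @conv1 (mpoly q.-1 C) = expseq (\sum_(j < q) y%:C *: wform R j).
  by rewrite -scaler_sumr sum_wform scaler0 expseq0.
rewrite -bigconv_expseq; apply: eq_bigr => j _; apply/funext => i /=.
rewrite /expseq exprZn scalerA; congr (_ *: _).
by rewrite rmorphM fmorphV rmorphXn /= rmorph_nat.
Qed.

(** With s = 1 / sqrt d, the exponent d / q + sqrt d m_j is m_j / s + 1 / (q s^2), and the factor
    d^(-|l|/2) = s^|l| is absorbed by taking the series at s z. The exponentials inserted to center
    the factors multiply to 1 by [wseries_expseq]. *)
Lemma krawtchouk_seqE l m d : (0 < d)%N ->
  krawtchouk_seq l m d = mcoeff l (wseries (fun j =>
    real_complex R \o centered_binom (Num.sqrt d%:R)^-1 (m j)) (mdeg l)).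
Proof.
move=> d0; rewrite /krawtchouk_seq krawtchoukE.
set s := (Num.sqrt d%:R)^-1.
have sd : Num.sqrt d%:R = s^-1 by rewrite invrK.
have d0' : (0 : R) < d%:R by rewrite ltr0n.
have s0 : s != 0 by rewrite invr_eq0 sqrtr_eq0 -ltNge.
have sd2 : d%:R = s ^- 2 :> R by rewrite exprVn invrK sqr_sqrtr // ltW.
have -> : d%:R `^ (- ((mdeg l)%:R / 2)) = s ^+ mdeg l.
  rewrite powRN mulrC powRrM powR12_sqrt ?ltW // powR_mulrn ?sqrtr_ge0 //.
  by rewrite exprVn.
pose c j : nat -> C := fun i => s%:C ^+ i *
  (gbinom (d%:R / q%:R + Num.sqrt d%:R * m j) i)%:C.
pose e : nat -> C := real_complex R \o @expseq R R^o (- (q%:R * s)^-1).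
have -> : (fun j => real_complex R \o centered_binom s (m j)) = (fun j => conv (c j) e).
  apply/funext => j; apply/funext => n /=; rewrite /centered_binom /conv rmorph_sum.
  apply: eq_bigr => i _; rewrite rmorphM /= /c.
  have -> : d%:R / q%:R + Num.sqrt d%:R * m j = m j / s + (q%:R * s ^+ 2)^-1.
    by rewrite sd sd2; field; rewrite s0 pnatr_eq0 -lt0n.
  by rewrite rmorphM rmorphXn [_ ^+ _ * _]mulrC.
rewrite (@wseries_conv R q c (fun=> e)) wseries_expseq convC conv1l.
rewrite rmorphXn mulrC -mcoeffZ /wseries; congr mcoeff.
rewrite -mul_mpolyC rmorphXn -bigconvZ.
apply: (congr1 (fun f : nat -> mpoly q.-1 C => f (mdeg l))); apply: eq_bigr => j _.
apply/funext => i; rewrite /c -scalerA -[RHS]mul_mpolyC.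
by rewrite -rmorphXn.
Qed.

Lemma cvg_krawtchouk_seq l m : krawtchouk_seq l m @ \oo --> (gf_coeff m l : C^o).
Proof.
rewrite gf_coeffE hermite_wseries mcoeff_wseries.
apply: (@cvg_trans _ ((\sum_(a : bmultinom q (mdeg l).+1 | mdeg a == mdeg l)
   (\prod_(j < q) (real_complex R \o centered_binom (Num.sqrt d%:R)^-1 (m j)) (a j)) * wcoeff R l a : C^o) @[d --> \oo])).
  by apply: near_eq_cvg; near=> d; rewrite krawtchouk_seqE ?mcoeff_wseries //; near: d; exact: nbhs_infty_gt.
apply: cvg_sum_fin => a _; apply: cvgMr_tmp; apply: cvg_prod_fin => j _.
apply: cvg_real_complex.
apply: (@cvg_ode (fun d => (Num.sqrt d%:R)^-1) (m j) q%:R^-1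
  (fun d => centered_binom (Num.sqrt d%:R)^-1 (m j)) _ _ (@cvg_sqrtV R) (ode_hermite _ _)).
near=> d; apply: ode_centered_binom.
rewrite invr_eq0 sqrtr_eq0 -ltNge ltr0n.
by near: d; exact: nbhs_infty_gt.
Unshelve. all: by end_near.
Qed.

Lemma krawtchouk_limE l m : krawtchouk_lim l m = gf_coeff m l.
Proof.
by apply: cvg_lim (@cvg_krawtchouk_seq l m) => //; exact: norm_hausdorff.
Qed.

End KrawtchoukLimit.

(** * Two families of variables, and the duality behind (iii) *)

Section Tensor.
Variables (n : nat) (K : idomainType).
Implicit Types (l : multinom n) (p : mpoly n K).
Local Notation A := (mpoly (n + n) K).

Definition mjoin l l' : multinom (n + n) :=
  Multinom [tuple match fintype.split i with inl j => l j | inr j => l' j end | i < n + n].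

Lemma mjoinl l l' i : mjoin l l' (lshift n i) = l i.
Proof. by rewrite mnm_tnth tnth_mktuple; case: split_ordP => j /eqP;
  rewrite ?eq_lshift ?eq_lrshift // => /eqP ->. Qed.

Lemma mjoinr l l' i : mjoin l l' (rshift n i) = l' i.
Proof. by rewrite mnm_tnth tnth_mktuple; case: split_ordP => j /eqP;
  rewrite ?eq_rshift ?eq_rlshift // => /eqP ->. Qed.

Lemma mjoin_inj l l' a a' : (mjoin l l' == mjoin a a') = (l == a) && (l' == a').
Proof.
apply/eqP/andP => [e|[/eqP -> /eqP ->] //]; split; apply/eqP/mnmP => i.
  by rewrite -(mjoinl l l') e mjoinl.
by rewrite -(mjoinr l l') e mjoinr.
Qed.

Definition inl_mpoly : mpoly n K -> A :=
  mmap (@mpolyC (n + n) K) (fun i => mpolyX K (mnm1 (lshift n i))).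
Definition inr_mpoly : mpoly n K -> A :=
  mmap (@mpolyC (n + n) K) (fun i => mpolyX K (mnm1 (rshift n i))).
HB.instance Definition _ := GRing.RMorphism.on inl_mpoly.
HB.instance Definition _ := GRing.RMorphism.on inr_mpoly.

Lemma inl_mpolyZ c p : inl_mpoly (c *: p) = c *: inl_mpoly p.
Proof. by rewrite /inl_mpoly mmapZ mul_mpolyC. Qed.

Lemma inr_mpolyZ c p : inr_mpoly (c *: p) = c *: inr_mpoly p.
Proof. by rewrite /inr_mpoly mmapZ mul_mpolyC. Qed.

Lemma inl_mpoly_sum (I : Type) (r : seq I) (P : pred I) (F : I -> mpoly n K) :
  inl_mpoly (\sum_(i <- r | P i) F i) = \sum_(i <- r | P i) inl_mpoly (F i).
Proof. by rewrite raddf_sum. Qed.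

Lemma inr_mpoly_sum (I : Type) (r : seq I) (P : pred I) (F : I -> mpoly n K) :
  inr_mpoly (\sum_(i <- r | P i) F i) = \sum_(i <- r | P i) inr_mpoly (F i).
Proof. by rewrite raddf_sum. Qed.

Lemma inl_mpolyX l l' : inl_mpoly (mpolyX K l) * inr_mpoly (mpolyX K l') = mpolyX K (mjoin l l').
Proof.
rewrite /inl_mpoly /inr_mpoly !mmapX /mmap1 [RHS]mpolyXE_id big_split_ord /=.
by congr (_ * _); apply: eq_bigr => i _; rewrite ?mjoinl ?mjoinr.
Qed.

(** With separate copies of the variables, a product of two coefficients is a single coefficient, so
    sums and expectations can be taken before it is extracted. *)
Lemma mcoeff_tensor l l' p p' :
  mcoeff (mjoin l l') (inl_mpoly p * inr_mpoly p') = mcoeff l p * mcoeff l' p'.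
Proof.
rewrite {1}(mpolyE p) {1}(mpolyE p') !raddf_sum /= big_distrlr /= raddf_sum /=.
rewrite [in RHS](mpolyE p) [in RHS](mpolyE p') !raddf_sum /= big_distrlr /=.
apply: eq_bigr => a _; rewrite raddf_sum; apply: eq_bigr => b _.
rewrite inl_mpolyZ inr_mpolyZ -scalerAl -scalerAr scalerA inl_mpolyX /=.
rewrite !mcoeffZ !mcoeffX mjoin_inj -mulnb natrM; ring.
Qed.

End Tensor.

Arguments inl_mpoly : simpl never.
Arguments inr_mpoly : simpl never.

Lemma mcoeff_prod_expseq (n : nat) (K : numFieldType) (l l' : multinom n) (I : finType) (p r : I -> mpoly n K) (k : I -> nat) :
  mcoeff (mjoin l l') (\prod_i expseq (inl_mpoly (p i) * inr_mpoly (r i)) (k i)) =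
  ((\prod_i (k i)`!)%:R)^-1 *
    (mcoeff l (\prod_i p i ^+ k i) * mcoeff l' (\prod_i r i ^+ k i)).
Proof.
rewrite -mcoeff_tensor !rmorph_prod -big_split scaler_prod mcoeffZ prodfV.
apply: f_equal2 => //; apply: f_equal; apply: eq_bigr => i _.
rewrite exprMn; apply: f_equal2; last by rewrite rmorphXn.
by rewrite rmorphXn.
Qed.

Section Duality.
Variables (R : realType) (n : nat).
Local Notation C := R[i].
Local Notation q := n.+1.
Local Notation A := (mpoly (n + n) C).
Implicit Types (l : multinom n) (a : multinom q).

Lemma shift_lift (k : 'I_n) : @Defs.shift q k = lift ord0 k.
Proof. exact: val_inj. Qed.

Lemma mdeg_mplus a : mdeg a = (a ord0 + mdeg (mplus a))%N.
Proof.
rewrite !mdegE big_ord_recl; congr addn; apply: eq_bigr => k _.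
by rewrite -shift_lift [RHS]mnm_tnth tnth_mktuple.
Qed.

(** The dropped entry a[0] is recovered from the degree. *)
Lemma mplus_inj a b : mdeg a = mdeg b -> mplus a = mplus b -> a = b.
Proof.
rewrite !mdeg_mplus => + ab; rewrite ab => /addIn ab0.
apply/mnmP => j; case: (unliftP ord0 j) => [k ->|-> //].
by move/mnmP/(_ k): ab; rewrite [LHS]mnm_tnth [RHS]mnm_tnth !tnth_mktuple shift_lift.
Qed.

Lemma count_vector_lift l (k : 'I_n) : @count_vector q l (lift ord0 k) = l k.
Proof. by rewrite (mnm_nth 0). Qed.

(* Both sides of [a! / l! * Q_(a+)(l) = wcoeff l a] are read off the expansion
   of the power N = |l| of \sum_(j < q) v_j (\sum_k w_k theta_k^j), with v_0 = 1,
   according to the powers of the v_j and of the w_k, respectively. *)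
Let v (j : 'I_q) : mpoly n C := oapp (fun k => mpolyX C (mnm1 k)) 1 (unlift ord0 j).

Let bilin : A := \sum_(j < q) inl_mpoly (wform R j) * inr_mpoly (v j).

Let v0 : v ord0 = 1.
Proof. by rewrite /v unlift_none. Qed.

Let vS k : v (lift ord0 k) = mpolyX C (mnm1 k).
Proof. by rewrite /v liftK. Qed.

(** The symmetry theta_k^j = theta_j^k exchanges the two families; the row of index 0, where all
    powers of theta are 1, supplies the constant 1 of the factors 1 + w_k that define the Krawtchouk
    polynomials. *)
Let swap_forms (B : comAlgType C) (x y : 'I_n -> B) :
  \sum_(k < n) theta R q (@Defs.shift q k) ^+ (ord0 : 'I_q) *: x k +
  \sum_(i < n) (\sum_(k < n) theta R q (@Defs.shift q k) ^+ (lift ord0 i : 'I_q) *: x k) * y i =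
  \sum_(k < n) x k * (1 + \sum_(i < n) theta R q (@Defs.shift q i) ^+ (lift ord0 k : 'I_q) *: y i).
Proof.
under [RHS]eq_bigr do rewrite mulrDr mulr1.
rewrite [RHS]big_split; congr (_ + _) => /=.
  by apply: eq_bigr => k _; rewrite expr0 scale1r.
under eq_bigr do rewrite big_distrl /=.
rewrite exchange_big; apply: eq_bigr => k _; rewrite big_distrr; apply: eq_bigr => i _ /=.
by rewrite -scalerAl -scalerAr theta_sym.
Qed.

Let inl_wform (j : 'I_q) : inl_mpoly (wform R j) =
  \sum_(k < n) theta R q (@Defs.shift q k) ^+ j *: inl_mpoly (mpolyX C (mnm1 k)).
Proof. by rewrite /wform raddf_sum; apply: eq_bigr => k _; exact: inl_mpolyZ. Qed.

Let inr_wform (j : 'I_q) : inr_mpoly (wform R j) =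
  \sum_(k < n) theta R q (@Defs.shift q k) ^+ j *: inr_mpoly (mpolyX C (mnm1 k)).
Proof. by rewrite /wform raddf_sum; apply: eq_bigr => k _; exact: inr_mpolyZ. Qed.

Let bilinE : bilin = \sum_(k < n) inl_mpoly (mpolyX C (mnm1 k)) *
   inr_mpoly (1 + wform R (lift ord0 k)).
Proof.
rewrite /bilin big_ord_recl v0 inl_wform.
apply: etrans (_ : _ = _) (etrans (swap_forms (fun k => inl_mpoly (mpolyX C (mnm1 k)))
  (fun i => inr_mpoly (mpolyX C (mnm1 i)))) _).
  apply: f_equal2; first by rewrite rmorph1 mulr1.
  by apply: eq_bigr => i _; rewrite vS inl_wform.
by apply: eq_bigr => k _; congr (_ * _); rewrite -inr_wform rmorphD rmorph1.
Qed.

Let coef_bilin_w a l : mcoeff (mjoin l (mplus a)) (expseq bilin (mdeg l)) =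
  ((\prod_k (l k)`!)%:R)^-1 * mcoeff (mplus a) (\prod_k (1 + wform R (lift ord0 k)) ^+ l k).
Proof.
have hl : (mdeg l < (mdeg l).+1)%N by [].
have E (b : multinom n) : mcoeff (mjoin l (mplus a))
    (\prod_(k < n) expseq (inl_mpoly (mpolyX C (mnm1 k)) * inr_mpoly (1 + wform R (lift ord0 k))) (b k)) =
    ((\prod_k (b k)`!)%:R)^-1 * ((b == l)%:R *
      mcoeff (mplus a) (\prod_(k < n) (1 + wform R (lift ord0 k)) ^+ b k)).
  by rewrite mcoeff_prod_expseq -mpolyXE_id mcoeffX.
rewrite bilinE -(sum_expr_fact _ hl) raddf_sum.
rewrite (eq_bigr _ (fun (b : bmultinom n (mdeg l).+1) _ => E b)).
rewrite (bigD1 (BMultinom hl)) //= eqxx mul1r [X in _ + X]big1 ?addr0 // => b /andP[_ bl].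
by rewrite (negbTE (_ : _ != l)) ?mul0r ?mulr0.
Qed.

Let prod_v (b : multinom q) : \prod_(j < q) v j ^+ b j = mpolyX C (mplus b).
Proof.
rewrite big_ord_recl v0 expr1n mul1r mpolyXE_id; apply: eq_bigr => k _.
by rewrite vS [in RHS]mnm_tnth tnth_mktuple shift_lift.
Qed.

(** As v_0 = 1, the monomial in the v_j shows only the entries of b other than b[0]; the fixed
    degree restores b[0], so that only b = a contributes. *)
Let coef_bilin_v a l : mdeg a = mdeg l ->
  mcoeff (mjoin l (mplus a)) (expseq bilin (mdeg l)) =
  ((\prod_j (a j)`!)%:R)^-1 * @wcoeff R q l a.
Proof.
move=> al; have hl : (mdeg a < (mdeg l).+1)%N by rewrite al.
have E (b : multinom q) : mcoeff (mjoin l (mplus a))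
    (\prod_(j < q) expseq (inl_mpoly (wform R j) * inr_mpoly (v j)) (b j)) =
    ((\prod_j (b j)`!)%:R)^-1 * (@wcoeff R q l b * (mplus b == mplus a)%:R).
  by rewrite mcoeff_prod_expseq prod_v mcoeffX.
rewrite /bilin -(sum_expr_fact _ (ltnSn (mdeg l))) raddf_sum.
rewrite (eq_bigr _ (fun (b : bmultinom q (mdeg l).+1) _ => E b)).
rewrite (bigD1 (BMultinom hl)) ?al //= eqxx mulr1 [X in _ + X]big1 ?addr0 // => b /andP[/eqP bl ba].
rewrite (negbTE (_ : mplus b != mplus a)) ?mulr0 //; apply: contra ba => /eqP ba.
by apply/eqP/val_inj/mplus_inj => //=; rewrite bl.
Qed.

Lemma krawtchouk_dual a l : mdeg a = mdeg l ->
  (\prod_(j < q) (a j)`!)%:R / (\prod_(j < q) (@count_vector q l j)`!)%:R *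
    @krawtchouk R q (mplus a) (fun j => (@count_vector q l j)%:R) =
  @wcoeff R q l a.
Proof.
move=> al; rewrite krawtchouk_nat.
have -> : (\prod_(j < q) (@count_vector q l j)`! = \prod_k (l k)`!)%N.
  by rewrite big_ord_recl mul1n; apply: eq_bigr => k _; rewrite count_vector_lift.
have -> : \prod_(j < q) (1 + wform R j) ^+ (@count_vector q l j) =
    \prod_k (1 + wform R (lift ord0 k)) ^+ l k.
  by rewrite big_ord_recl mul1r; apply: eq_bigr => k _; rewrite count_vector_lift.
rewrite -mulrA -coef_bilin_w coef_bilin_v // mulVKf //.
by rewrite pnatr_eq0 -lt0n prodn_gt0 // => j; exact: fact_gt0.
Qed.

End Duality.

Lemma krawtchouk_lim_formulaE (R : realType) q (q0 : (0 < q)%N) (l : multinom q.-1) (m : 'I_q -> R) :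
  krawtchouk_lim_formula l m = gf_coeff m l.
Proof.
case: q q0 l m => // n _ l m.
rewrite gf_coeffE hermite_wseries mcoeff_wseries.
apply: eq_bigr => a /eqP al; rewrite -mulrA krawtchouk_dual //.
by rewrite rmorph_prod.
Qed.

(** * Gaussian moments *)

Section NormalMgf.
Variable R : realType.
Local Notation mu := (@lebesgue_measure R).

(** Change of variables holds for the Radon-Nikodym derivative, which agrees almost everywhere with
    the density because both have the same integral over every measurable set. *)
Lemma ge0_integral_normal_prob (m s : R) (f : _ -> \bar R) :
  measurable_fun setT f -> (forall x, (0 <= f x)%E) ->
  (\int[normal_prob m s]_x f x =
   \int[mu]_x (f x * (normal_pdf m s x)%:E))%E.
Proof.
move=> mf f0; have dom := normal_prob_dominates m s.
rewrite -(Radon_Nikodym_SigmaFinite.change_of_variables dom) //.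
have mpdf : measurable_fun setT (EFin \o normal_pdf m s).
  by apply/measurable_EFinP; exact: measurable_normal_pdf.
have intf := Radon_Nikodym_SigmaFinite.f_integrable dom.
apply: ae_eq_integral => //.
- apply: emeasurable_funM => //; exact: measurable_int intf.
- exact: emeasurable_funM.
- apply: ae_eqe_mul2l; apply: integral_ae_eq => //.
  by move=> E _ mE; rewrite -Radon_Nikodym_SigmaFinite.f_integral.
Qed.

Lemma normal_prob_mgf (m s t : R) : s != 0 ->
  (\int[normal_prob m s]_x (expR (t * x))%:E =
   (expR (m * t + s ^+ 2 * t ^+ 2 / 2))%:E)%E.
Proof.
move=> s0; rewrite ge0_integral_normal_prob; last 2 first.
- by apply/measurable_EFinP; apply: measurableT_comp => //; exact: measurable_funM.
- by move=> x; rewrite lee_fin expR_ge0.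
(* Completing the square: exp (t x) times the density is a constant times the normal density of mean
   m + s^2 t, whose integral is 1. *)
transitivity (\int[mu]_x ((expR (m * t + s ^+ 2 * t ^+ 2 / 2))%:E *
    (normal_pdf (m + s ^+ 2 * t) s x)%:E))%E.
  apply: eq_integral => x _; rewrite !normal_pdfE // -!EFinM /normal_fun; congr EFin.
  rewrite mulrCA [RHS]mulrCA; congr (_ * _).
  rewrite -!expRD; congr expR; field.
  by rewrite s0.
rewrite integralZl ?integral_normal_pdf ?mule1 //.
exact: integrable_normal_pdf.
Qed.

End NormalMgf.

Section RandomVariables.
Context d (T : measurableType d) (R : realType) (P : probability T R).
Implicit Types (f g Y : T -> R) (a b : R).

Lemma univ_normal_mgf Y m s t : measurable_fun setT Y ->
  (forall A, measurable A -> P (Y @^-1` A) = univ_normal m s A) ->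
  (\int[P]_w (expR (t * Y w))%:E = (expR (m * t + s ^+ 2 * t ^+ 2 / 2))%:E)%E.
Proof.
move=> mY hY.
have mf : measurable_fun setT (fun x : measurableTypeR R => (expR (t * x))%:E).
  by apply/measurable_EFinP; apply: measurableT_comp => //; exact: measurable_funM.
pose Y' : T -> measurableTypeR R := Y.
have mY' : measurable_fun setT Y' by [].
rewrite -(@ge0_integral_pushforward _ _ _ _ _ Y' mY' P setT (fun x => (expR (t * x))%:E)) //.
have [s0|s0] := eqVneq s 0.
  rewrite (eq_measure_integral (@dirac _ (measurableTypeR R) m R)) => [|A mA _]; last first.
    by apply: etrans (hY A mA) _; rewrite /univ_normal s0 eqxx.
  by rewrite integral_dirac // diracT mul1e s0 expr0n !mul0r addr0 mulrC.
rewrite (eq_measure_integral (normal_prob m s)) => [|A mA _]; last first.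
  by apply: etrans (hY A mA) _; rewrite /univ_normal (negbTE s0).
exact: normal_prob_mgf.
Qed.

(* [f] is integrable, with expectation [a]. *)
Definition isE f a := P.-integrable setT (EFin \o f) /\ (\int[P]_w (f w)%:E = a%:E)%E.

Lemma isE_cst a : isE (cst a) a.
Proof.
split; first exact: finite_measure_integrable_cst.
by have := expectation_cst P a; rewrite unlock.
Qed.

Lemma isED f g a b : isE f a -> isE g b -> isE (fun w => f w + g w) (a + b).
Proof.
move=> [fi fa] [gi gb]; split; first by have := integrableD measurableT fi gi.
by rewrite EFinD -fa -gb -(integralD measurableT fi gi).
Qed.

Lemma isEZ c f a : isE f a -> isE (fun w => c * f w) (c * a).
Proof.
move=> [fi fa]; split; first by have := integrableZl measurableT c fi.
by rewrite EFinM -fa -(integralZl measurableT fi).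
Qed.

Lemma isEB f g a b : isE f a -> isE g b -> isE (fun w => f w - g w) (a - b).
Proof.
move=> fa /(isEZ (-1)) gb; have := isED fa gb; rewrite mulN1r.
by congr isE; apply/funext => w; rewrite mulN1r.
Qed.

Lemma isE_sum (I : Type) (r : seq I) (p : pred I) (f : I -> T -> R) (a : I -> R) :
  (forall i, p i -> isE (f i) (a i)) ->
  isE (fun w => \sum_(i <- r | p i) f i w) (\sum_(i <- r | p i) a i).
Proof.
move=> h; rewrite (_ : (fun w => _) = \sum_(i <- r | p i) f i); last first.
  by apply/funext => w; rewrite fct_sumE.
apply: (big_ind2 isE) => //; first exact: isE_cst.
by move=> *; exact: isED.
Qed.

Lemma isE_le f g a b : isE f a -> isE g b -> (forall w, f w <= g w) -> a <= b.
Proof.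
move=> [fi fa] [gi gb] fg; rewrite -lee_fin -fa -gb.
by apply: le_integral => // w _; rewrite lee_fin.
Qed.

Lemma isE_uniq f a b : isE f a -> isE f b -> a = b.
Proof. by move=> [_ fa] [_]; rewrite fa => -[]. Qed.

Lemma isE_abs_le f g a b : isE f a -> isE g b -> (forall w, `|f w| <= g w) -> `|a| <= b.
Proof.
move=> fa gb fg; rewrite ler_norml; apply/andP; split.
  rewrite -[- b]mulN1r; apply: isE_le (isEZ (-1) gb) fa _ => w.
  by have := fg w; rewrite ler_norml mulN1r => /andP[].
by apply: isE_le fa gb _ => w; apply: le_trans (fg w); exact: ler_norm.
Qed.

Lemma isE_dominated f g b : measurable_fun setT f -> isE g b ->
  (forall w, `|f w| <= g w) -> isE f (fine (\int[P]_w (f w)%:E)%E).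
Proof.
move=> mf [gi _] fg.
have fi : P.-integrable setT (EFin \o f).
  apply: le_integrable gi => //; first exact/measurable_EFinP.
  by move=> w _ /=; rewrite lee_fin (le_trans (fg w)) // ler_norm.
by split=> //; rewrite fineK // integrable_fin_num.
Qed.

Lemma isE_ge0 f a : measurable_fun setT f -> (forall w, 0 <= f w) ->
  (\int[P]_w (f w)%:E = a%:E)%E -> isE f a.
Proof.
move=> mf f0 fa; split=> //; apply/integrableP; split; first exact/measurable_EFinP.
by under eq_integral do rewrite /= ger0_norm //; rewrite fa ltry.
Qed.

End RandomVariables.

(** * Taylor expansions of the exponential and uniqueness of their coefficients *)

Section ExpBounds.
Variable R : realType.
Implicit Types (x t : R) (n : nat).

Lemma lim_norm_le (u : nat -> R) l b : u @ \oo --> l ->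
  (\forall n \near \oo, `|u n| <= b) -> `|l| <= b.
Proof.
move=> ul ub.
exact: (closed_cvg (fun x : R => x <= b) (@closed_le R b) ub _ (cvg_norm ul)).
Qed.

Lemma series_exp_le x n : 0 <= x -> series (exp_coeff x) n <= expR x.
Proof.
move=> x0; apply: nondecreasing_cvgn_le (is_cvg_series_exp_coeff x) n.
by apply: nondecreasing_series => k _ _; exact: exp_coeff_ge0.
Qed.

Lemma exprn_le_expR x n : 0 <= x -> x ^+ n <= n`!%:R * expR x.
Proof.
move=> x0; rewrite mulrC -ler_pdivrMr ?ltr0n ?fact_gt0 //.
apply: le_trans (series_exp_le n.+1 x0).
rewrite /series /= big_nat_recr //= lerDr; apply: sumr_ge0 => i _.
exact: exp_coeff_ge0.
Qed.

(** As (n + i)! >= i!, the terms from n on are at most y^n times those of the full series. *)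
Lemma exp_tail (y : R) n m : 0 <= y -> \sum_(n <= k < m) exp_coeff y k <= y ^+ n * expR y.
Proof.
move=> y0; have [mn|/ltnW nm] := leqP m n.
  by rewrite big_geq // mulr_ge0 ?exprn_ge0 ?expR_ge0.
rewrite -{1}[n]add0n big_addn.
apply: (@le_trans _ _ (\sum_(0 <= i < m - n) y ^+ n * exp_coeff y i)).
  apply: ler_sum => i _; rewrite /exp_coeff /= exprD [_ * y ^+ n]mulrC -mulrA.
  rewrite ler_wpM2l ?exprn_ge0 // ler_wpM2l ?exprn_ge0 //.
  by rewrite lef_pV2 ?posrE ?ltr0n ?fact_gt0 // ler_nat leq_fact // leq_addr.
by rewrite -big_distrr ler_wpM2l ?exprn_ge0 // series_exp_le.
Qed.

Lemma expR_taylor x n :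
  `|expR x - series (exp_coeff x) n| <= `|x| ^+ n * expR `|x|.
Proof.
apply: (@lim_norm_le (fun k => series (exp_coeff x) k - series (exp_coeff x) n)).
  by apply: cvgB; [exact: is_cvg_series_exp_coeff|exact: cvg_cst].
near=> k.
have nk : (n <= k)%N by near: k; exact: nbhs_infty_ge.
rewrite /series /= (big_cat_nat (leq0n n) nk) /= addrAC subrr add0r.
apply: le_trans (ler_norm_sum _ _ _) _; apply: le_trans (exp_tail n k (normr_ge0 x)).
by apply: ler_sum => i _; rewrite /exp_coeff /= normrM normrX normfV normr_nat.
Unshelve. all: by end_near.
Qed.

Lemma expR_norm_le x : expR `|x| <= expR x + expR (- x).
Proof.
have [x0|x0] := leP 0 x; first by rewrite ger0_norm // lerDl expR_ge0.
by rewrite ltr0_norm // lerDr expR_ge0.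
Qed.

(** The k-th term of the series of cos or sin is, up to sign, one of the terms 2k and 2k + 1 of exp
    |x|. The resulting bound on partial sums does not depend on n, as dominated convergence
    requires. *)
Lemma series_exp_coeff_pairs (c : nat -> R) x n :
  (forall k, `|c k| <= exp_coeff `|x| k.*2 + exp_coeff `|x| k.*2.+1) ->
  `|series c n| <= expR `|x|.
Proof.
move=> hc; apply: le_trans (series_exp_le n.*2 (normr_ge0 x)).
elim: n => [|n IH]; first by rewrite /series /= !big_geq // normr0.
rewrite /series /= in IH *; rewrite big_nat_recr //= doubleS !big_nat_recr //=.
by apply: le_trans (ler_normD _ _) _; rewrite -addrA lerD.
Qed.

(** Induction on n: the top term is O(t^n) and can be moved into the bound, so the lower
    coefficients vanish; the original bound then gives |b n| <= C t for all small t. *)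
Lemma poly_small (b : nat -> R) n C :
  (forall t, 0 < t <= 1 -> `|\sum_(k < n) b k * t ^+ k| <= C * t ^+ n) ->
  forall k, (k < n)%N -> b k = 0.
Proof.
elim: n C => // n IH C h.
have hb k : (k < n)%N -> b k = 0.
  apply: (IH (C + `|b n|)) => t /[dup] t01 /andP[t0 t1].
  have := h t t01; rewrite big_ord_recr /= => h1.
  rewrite -[\sum_(_ < _) _](addrK (b n * t ^+ n)).
  apply: le_trans (ler_normB _ _) _; rewrite mulrDl lerD //.
    apply: le_trans h1 _; rewrite exprS mulrCA ler_piMl //.
    by have := le_trans (normr_ge0 _) (h t t01); rewrite exprS mulrCA pmulr_rge0.
  by rewrite normrM (ger0_norm (exprn_ge0 _ (ltW t0))).
move=> k; rewrite ltnS leq_eqVlt => /orP[/eqP ->|]; last exact: hb.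
have hn t : 0 < t <= 1 -> `|b n| <= C * t.
  move=> /[dup] t01 /andP[t0 t1]; have := h t t01; rewrite big_ord_recr /= big1 => [|i _].
    rewrite add0r normrM (ger0_norm (exprn_ge0 _ (ltW t0))) exprS mulrA.
    by rewrite ler_pM2r // exprn_gt0.
  by rewrite hb // mul0r.
apply/eqP; rewrite -normr_le0; apply/ler_addgt0Pl => e e0; rewrite addr0.
have C1 : 0 < `|C| + 1 by rewrite ltr_wpDl.
(* For this t the bound C t is at most e; the 1 added to |C| keeps the denominator positive. *)
pose t := Num.min 1 (e / (`|C| + 1)).
have t0 : 0 < t by rewrite lt_min ltr01 divr_gt0.
apply: (le_trans (hn t _)); first by rewrite t0 ge_min lexx.
have : (`|C| + 1) * t <= e by rewrite mulrC -ler_pdivlMr // ge_min lexx orbT.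
apply: le_trans; rewrite ler_pM2r //; apply: le_trans (ler_norm C) _.
by rewrite lerDl.
Qed.

End ExpBounds.

(** Taylor coefficients are characterised by the order of the remainder, so moments are read off the
    moment generating function without differentiating under the integral. *)
Lemma taylor_uniq (R : realType) (F : R -> R) (b b' : nat -> R) n C C' :
  (forall t, 0 < t <= 1 -> `|F t - \sum_(k < n) b k * t ^+ k| <= C * t ^+ n) ->
  (forall t, 0 < t <= 1 -> `|F t - \sum_(k < n) b' k * t ^+ k| <= C' * t ^+ n) ->
  forall k, (k < n)%N -> b k = b' k.
Proof.
move=> h h' k kn; apply/eqP; rewrite -subr_eq0; apply/eqP.
apply: (@poly_small _ (fun k => b k - b' k) n (C + C')) kn => t t01.
rewrite (_ : \sum_(_ < _) _ = (F t - \sum_(k < n) b' k * t ^+ k) - (F t - \sum_(k < n) b k * t ^+ k)).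
  by rewrite mulrDl [C * _ + _]addrC (le_trans (ler_normB _ _)) // lerD ?h ?h'.
rewrite opprB addrC subrKA -sumrB; apply: eq_bigr => i _.
by rewrite mulrBl.
Qed.

Lemma expseq2_even (R : realType) (x : R) n :
  \sum_(k < n.*2) expseq2 (x : R^o) k * 1 = series (exp_coeff x) n.
Proof.
elim: n => [|n IH]; first by rewrite big_ord0 /series /= big_geq.
rewrite doubleS !big_ord_recr /= IH /series /= big_nat_recr //=.
rewrite /expseq2 /= odd_double /= mul0r addr0 mulr1 doubleK /expseq /exp_coeff /=.
by rewrite mulrC.
Qed.

Lemma expseq2_scale (R : realType) (x t : R) k :
  expseq2 (t ^+ 2 * x : R^o) k = expseq2 (x : R^o) k * t ^+ k.
Proof.
rewrite /expseq2; case: ifPn => [_|ko]; first by rewrite mul0r.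
rewrite /expseq exprMn -exprM mul2n even_halfK //.
by rewrite !regular_scaleE; ring.
Qed.

Section Moments.
Context d (T : measurableType d) (R : realType) (P : probability T R).
Variables (Y : T -> R) (m tau : R).
Hypothesis mY : measurable_fun setT Y.
Hypothesis mgfY : forall t, (\int[P]_w (expR (t * Y w))%:E =
  (expR (m * t + tau * t ^+ 2 / 2))%:E)%E.
Hypothesis tau0 : 0 <= tau.
Local Notation isE := (isE P).

Lemma isE_exp t : isE (fun w => expR (t * Y w)) (expR (m * t + tau * t ^+ 2 / 2)).
Proof.
apply: isE_ge0 => [||]; last exact: mgfY.
  by apply: measurableT_comp => //; exact: measurable_funM.
by move=> w; exact: expR_ge0.
Qed.

(** Dominates |Y|^n e^|Y|, as |Y|^n <= n! e^|Y| and e^(2|Y|) <= e^(2Y) + e^(-2Y). *)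
Let bnd n w := n`!%:R * (expR (2 * Y w) + expR (- 2 * Y w)).

Let isE_bnd n : isE (bnd n) (n`!%:R * (expR (m * 2 + tau * 2 ^+ 2 / 2) +
  expR (m * (- 2) + tau * (- 2) ^+ 2 / 2))).
Proof. by apply: isEZ; apply: isED; exact: isE_exp. Qed.

Let bndP n w : `|Y w| ^+ n * expR `|Y w| <= bnd n w.
Proof.
apply: (@le_trans _ _ (n`!%:R * (expR `|Y w| * expR `|Y w|))).
  by rewrite mulrA ler_wpM2r ?expR_ge0 // exprn_le_expR.
rewrite ler_wpM2l // -expRD.
have -> : `|Y w| + `|Y w| = `|2 * Y w| by rewrite normrM ger0_norm //; ring.
have -> : - 2 * Y w = - (2 * Y w) by ring.
exact: expR_norm_le.
Qed.

Lemma isE_moment_def n : isE (fun w => Y w ^+ n) (fine (\int[P]_w (Y w ^+ n)%:E)%E).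
Proof.
apply: (isE_dominated _ (isE_bnd n)); first exact: measurable_funX.
move=> w; rewrite normrX (le_trans _ (bndP n w)) // ler_peMr ?exprn_ge0 //.
by rewrite -[leLHS]expR0 ler_expR.
Qed.

Let mom n := fine (\int[P]_w (Y w ^+ n)%:E)%E.

(** For t <= 1 the remainder of exp (t Y) at order n is at most t^n |Y|^n e^|Y|, which integrates to
    a constant times t^n. *)
Let taylor_mgf n : exists C, forall t, 0 < t <= 1 ->
  `|expR (m * t + tau * t ^+ 2 / 2) - \sum_(k < n) (mom k / k`!%:R) * t ^+ k| <= C * t ^+ n.
Proof.
exists (n`!%:R * (expR (m * 2 + tau * 2 ^+ 2 / 2) +
  expR (m * (- 2) + tau * (- 2) ^+ 2 / 2))) => t /andP[t0 t1].
have h1 : isE (fun w => expR (t * Y w) - series (exp_coeff (t * Y w)) n)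
   (expR (m * t + tau * t ^+ 2 / 2) - \sum_(k < n) (mom k / k`!%:R) * t ^+ k).
  rewrite (_ : (fun w => _) = (fun w => expR (t * Y w) - \sum_(k < n) (t ^+ k / k`!%:R) * Y w ^+ k)).
    apply: isEB (isE_exp t) _.
    rewrite (eq_bigr (fun k : 'I_n => (t ^+ k / k`!%:R) * mom k)) => [|k _]; last by ring.
    by apply: isE_sum => k _; apply: isEZ; exact: isE_moment_def.
  apply/funext => w; rewrite /series /= big_mkord; congr (_ - _).
  by apply: eq_bigr => k _; rewrite /exp_coeff /= exprMn mulrAC.
rewrite [leRHS]mulrC; apply: (isE_abs_le h1 (isEZ (t ^+ n) (isE_bnd n))) => w.
apply: le_trans (expR_taylor _ _) _.
rewrite normrM (gtr0_norm t0) exprMn -mulrA ler_wpM2l ?exprn_ge0 ?(ltW t0) //.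
apply: le_trans (bndP n w); rewrite ler_wpM2l ?exprn_ge0 // ler_expR.
by rewrite ler_piMl.
Qed.

Lemma mean_mgf : isE Y m.
Proof.
have := isE_moment_def 1; congr isE; rewrite -/(mom 1).
have [C hC] := taylor_mgf 2.
pose x t := m * t + tau * t ^+ 2 / 2.
pose D := `|m| + tau.
have D0 : 0 <= D by rewrite addr_ge0.
(* The exponent satisfies |x t| <= D t: D^2 e^D bounds the remainder of exp at order 2, and tau the
   quadratic term of x. *)
have h2 t : 0 < t <= 1 -> `|expR (x t) - \sum_(k < 2) (if k == 0%N :> nat then 1 else m) * t ^+ k| <=
    (D ^+ 2 * expR D + tau) * t ^+ 2.
  move=> /andP[t0 t1]; rewrite !big_ord_recr big_ord0 /= add0r expr0 expr1 mulr1.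
  have xD : `|x t| <= D * t.
    rewrite /x mulrDl (le_trans (ler_normD _ _)) // lerD //.
      by rewrite normrM (gtr0_norm t0).
    rewrite ger0_norm; last by rewrite divr_ge0 // mulr_ge0 // exprn_ge0 // ltW.
    rewrite -mulrA ler_wpM2l // expr2 -mulrA ler_piMr //; first exact: ltW.
    by rewrite ler_pdivrMr // (le_trans t1) // mul1r ler1n.
  have -> : expR (x t) - (1 + m * t) = (expR (x t) - series (exp_coeff (x t)) 2) + tau * t ^+ 2 / 2.
    rewrite /series /= !big_nat_recr // big_geq //= /exp_coeff /= /x expr0 expr1 !divr1; ring.
  apply: le_trans (ler_normD _ _) _; rewrite mulrDl lerD //.
    apply: le_trans (expR_taylor _ _) _.
    rewrite [leRHS]mulrAC ler_pM ?exprn_ge0 ?expR_ge0 //.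
      by rewrite -exprMn ler_sqr ?nnegrE // mulr_ge0 // ltW.
    by rewrite ler_expR (le_trans xD) // ler_piMr.
  rewrite ger0_norm; last by rewrite divr_ge0 // mulr_ge0 // exprn_ge0 // ltW.
  by rewrite ler_piMr ?mulr_ge0 ?exprn_ge0 ?(ltW t0) // invf_le1 // ler1n.
have := @taylor_uniq R _ (fun k => mom k / k`!%:R) (fun k => if k == 0%N then 1 else m) 2 _ _ hC h2 1 isT.
by rewrite /= divr1.
Qed.

Lemma moment_mgf n : m = 0 -> isE (fun w => Y w ^+ n / n`!%:R) (expseq2 (tau / 2 : R^o) n).
Proof.
move=> m0; have h := isEZ (n`!%:R^-1) (isE_moment_def n).
rewrite (_ : (fun w => _) = (fun w => n`!%:R^-1 * Y w ^+ n)); last first.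
  by apply/funext => w; rewrite mulrC.
move: h; congr isE; rewrite -/(mom n).
(* The order 2 (n + 1) exceeds n and is even, so the truncated series in t is a partial sum of the
   series of exp at tau t^2 / 2. *)
have [C hC] := taylor_mgf n.+1.*2.
have h2 t : 0 < t <= 1 -> `|expR (m * t + tau * t ^+ 2 / 2) -
    \sum_(k < n.+1.*2) expseq2 (tau / 2 : R^o) k * t ^+ k| <= ((tau / 2) ^+ n.+1 * expR (tau / 2)) * t ^+ n.+1.*2.
  move=> /andP[t0 t1]; rewrite m0 mul0r add0r.
  have -> : tau * t ^+ 2 / 2 = t ^+ 2 * (tau / 2) by ring.
  rewrite (eq_bigr (fun k : 'I_ _ => expseq2 (t ^+ 2 * (tau / 2) : R^o) k * 1)) => [|k _]; last first.
    by rewrite mulr1 expseq2_scale.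
  rewrite expseq2_even; apply: le_trans (expR_taylor _ _) _.
  have tau2 : 0 <= tau / 2 by rewrite divr_ge0.
  have t2 : 0 <= t ^+ 2 by rewrite exprn_ge0 // ltW.
  rewrite (ger0_norm (mulr_ge0 t2 tau2)) exprMn -exprM mul2n [leRHS]mulrC -mulrA.
  rewrite ler_wpM2l ?exprn_ge0 ?(ltW t0) // ler_wpM2l ?exprn_ge0 // ler_expR.
  by rewrite ler_piMl // exprn_ile1 // ltW.
have nn : (n < n.+1.*2)%N by rewrite -addnn ltn_addr.
by rewrite -(@taylor_uniq R _ (fun k => mom k / k`!%:R) (@expseq2 R R^o (tau / 2)) _ _ _ hC h2 n nn) mulrC.
Qed.

End Moments.

Lemma isE_cvg d (T : measurableType d) (R : realType) (P : probability T R)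
    (u : nat -> T -> R) (f g : T -> R) (a : nat -> R) b l :
  measurable_fun setT f -> (forall n, isE P (u n) (a n)) -> isE P g b ->
  (forall n w, `|u n w| <= g w) -> (forall w, u ^~ w @ \oo --> f w) ->
  a @ \oo --> l -> isE P f l.
Proof.
move=> mf ua [gi _] ug uf al.
have cvgE (v : nat -> R) c : v @ \oo --> c -> (v n)%:E @[n --> \oo] --> c%:E.
  by move=> vc; apply: cvg_EFin => //; exact: nearW.
have [] := @dominated_convergence _ _ _ P setT measurableT
  (fun n w => (u n w)%:E) (EFin \o f) (EFin \o g).
- by move=> n; have [/measurable_int] := ua n.
- exact/measurable_EFinP.
- by apply: aeW => w _; exact: cvgE.
- exact: gi.
- by apply: aeW => w n _; rewrite /= lee_fin.
move=> fi _ cvgf; split=> //; apply: (cvg_unique _ cvgf) => //.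
rewrite (_ : [sequence _]_n = EFin \o a); last by apply/funext => n /=; exact: (ua n).2.
exact: cvgE.
Qed.

Section GaussianTrig.
Context d (T : measurableType d) (R : realType) (P : probability T R).
Variables (Y : T -> R) (tau : R).
Hypothesis mY : measurable_fun setT Y.
Hypothesis mgfY : forall t, (\int[P]_w (expR (t * Y w))%:E =
  (expR (0 * t + tau * t ^+ 2 / 2))%:E)%E.
Hypothesis tau0 : 0 <= tau.
Local Notation isE := (isE P).

Let dom w : R := expR (1 * Y w) + expR (- 1 * Y w).

Let isE_dom : isE dom (expR (0 * 1 + tau * 1 ^+ 2 / 2) + expR (0 * -1 + tau * (-1) ^+ 2 / 2)).
Proof. by apply: isED; exact: isE_exp. Qed.

Let domP w : expR `|Y w| <= dom w.
Proof. by rewrite /dom mul1r mulN1r expR_norm_le. Qed.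

(** The cosine series is integrated term by term under the integrable bound e^|Y| <= [dom]; the even
    moments rebuild the series of exp at - tau / 2. *)
Lemma isE_cos_gaussian : isE (fun w => cos (Y w)) (expR (- (tau / 2))).
Proof.
apply: (@isE_cvg _ _ _ _ (fun n w => series (cos_coeff' (Y w)) n) _ dom
   (series (exp_coeff (- (tau / 2))))) isE_dom _ _ _ => //.
- exact: measurableT_comp (continuous_measurable_fun (@continuous_cos R)) mY.
- move=> n; rewrite /series /= !big_mkord.
  rewrite (_ : (fun w => _) = (fun w => \sum_(k < n) (-1) ^+ k * (Y w ^+ k.*2 / k.*2`!%:R))); last first.
    apply/funext => w; rewrite big_mkord; apply: eq_bigr => k _.
    by rewrite /cos_coeff' -exprnP mulrA.
  apply: isE_sum => k _.
  have := isEZ ((-1) ^+ k) (moment_mgf mY mgfY tau0 k.*2 erefl).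
  congr isE; rewrite /expseq2 odd_double doubleK /expseq /exp_coeff /=.
  by rewrite regular_scaleE (exprNn (tau / 2)) -mulrA; congr (_ * _); exact: mulrC.
- move=> n w; apply: le_trans (domP w); apply: series_exp_coeff_pairs => k.
  rewrite /cos_coeff' -exprnP !normrM normrX normrN1 expr1n mul1r normrX normfV normr_nat.
  by rewrite lerDl exp_coeff_ge0.
- by move=> w; exact: cvg_cos_coeff'.
- exact: is_cvg_series_exp_coeff.
Qed.

Lemma isE_sin_gaussian : isE (fun w => sin (Y w)) 0.
Proof.
apply: (@isE_cvg _ _ _ _ (fun n w => series (sin_coeff' (Y w)) n) _ dom
   (fun=> 0)) isE_dom _ _ _ => //.
- exact: measurableT_comp (continuous_measurable_fun (@continuous_sin R)) mY.
- move=> n; rewrite /series /=.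
  rewrite (_ : (fun w => _) = (fun w => \sum_(k < n) (-1) ^+ k * (Y w ^+ k.*2.+1 / k.*2.+1`!%:R))); last first.
    apply/funext => w; rewrite big_mkord; apply: eq_bigr => k _.
    by rewrite /sin_coeff' -exprnP mulrA.
  rewrite [X in isE _ X](_ : _ = \sum_(k < n) 0); last by rewrite big1.
  apply: isE_sum => k _.
  have := isEZ ((-1) ^+ k) (moment_mgf mY mgfY tau0 k.*2.+1 erefl).
  by congr isE; rewrite /expseq2 /= odd_double /= mulr0.
- move=> n w; apply: le_trans (domP w).
  apply: series_exp_coeff_pairs => k.
  rewrite /sin_coeff' -exprnP !normrM normrX normrN1 expr1n mul1r normrX normfV normr_nat.
  by rewrite lerDr exp_coeff_ge0.
- by move=> w; exact: cvg_sin_coeff'.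
- exact: cvg_cst.
Qed.

End GaussianTrig.

Lemma normM_le_sqr (R : realFieldType) (x y : R) : `|x * y| <= x ^+ 2 + y ^+ 2.
Proof.
rewrite normrM -(real_normK (num_real x)) -(real_normK (num_real y)).
have := sqr_ge0 (`|x| - `|y|); have := sqr_ge0 (`|x| + `|y|).
rewrite !expr2; nra.
Qed.

Section AllMoments.
Context (R : realType) d (T : measurableType d) (P : probability T R).
Implicit Types f g : T -> R.

(** Having moments of all orders, unlike having one of a given order, is stable under products, as
    |f g|^n <= f^(2n) + g^(2n). *)
Definition all_moments f :=
  measurable_fun setT f /\ forall n, exists e, isE P (fun w => f w ^+ n) e.

Lemma all_momentsM f g : all_moments f -> all_moments g ->
  all_moments (fun w => f w * g w).
Proof.
move=> [mf hf] [mg hg]; have mfg : measurable_fun setT (fun w => f w * g w).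
  exact: measurable_funM.
split=> // n; have [ef hef] := hf (n * 2)%N; have [eg heg] := hg (n * 2)%N.
eexists; apply: (isE_dominated (measurable_funX n mfg) (isED hef heg)) => w.
by rewrite exprMn !exprM; exact: normM_le_sqr.
Qed.

Lemma all_moments_cst c : all_moments (cst c).
Proof. by split=> // n; exists (c ^+ n); exact: (isE_cst P (c ^+ n)). Qed.

Lemma all_momentsX f n : all_moments f -> all_moments (fun w => f w ^+ n).
Proof.
move=> hf; elim: n => [|n IH]; first exact: (all_moments_cst 1).
by under eq_fun do rewrite exprS; exact: all_momentsM.
Qed.

Lemma all_moments_prod (I : Type) (r : seq I) (p : pred I) (f : I -> T -> R) :
  (forall i, p i -> all_moments (f i)) -> all_moments (fun w => \prod_(i <- r | p i) f i w).
Proof.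
move=> h; rewrite (_ : (fun w => _) = \prod_(i <- r | p i) f i); last first.
  by apply/funext => w; rewrite fct_prodE.
by apply: (big_ind all_moments) => //; [exact: all_moments_cst|exact: all_momentsM].
Qed.

End AllMoments.

Section GaussianVector.
Context (R : realType) (q : nat) d (T : measurableType d) (P : probability T R).
Variable X : 'I_q -> {RV P >-> R}.
Hypothesis hX : multivariate_normal X.
Hypothesis hmean : forall a, ('E_P[X a] = 0)%E.
Hypothesis hcov : forall a b,
  covariance P (X a) (X b) = (q%:R^-1 * ((a == b)%:R - q%:R^-1))%:E.
Local Notation isE := (isE P).
Implicit Types t : 'I_q -> R.

Definition lincomb t (w : T) : R := \sum_(j < q) t j * X j w.

Definition limit_var t : R := \sum_(a < q) \sum_(b < q)
  t a * t b * (q%:R^-1 * ((a == b)%:R - q%:R^-1)).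

Lemma measurable_lincomb t : measurable_fun setT (lincomb t).
Proof. by apply: measurable_sum => j; apply: measurable_funM. Qed.

Let mgf t : exists m s : R, forall u, (\int[P]_w (expR (u * lincomb t w))%:E =
  (expR (m * u + s ^+ 2 * u ^+ 2 / 2))%:E)%E.
Proof.
have [m [s h]] := hX t; exists m, s => u.
exact: univ_normal_mgf (measurable_lincomb t) h.
Qed.

Let lincomb_delta a : lincomb (fun j => (j == a)%:R) = X a.
Proof.
apply/funext => w; rewrite /lincomb (bigD1 a) //= eqxx mul1r big1 ?addr0 // => j ja.
by rewrite (negbTE ja) mul0r.
Qed.

Let isE_X a : isE (X a) 0.
Proof.
have [m [s h]] := mgf (fun j => (j == a)%:R).
have := mean_mgf (measurable_lincomb _) h (sqr_ge0 s); rewrite lincomb_delta.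
by move=> [Xi _]; split=> //; have := hmean a; rewrite unlock.
Qed.

Let isE_XX a b : isE (fun w => X a w * X b w) (q%:R^-1 * ((a == b)%:R - q%:R^-1)).
Proof.
have sqr c : exists e, isE (fun w => X c w ^+ 2) e.
  have [m [s h]] := mgf (fun j => (j == c)%:R).
  have := isE_moment_def (measurable_lincomb _) h 2; rewrite lincomb_delta.
  by move=> hE; eexists; exact: hE.
have [ea ha] := sqr a; have [eb hb] := sqr b.
have mXX : measurable_fun setT (fun w => X a w * X b w) by exact: measurable_funM.
have bnd w : `|X a w * X b w| <= X a w ^+ 2 + X b w ^+ 2 by exact: normM_le_sqr.
have [XXi _] := isE_dominated mXX (isED ha hb) bnd.
split=> //; have := hcov a b; rewrite unlock /= !hmean /=.
rewrite unlock => <-; apply: eq_integral => w _; congr EFin.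
by rewrite -[RHS]/((X a w - 0) * (X b w - 0)) !subr0.
Qed.

(** [multivariate_normal] only provides some mean and deviation for each t. They are identified by
    comparing the first two moments of the normal law with those computed from [hmean] and
    [hcov]. *)
Lemma limit_varP t : 0 <= limit_var t /\ forall u, (\int[P]_w (expR (u * lincomb t w))%:E =
  (expR (0 * u + limit_var t * u ^+ 2 / 2))%:E)%E.
Proof.
have [m [s h]] := mgf t.
have mt := measurable_lincomb t.
have m0 : m = 0.
  apply: isE_uniq (mean_mgf mt h (sqr_ge0 s)) _.
  have -> : 0 = \sum_(j < q) t j * 0 :> R by rewrite big1 // => j _; rewrite mulr0.
  by apply: isE_sum => j _; exact: isEZ (isE_X j).
have sv : s ^+ 2 = limit_var t.
  have h1 := isEZ 2 (moment_mgf mt h (sqr_ge0 s) 2 m0).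
  have h2 : isE (fun w => lincomb t w ^+ 2) (limit_var t).
    rewrite (_ : (fun w => _) = fun w => \sum_a \sum_b t a * t b * (X a w * X b w)).
      by apply: isE_sum => a _; apply: isE_sum => b _; exact: isEZ (isE_XX a b).
    apply/funext => w; rewrite expr2 /lincomb big_distrlr /=.
    by apply: eq_bigr => a _; apply: eq_bigr => b _; ring.
  apply: isE_uniq _ h2; move: h1; congr isE.
    by apply/funext => w; rewrite mulrC divfK.
  by rewrite /expseq2 /= /expseq expr1 regular_scaleE invr1 mul1r mulrC divfK.
by rewrite -sv; split; [exact: sqr_ge0|move=> u; rewrite h m0].
Qed.

Lemma limit_varE t : limit_var t =
  q%:R^-1 * (\sum_(a < q) t a ^+ 2) - (q%:R^-1 * \sum_(a < q) t a) ^+ 2.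
Proof.
rewrite /limit_var exprMn expr2 [(\sum_(a < q) t a) ^+ 2]expr2 big_distrlr /= !big_distrr /= -sumrB.
apply: eq_bigr => a _; rewrite big_distrr /=.
under eq_bigr do rewrite mulrBr mulrBr.
rewrite sumrB; congr (_ - _); last by apply: eq_bigr => b _; ring.
rewrite (bigD1 a) //= eqxx [X in _ + X]big1 => [|b ba].
  by rewrite addr0 mulr1 expr2 mulrC.
by rewrite eq_sym (negbTE ba) !mulr0.
Qed.

Lemma isE_monomial (a : 'I_q -> nat) : exists e, isE (fun w => \prod_(j < q) X j w ^+ a j) e.
Proof.
have [_ /(_ 1%N)] : all_moments P (fun w => \prod_(j < q) X j w ^+ a j).
  apply: all_moments_prod => j _; apply: all_momentsX; split=> // n.
  have [m [s h]] := mgf (fun i => (i == j)%:R).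
  have := isE_moment_def (measurable_lincomb _) h n; rewrite lincomb_delta.
  by move=> hE; eexists; exact: hE.
by move=> [e he]; exists e.
Qed.

End GaussianVector.

(** * Polynomial identities and joint Gaussian moments *)

Section PolynomialIdentity.
Variables (n : nat) (K : numFieldType).
Implicit Types (p : mpoly n K) (t : 'I_n -> K).

(** The number with base-D digits f j, provided that these are below D. *)
Let code D m (f : 'I_m -> nat) := (\sum_(j < m) f j * D ^ j)%N.

Let code_inj D m (f g : 'I_m -> nat) :
  (forall j, f j < D)%N -> (forall j, g j < D)%N -> code D f = code D g -> f =1 g.
Proof.
elim: m f g => [|m IH] f g hf hg; first by move=> _ [].
have codeS (h : 'I_m.+1 -> nat) :
    code D h = (h ord0 + D * code D (fun j => h (lift ord0 j)))%N.
  rewrite /code big_ord_recl expn0 muln1; congr addn.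
  by rewrite big_distrr; apply: eq_bigr => j _; rewrite /= expnS mulnCA.
rewrite !codeS => e.
have D0 : (0 < D)%N by apply: leq_trans (hf ord0).
have e0 : f ord0 = g ord0.
  by have := congr1 (modn^~ D) e; rewrite ![(D * _)%N]mulnC ![(_ + _ * D)%N]addnC !modnMDl !modn_small.
have eS : code D (fun j => f (lift ord0 j)) = code D (fun j => g (lift ord0 j)).
  by move: e; rewrite e0 => /addnI/eqP; rewrite eqn_pmul2l // => /eqP.
move=> j; case: (unliftP ord0 j) => [k ->|-> //].
exact: (IH (fun j => f (lift ord0 j)) (fun j => g (lift ord0 j))).
Qed.

Lemma poly_vanish (Q : {poly K}) : (forall s : nat, Q.[s%:R] = 0) -> Q = 0.
Proof.
move=> h; apply: (@roots_geq_poly_eq0 _ _ [seq (i%:R : K) | i <- iota 0 (size Q)]).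
- by apply/allP => x /mapP[i _ ->]; apply/eqP; exact: h.
- by rewrite map_inj_uniq ?iota_uniq // => i j /eqP; rewrite eqr_nat => /eqP.
- by rewrite size_map size_iota.
Qed.

(** Kronecker's substitution of s^(D^j) for the j-th variable: with D above all exponents of p,
    distinct monomials become distinct powers of s, and a univariate polynomial that vanishes at all
    natural numbers is zero. *)
Lemma mpoly_vanish p : (forall t, meval t p = 0) -> p = 0.
Proof.
move=> h.
pose D := (\max_(a <- msupp p) \max_(j < n) a j).+1.
have aD (a : multinom n) j : a \in msupp p -> (a j < D)%N.
  move=> ap; rewrite ltnS; apply: (@leq_trans (\max_(j < n) a j)).
    exact: (leq_bigmax (F := fun j => a j)).
  exact: (leq_bigmax_seq (P := xpredT) (F := fun a : multinom n => \max_(j < n) a j)%N).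
pose Q : {poly K} := \sum_(a <- msupp p) mcoeff a p *: 'X^(code D a).
have Q0 : Q = 0.
  apply: poly_vanish => s; rewrite -[RHS](h (fun j => s%:R ^+ (D ^ j))) mevalE.
  rewrite /Q horner_sum; apply: eq_bigr => a _; rewrite hornerZ hornerXn; congr (_ * _).
  by rewrite /code expr_sum; apply: eq_bigr => j _; rewrite mulnC exprM.
apply/mpolyP => a; rewrite mcoeff0.
have [ap|ap] := boolP (a \in msupp p); last exact: memN_msupp_eq0.
have := congr1 (fun P : {poly K} => P`_(code D a)) Q0.
rewrite coef0 /Q coef_sum (bigD1_seq a) ?msupp_uniq //= coefZ coefXn eqxx mulr1.
rewrite big_seq_cond big1 ?addr0 // => b /andP[bp ba].
rewrite coefZ coefXn; case: eqP => [e|_]; last by rewrite mulr0.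
case/eqP: ba; apply/mnmP; apply/fsym; apply: code_inj e => j; exact: aD.
Qed.

End PolynomialIdentity.

Section MomentPolynomial.
Context (R : realType) (q : nat) d (T : measurableType d) (P : probability T R).
Variable X : 'I_q -> {RV P >-> R}.
Hypothesis hX : multivariate_normal X.
Hypothesis hmean : forall a, ('E_P[X a] = 0)%E.
Hypothesis hcov : forall a b,
  covariance P (X a) (X b) = (q%:R^-1 * ((a == b)%:R - q%:R^-1))%:E.

Definition moment (a : 'I_q -> nat) : R := fine (\int[P]_w (\prod_(j < q) X j w ^+ a j)%:E)%E.

Lemma isE_moment a : isE P (fun w => \prod_(j < q) X j w ^+ a j) (moment a).
Proof. by have [e [ei ee]] := isE_monomial hX a; split=> //; rewrite /moment ee. Qed.

(** The variance of sum_j t_j X_j in the shape of [limit_varE]: the square of the sum of the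
    variables stands apart because it will be evaluated at forms of sum zero. *)
Definition var_mpoly : mpoly q R := (q%:R^-1 : R) *: (\sum_(j < q) mpolyX R (mnm1 j) ^+ 2) -
  ((q%:R^-1 : R) *: \sum_(j < q) mpolyX R (mnm1 j)) ^+ 2.

(** At each real t both sides are the n-th moment of the linear combination divided by n!, the left
    one being expanded into joint moments. *)
Lemma moment_poly n :
  \sum_(a : bmultinom q n.+1 | mdeg a == n)
    moment a *: \prod_(j < q) expseq (mpolyX R (mnm1 j)) (a j) =
  expseq2 ((2^-1 : R) *: var_mpoly) n.
Proof.
apply/eqP; rewrite -subr_eq0; apply/eqP; apply: mpoly_vanish => t.
rewrite mevalB; apply/eqP; rewrite subr_eq0; apply/eqP.
have [v0 mgf] := limit_varP hX hmean hcov t.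
have hE := moment_mgf (measurable_lincomb X t) mgf v0 n erefl.
have evX j : meval t (mpolyX R (mnm1 j)) = t j by exact: mevalXU.
have ev_expseq (p : mpoly q R) k : meval t (expseq p k) = expseq (meval t p : R^o) k.
  by rewrite /expseq mevalZ rmorphXn.
transitivity (expseq2 (limit_var t / 2 : R^o) n).
  apply: isE_uniq hE.
  rewrite (_ : (fun w => _) = fun w => \sum_(a : bmultinom q n.+1 | mdeg a == n)
     (\prod_(j < q) expseq (t j : R^o) (a j)) * \prod_(j < q) X j w ^+ a j).
    rewrite raddf_sum; apply: isE_sum => a _.
    rewrite [X in isE _ _ X](_ : _ = (\prod_(j < q) expseq (t j : R^o) (a j)) * moment a); last first.
      rewrite /= mevalZ rmorph_prod mulrC; congr (_ * _); apply: eq_bigr => j _.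
      by rewrite -evX -ev_expseq.
    by apply: isEZ; exact: isE_moment.
  apply/funext => w.
  transitivity (expseq (\sum_(j < q) t j * X j w : R^o) n).
    by rewrite mulrC.
  rewrite -(sum_expr_fact _ (ltnSn n)); apply: eq_bigr => a _.
  rewrite -big_split; apply: eq_bigr => j _ /=.
  by rewrite /expseq !regular_scaleE exprMn mulrA.
have -> : limit_var t / 2 = meval t ((2^-1 : R) *: var_mpoly).
  have ev_pow (p : mpoly q R) k : meval t (p ^+ k) = meval t p ^+ k by rewrite rmorphXn.
  have ev_sum (F : 'I_q -> mpoly q R) : meval t (\sum_(j < q) F j) = \sum_(j < q) meval t (F j).
    by rewrite raddf_sum.
  rewrite mevalZ [LHS]mulrC limit_varE /var_mpoly mevalB ev_pow !mevalZ !ev_sum.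
  under [in RHS]eq_bigr do rewrite ev_pow evX.
  by under [X in _ = _ * (_ - (_ * X) ^+ _)]eq_bigr do rewrite evX.
by rewrite /expseq2; case: ifP => _; rewrite ?meval0 ?ev_expseq.
Qed.

End MomentPolynomial.

(** * Characteristic functions *)

Section ReIm.
Variable R : realType.

Lemma Re_sum (I : Type) (r : seq I) (p : pred I) (F : I -> R[i]) :
  complex.Re (\sum_(i <- r | p i) F i) = \sum_(i <- r | p i) complex.Re (F i).
Proof. by apply: (big_morph (@complex.Re R)) => // -[? ?] []. Qed.

Lemma Im_sum (I : Type) (r : seq I) (p : pred I) (F : I -> R[i]) :
  complex.Im (\sum_(i <- r | p i) F i) = \sum_(i <- r | p i) complex.Im (F i).
Proof. by apply: (big_morph (@complex.Im R)) => // -[? ?] []. Qed.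

Lemma Re_realM (x : R) z : complex.Re (x%:C * z) = x * complex.Re z.
Proof. by case: z => a b /=; rewrite mul0r subr0. Qed.

Lemma Im_realM (x : R) z : complex.Im (x%:C * z) = x * complex.Im z.
Proof. by case: z => a b /=; rewrite mul0r addr0. Qed.

End ReIm.

Section TrigTaylor.
Variable R : realType.
Implicit Types (x y : R).

(** As (2k)! >= k!, the tail from k = 2 is dominated by that of the exponential series at x^2, to
    which [exp_tail] applies. *)
Lemma cos_taylor x : `|cos x - (1 - x ^+ 2 / 2)| <= x ^+ 4 * expR (x ^+ 2).
Proof.
apply: (@lim_norm_le _ (fun n => series (cos_coeff' x) n - (1 - x ^+ 2 / 2))).
  by apply: cvgB; [exact: cvg_cos_coeff'|exact: cvg_cst].
near=> n; have n2 : (2 <= n)%N by near: n; exact: nbhs_infty_ge.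
rewrite /series /= (big_cat_nat (leq0n 2) n2) /= !big_nat_recl // big_geq // addr0.
have -> : cos_coeff' x 0 + cos_coeff' x 1 = 1 - x ^+ 2 / 2.
  rewrite /cos_coeff' -!exprnP -[0.*2]/0%N -[1.*2]/2%N.
  by rewrite !expr0 expr1 divr1 mul1r mulN1r mulNr.
rewrite addrAC subrr add0r.
apply: le_trans (ler_norm_sum _ _ _) _.
apply: le_trans (_ : _ <= \sum_(2 <= k < n) exp_coeff (x ^+ 2) k) _; last first.
  by apply: le_trans (exp_tail _ _ (sqr_ge0 x)) _; rewrite -exprM.
apply: ler_sum => k _; rewrite /cos_coeff' /exp_coeff -exprnP /= !normrM normrX normrN1 expr1n mul1r.
rewrite -mul2n exprM normrX ger0_norm ?sqr_ge0 // normfV normr_nat.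
apply: ler_wpM2l; first exact: exprn_ge0 (sqr_ge0 x).
rewrite lef_pV2 ?posrE ?ltr0n ?fact_gt0 //.
by rewrite ler_nat leq_fact // leq_pmull.
Unshelve. all: by end_near.
Qed.

Lemma sin_taylor x : `|sin x - x| <= `|x| * x ^+ 2 * expR (x ^+ 2).
Proof.
apply: (@lim_norm_le _ (fun n => series (sin_coeff' x) n - x)).
  by apply: cvgB; [exact: cvg_sin_coeff'|exact: cvg_cst].
near=> n; have n1 : (1 <= n)%N by near: n; exact: nbhs_infty_ge.
rewrite /series /= (big_cat_nat (leq0n 1) n1) /= big_nat1.
have -> : sin_coeff' x 0 = x.
  by rewrite /sin_coeff' -exprnP -[0.*2.+1]/1%N expr0 mul1r expr1 divr1.
rewrite addrAC subrr add0r.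
apply: le_trans (ler_norm_sum _ _ _) _.
apply: le_trans (_ : _ <= \sum_(1 <= k < n) `|x| * exp_coeff (x ^+ 2) k) _; last first.
  rewrite -big_distrr -mulrA ler_wpM2l //.
  by apply: le_trans (exp_tail _ _ (sqr_ge0 x)) _.
apply: ler_sum => k _; rewrite /sin_coeff' /exp_coeff -exprnP /= !normrM normrX normrN1 expr1n mul1r.
rewrite exprS normrM -mulrA ler_wpM2l // -mul2n exprM normrX (ger0_norm (sqr_ge0 x)) normfV normr_nat.
apply: ler_wpM2l; first exact: exprn_ge0 (sqr_ge0 x).
rewrite lef_pV2 ?posrE ?ltr0n ?fact_gt0 //.
by rewrite ler_nat leq_fact // (leq_trans _ (leqnSn _)) // leq_pmull.
Unshelve. all: by end_near.
Qed.

Lemma dist_expr_le (K : numDomainType) (z w : K) n : `|z| <= 1 -> `|w| <= 1 ->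
  `|z ^+ n - w ^+ n| <= n%:R * `|z - w|.
Proof.
move=> z1 w1; rewrite subrXX normrM mulrC ler_wpM2r //.
apply: le_trans (ler_norm_sum _ _ _) _.
apply: le_trans (_ : _ <= \sum_(i < n) (1 : K)) _; last by rewrite sumr_const card_ord.
apply: ler_sum => i _; rewrite normrM !normrX.
by rewrite mulr_ile1 ?exprn_ge0 ?exprn_ile1.
Qed.

Lemma normc_le (z : R[i]) (a b : R) : `|complex.Re z| <= a -> `|complex.Im z| <= b ->
  `|z| <= (a + b)%:C.
Proof.
case: z => x y /= xa yb; have -> : x +i* y = x%:C + y%:C * 'i%C.
  by apply/eqP; rewrite eq_complex /= !mulr0 !mul0r !mulr1 subr0 addr0 !add0r ?addr0 !eqxx.
apply: le_trans (ler_normD _ _) _; rewrite normrM rmorphD lerD //.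
  by rewrite normc_def /= expr0n addr0 sqrtr_sqr lecR.
rewrite [`|'i%C|]normc_def /= expr0n expr1n add0r sqrtr1 mulr1.
by rewrite normc_def /= expr0n addr0 sqrtr_sqr lecR.
Qed.

End TrigTaylor.

Section CharacteristicLimit.
Variables (R : realType) (q : nat).
Hypothesis q0 : (0 < q)%N.
Variable s : 'I_q -> R.
Hypothesis s0 : \sum_(j < q) s j = 0.
Let v := q%:R^-1 * \sum_(j < q) s j ^+ 2.

(** Both quantities are d-th powers of numbers z and w of modulus at most 1, so they differ by at
    most d |z - w|. With r = 1 / sqrt d, the real parts of z and w agree up to r^4 and, as the s j
    sum to 0, the imaginary ones up to r^3; and d r^3 = r. *)
Lemma char_limit_bound : exists C : R, forall d : nat, (0 < d)%N ->
  `|(q%:R^-1 * \sum_(j < q) cis (s j / Num.sqrt d%:R)) ^+ d - (expR (- (v / 2)))%:C|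
  <= (C / Num.sqrt d%:R)%:C.
Proof.
pose K := \sum_(j < q) s j ^+ 2.
have K0 : 0 <= K by apply: sumr_ge0 => j _; exact: sqr_ge0.
have qR0 : (0 : R) < q%:R by rewrite ltr0n.
have sK j : s j ^+ 2 <= K.
  by rewrite /K (bigD1 j) //= lerDl; apply: sumr_ge0 => i _; exact: sqr_ge0.
have sK1 j : `|s j| <= 1 + K.
  have := sK j; rewrite -(real_normK (num_real (s j))) => h.
  have := sqr_ge0 (`|s j| - 1); nra.
have v0 : 0 <= v by rewrite mulr_ge0 ?invr_ge0.
(* The three terms bound the remainders of cos, exp and sin, in this order. *)
exists (K ^+ 2 * expR K + (v / 2) ^+ 2 * expR (v / 2) + (1 + K) * K * expR K) => d d0.
set r := (Num.sqrt d%:R)^-1.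
have dR0 : (0 : R) < d%:R by rewrite ltr0n.
have r0 : 0 < r by rewrite invr_gt0 sqrtr_gt0.
have r2 : r ^+ 2 = d%:R^-1 by rewrite exprVn sqr_sqrtr // ltW.
have r1 : r <= 1 by rewrite -(@expr_le1 _ 2) ?(ltW r0) // r2 invf_le1 // ler1n.
set z := q%:R^-1 * _; set w := (expR (- (v * r ^+ 2 / 2)))%:C.
have -> : (expR (- (v / 2)))%:C = w ^+ d.
  rewrite -rmorphXn -expRM_natl; congr (expR _)%:C.
  by rewrite r2; field; rewrite (gt_eqF dR0).
have avg (F : 'I_q -> R) b : (forall j, `|F j| <= b) -> `|q%:R^-1 * \sum_(j < q) F j| <= b.
  move=> h; rewrite normrM ger0_norm ?invr_ge0 // mulrC ler_pdivrMr //.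
  apply: le_trans (ler_norm_sum _ _ _) _; apply: le_trans (ler_sum _ (fun j _ => h j)) _.
  by rewrite sumr_const card_ord -[b *+ q]mulr_natr.
have z1 : `|z| <= 1.
  rewrite /z normrM ger0_norm ?invr_ge0 // mulrC ler_pdivrMr ?ltr0n // mul1r.
  apply: le_trans (ler_norm_sum _ _ _) _.
  by under eq_bigr do rewrite norm_cis; rewrite sumr_const card_ord.
have w1 : `|w| <= 1.
  rewrite normc_def /= expr0n addr0 sqrtr_sqr lecR ger0_norm ?expR_ge0 // -expR0 ler_expR.
  by rewrite oppr_le0 divr_ge0 // mulr_ge0 // sqr_ge0.
apply: le_trans (dist_expr_le d z1 w1) _.
have zE : z = (q%:R^-1)%:C * \sum_(j < q) cis (s j * r) by rewrite fmorphV rmorph_nat.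
have Rez : complex.Re z = q%:R^-1 * \sum_(j < q) cos (s j * r).
  by rewrite zE Re_realM Re_sum.
have Imz : complex.Im z = q%:R^-1 * \sum_(j < q) sin (s j * r).
  by rewrite zE Im_realM Im_sum.
have r20 : 0 <= r ^+ 2 by exact: sqr_ge0.
have sr j : (s j * r) ^+ 2 <= K * r ^+ 2 by rewrite exprMn ler_wpM2r.
have Kr : K * r ^+ 2 <= K by rewrite ler_piMr // exprn_ile1 // ltW.
have esr j : expR ((s j * r) ^+ 2) <= expR K by rewrite ler_expR (le_trans (sr j)).
have hRe : `|complex.Re (z - w)| <= (K ^+ 2 * expR K + (v / 2) ^+ 2 * expR (v / 2)) * r ^+ 4.
  have -> : complex.Re (z - w) = complex.Re z - expR (- (v * r ^+ 2 / 2)) by case: (z).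
  rewrite Rez.
  have -> : q%:R^-1 * (\sum_(j < q) cos (s j * r)) - expR (- (v * r ^+ 2 / 2)) =
    q%:R^-1 * (\sum_(j < q) (cos (s j * r) - (1 - (s j * r) ^+ 2 / 2))) -
    (expR (- (v * r ^+ 2 / 2)) - (1 - v * r ^+ 2 / 2)).
    have h0 : q%:R^-1 * (\sum_(j < q) (1 - (s j * r) ^+ 2 / 2)) = 1 - v * r ^+ 2 / 2.
      rewrite sumrB sumr_const card_ord mulrBr mulVf ?gt_eqF //; congr (_ - _).
      rewrite /v -mulr_suml; under eq_bigr do rewrite exprMn.
      by rewrite -mulr_suml; ring.
    by rewrite sumrB mulrBr h0; ring.
  apply: le_trans (ler_normB _ _) _; rewrite mulrDl lerD //.
    apply: avg => j; apply: le_trans (cos_taylor _) _.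
    rewrite [leRHS]mulrAC ler_pM ?expR_ge0 //; first by rewrite (exprM _ 2 2) sqr_ge0.
    rewrite (exprM _ 2 2) (exprM r 2 2) -exprMn ler_sqr ?nnegrE //; first exact: sqr_ge0.
    by rewrite mulr_ge0.
  have := expR_taylor (- (v * r ^+ 2 / 2)) 2.
  rewrite /series /= !big_nat_recr // big_geq //= /exp_coeff /= expr0 expr1 !divr1 add0r.
  rewrite normrN; have vr0 : 0 <= v * r ^+ 2 / 2 by rewrite divr_ge0 // mulr_ge0.
  rewrite (ger0_norm vr0); move/le_trans; apply.
  rewrite [leRHS]mulrAC ler_pM ?expR_ge0 ?sqr_ge0 //.
    by rewrite (exprM r 2 2) -exprMn mulrAC.
  by rewrite ler_expR mulrAC ler_piMr // ?divr_ge0 // exprn_ile1 // ltW.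
have hIm : `|complex.Im (z - w)| <= (1 + K) * K * expR K * r ^+ 3.
  have -> : complex.Im (z - w) = complex.Im z by case: (z) => a b /=; rewrite oppr0 addr0.
  rewrite Imz (_ : \sum_(j < q) _ = \sum_(j < q) (sin (s j * r) - s j * r)); last first.
    by rewrite sumrB -mulr_suml s0 mul0r subr0.
  apply: avg => j; apply: le_trans (sin_taylor _) _.
  rewrite [leRHS]mulrAC; apply: ler_pM; rewrite ?expR_ge0 ?(mulr_ge0 (normr_ge0 _) (sqr_ge0 _)) //.
  rewrite normrM (gtr0_norm r0) exprMn.
  have -> : `|s j| * r * (s j ^+ 2 * r ^+ 2) = (`|s j| * s j ^+ 2) * r ^+ 3 by ring.
  by rewrite ler_wpM2r ?exprn_ge0 ?(ltW r0) // ler_pM // ?sqr_ge0.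
apply: le_trans (ler_wpM2l (ler0n _ d) (normc_le hRe hIm)) _.
rewrite -(rmorph_nat (real_complex R)) -rmorphM lecR.
have dr : d%:R * r ^+ 2 = 1 by rewrite r2 mulfV // gt_eqF.
set A := K ^+ 2 * expR K + _; set B := (1 + K) * K * expR K.
have -> : d%:R * (A * r ^+ 4 + B * r ^+ 3) = (d%:R * r ^+ 2) * (A * r ^+ 2 + B * r) by ring.
rewrite dr mul1r [leRHS]mulrDl lerD // ler_wpM2l //.
  by rewrite addr_ge0 // mulr_ge0 ?expR_ge0 ?sqr_ge0.
by rewrite expr2 ler_piMr // ltW.
Qed.

End CharacteristicLimit.

(** * Biorthogonality *)

Section ComplexExpectation.
Context (R : realType) d (T : measurableType d) (P : probability T R).
Local Notation C := R[i].
Implicit Types (f : T -> C) (z c : C).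

Definition isEC f z :=
  isE P (fun w => complex.Re (f w)) (complex.Re z) /\
  isE P (fun w => complex.Im (f w)) (complex.Im z).

Lemma isEC_mulr f z c : isEC f z -> isEC (fun w => f w * c) (z * c).
Proof.
case: c => a b [hr hi]; split.
  rewrite (_ : (fun w => _) = fun w => a * complex.Re (f w) - b * complex.Im (f w)).
    rewrite (_ : complex.Re _ = a * complex.Re z - b * complex.Im z).
      by apply: isEB; exact: isEZ.
    by case: z {hr hi} => x y /=; ring.
  by apply/funext => w; case: (f w) => x y /=; ring.
rewrite (_ : (fun w => _) = fun w => b * complex.Re (f w) + a * complex.Im (f w)).
  rewrite (_ : complex.Im _ = b * complex.Re z + a * complex.Im z).
    by apply: isED; exact: isEZ.
  by case: z {hr hi} => x y /=; ring.
by apply/funext => w; case: (f w) => x y /=; ring.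
Qed.

Lemma isEC_real (g : T -> R) (e : R) : isE P g e -> isEC (fun w => (g w)%:C) e%:C.
Proof. by move=> h; split=> //; exact: isE_cst. Qed.

Lemma isEC_sum (I : Type) (r : seq I) (p : pred I) (f : I -> T -> C) (z : I -> C) :
  (forall i, p i -> isEC (f i) (z i)) ->
  isEC (fun w => \sum_(i <- r | p i) f i w) (\sum_(i <- r | p i) z i).
Proof.
move=> h; split; [rewrite Re_sum|rewrite Im_sum].
  by under eq_fun do rewrite Re_sum; apply: isE_sum => i /h [].
by under eq_fun do rewrite Im_sum; apply: isE_sum => i /h [].
Qed.

Lemma isEC_expectation f z : isEC f z -> cintegrable P f /\ cexpectation P f = z.
Proof.
move=> [[ri re] [ii ie]]; split; first by split.
by rewrite /cexpectation unlock re ie; case: z {re ie}.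
Qed.

End ComplexExpectation.

Section MpolyExpectation.
Context (R : realType) d (T : measurableType d) (P : probability T R) (n : nat).
Local Notation C := R[i].
Local Notation A := (mpoly n C).
Implicit Types (F : T -> A) (x : A).

Definition isEM F x := forall l, isEC P (fun w => mcoeff l (F w)) (mcoeff l x).

Lemma isEM_real (g : T -> R) (e : R) x : isE P g e ->
  isEM (fun w => (g w)%:C *: x) (e%:C *: x).
Proof.
move=> h l; rewrite mcoeffZ; under eq_fun do rewrite mcoeffZ.
by apply: isEC_mulr; exact: isEC_real.
Qed.

Lemma isEM_sum (I : Type) (r : seq I) (p : pred I) (F : I -> T -> A) (x : I -> A) :
  (forall i, p i -> isEM (F i) (x i)) ->
  isEM (fun w => \sum_(i <- r | p i) F i w) (\sum_(i <- r | p i) x i).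
Proof.
move=> h l; rewrite raddf_sum /=; under eq_fun do rewrite raddf_sum /=.
by apply: isEC_sum => i /h /(_ l).
Qed.

Lemma isEM_mulr F x y : isEM F x -> isEM (fun w => F w * y) (x * y).
Proof.
move=> h l; rewrite mcoeffM; under eq_fun do rewrite mcoeffM.
by apply: isEC_sum => k _; exact: isEC_mulr.
Qed.

End MpolyExpectation.

Lemma wcoeff_neq (R : realType) q (l : multinom q.-1) (a : 'I_q -> nat) :
  (\sum_(j < q) a j)%N != mdeg l -> wcoeff R l a = 0.
Proof.
move=> al; suff h : \prod_(j < q) wform R j ^+ a j \is @ishomog1 q.-1 R[i] (\sum_(j < q) a j) mdeg.
  by rewrite /wcoeff (dhomog_nemf_coeff h) // eq_sym.
apply: (big_ind2 (fun (p : mpoly q.-1 R[i]) k => p \is @ishomog1 q.-1 R[i] k mdeg)).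
- exact: dhomog1.
- by move=> *; exact: dhomogM.
- by move=> j _; exact: dhomog_wformX.
Qed.

Section Orthogonality.
Context (R : realType) (q : nat) d (T : measurableType d) (P : probability T R).
Hypothesis q0 : (0 < q)%N.
Variable X : 'I_q -> {RV P >-> R}.
Hypothesis hX : multivariate_normal X.
Hypothesis hmean : forall a, ('E_P[X a] = 0)%E.
Hypothesis hcov : forall a b,
  covariance P (X a) (X b) = (q%:R^-1 * ((a == b)%:R - q%:R^-1))%:E.
Local Notation C := R[i].
Local Notation n := q.-1.
Local Notation A := (mpoly (n + n) C).
Local Notation A1 := (mpoly n C).

(** Only the coefficients are conjugated, not the variables, so the coefficient at l' becomes the
    conjugate of the original one. *)
Let conjm : A1 -> A1 := map_mpoly (@conjc R).

Let L (m : 'I_q -> R) : A1 := \sum_(j < q) (m j)%:C *: wform R j.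
Let U : A1 := \sum_(j < q) (q%:R^-1 : C) *: wform R j ^+ 2.
Let c (j : 'I_q) : A := inl_mpoly (wform R j) + inr_mpoly (conjm (wform R j)).
Let U2 : A := inl_mpoly U + inr_mpoly (conjm U).

Let H (m : 'I_q -> R) : nat -> A :=
  conv (fun i => inl_mpoly (hermite_seq (L m) U i))
       (fun i => inr_mpoly (conjm (hermite_seq (L m) U i))).

Let inl_wformE (j : 'I_q) : inl_mpoly (wform R j) =
  \sum_(k < n) theta R q (Defs.shift k) ^+ j *: inl_mpoly (mpolyX C (mnm1 k)).
Proof. by rewrite /wform raddf_sum; apply: eq_bigr => k _; exact: inl_mpolyZ. Qed.

Let inr_wformE (j : 'I_q) : inr_mpoly (conjm (wform R j)) =
  \sum_(k < n) (theta R q (Defs.shift k))^*%C ^+ j *: inr_mpoly (mpolyX C (mnm1 k)).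
Proof.
have -> : conjm (wform R j) =
    \sum_(k < n) (theta R q (Defs.shift k))^*%C ^+ j *: mpolyX C (mnm1 k).
  rewrite /wform /conjm raddf_sum; apply: eq_bigr => k _.
  by rewrite /= map_mpolyZ map_mpolyX rmorphXn.
by rewrite raddf_sum; apply: eq_bigr => k _; exact: inr_mpolyZ.
Qed.

(** The part of the exponent that depends on m is linear and gathers into the [c j]; the quadratic
    part is deterministic and factors out of the expectation. *)
Let HE (m : 'I_q -> R) : H m =
  conv (expseq (\sum_(j < q) (m j)%:C *: c j)) (expseq2 (- (2^-1 : C) *: U2)).
Proof.
rewrite -/(hermite_seq _ _); apply: ode_uniq (ode_hermite_seq _ _).
have hc : \sum_(j < q) (m j)%:C *: c j = inl_mpoly (L m) + inr_mpoly (conjm (L m)).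
  have -> : conjm (L m) = \sum_(j < q) (m j)%:C *: conjm (wform R j).
    rewrite /L /conjm raddf_sum; apply: eq_bigr => j _.
    by rewrite /= map_mpolyZ; congr (_ *: _); exact: conjc_real.
  have -> : inl_mpoly (L m) = \sum_(j < q) (m j)%:C *: inl_mpoly (wform R j).
    by rewrite /L raddf_sum; apply: eq_bigr => j _; exact: inl_mpolyZ.
  have -> : inr_mpoly (\sum_(j < q) (m j)%:C *: conjm (wform R j)) =
      \sum_(j < q) (m j)%:C *: inr_mpoly (conjm (wform R j)).
    by rewrite raddf_sum; apply: eq_bigr => j _; exact: inr_mpolyZ.
  by rewrite -[RHS]big_split; apply: eq_bigr => j _; rewrite scalerDr.
rewrite hc; apply: ode_conv.
  by have := ode_rmorph (@inl_mpoly n C) (ode_hermite_seq (L m) U); rewrite rmorph0.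
have := ode_rmorph (@inr_mpoly n C) (ode_rmorph (map_mpoly (@conjc R)) (ode_hermite_seq (L m) U)).
by rewrite !rmorph0.
Qed.

Let M i : A := \sum_(a : bmultinom q i.+1 | mdeg a == i)
  (moment X a)%:C *: \prod_(j < q) expseq (c j) (a j).

Let isEM_expseq i : isEM P (fun w => expseq (\sum_(j < q) (X j w)%:C *: c j) i) (M i).
Proof.
rewrite (_ : (fun w => _) = fun w => \sum_(a : bmultinom q i.+1 | mdeg a == i)
    (\prod_(j < q) X j w ^+ a j)%:C *: \prod_(j < q) expseq (c j) (a j)).
  by apply: isEM_sum => a _; apply: isEM_real; exact: isE_moment.
apply/funext => w; rewrite -(sum_expr_fact _ (ltnSn i)); apply: eq_bigr => a _.
rewrite rmorph_prod -scaler_prod; apply: eq_bigr => j _.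
by rewrite /expseq exprZn rmorphXn !scalerA mulrC.
Qed.

(** Evaluation of a real polynomial in t at t_j = [c j], which carries [moment_poly] over to the
    algebra. *)
Let phi : mpoly q R -> A := mmap (@mpolyC (n + n) C \o real_complex R) c.

Let phiZ r p : phi (r *: p) = r%:C *: phi p.
Proof. by rewrite /phi mmapZ mul_mpolyC. Qed.

Let phiX j : phi (mpolyX R (mnm1 j)) = c j.
Proof. by rewrite /phi mmapX mmap1U. Qed.

Let phi_expr p k : phi (p ^+ k) = phi p ^+ k.
Proof. by rewrite /phi rmorphXn. Qed.

Let phi_sum (I : Type) (r : seq I) (p : pred I) (F : I -> mpoly q R) :
  phi (\sum_(i <- r | p i) F i) = \sum_(i <- r | p i) phi (F i).
Proof. by rewrite /phi raddf_sum. Qed.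

Let phi_prod (I : Type) (r : seq I) (F : I -> mpoly q R) :
  phi (\prod_(i <- r) F i) = \prod_(i <- r) phi (F i).
Proof. by rewrite /phi rmorph_prod. Qed.

Let phi_expseq p k : phi (expseq p k) = expseq (phi p) k.
Proof. by rewrite /expseq phiZ phi_expr fmorphV rmorph_nat. Qed.

Let ME i : M i = expseq2 (phi ((2^-1 : R) *: var_mpoly R q)) i.
Proof.
transitivity (phi (expseq2 ((2^-1 : R) *: var_mpoly R q) i)).
  rewrite -(moment_poly hX hmean hcov) phi_sum; apply: eq_bigr => a _.
  rewrite phiZ phi_prod; congr (_ *: _); apply: eq_bigr => j _.
  by rewrite phi_expseq phiX.
by rewrite /expseq2; case: ifP => _; rewrite ?phi_expseq // /phi mmap0.
Qed.

Let sum_c : \sum_(j < q) c j = 0.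
Proof.
have hl : inl_mpoly (\sum_(j < q) wform R j) = \sum_(j < q) inl_mpoly (wform R j).
  by rewrite raddf_sum.
have hc : conjm (\sum_(j < q) wform R j) = \sum_(j < q) conjm (wform R j).
  by rewrite /conjm raddf_sum.
have hr : inr_mpoly (\sum_(j < q) conjm (wform R j)) = \sum_(j < q) inr_mpoly (conjm (wform R j)).
  exact: inr_mpoly_sum.
transitivity (inl_mpoly (\sum_(j < q) wform R j) + inr_mpoly (conjm (\sum_(j < q) wform R j))).
  by rewrite hc hl hr -[RHS]big_split.
by rewrite sum_wform /conjm !raddf0 addr0.
Qed.

Let B : A := \sum_(k < n) inl_mpoly (mpolyX C (mnm1 k)) * inr_mpoly (mpolyX C (mnm1 k)).

(** The orthogonality of characters leaves only the diagonal terms; this is where the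
    biorthogonality of the system originates. *)
Let sum_cross (D : comAlgType C) (x y : 'I_n -> D) :
  \sum_(j < q) (\sum_(k < n) theta R q (Defs.shift k) ^+ j *: x k) *
    (\sum_(k < n) (theta R q (Defs.shift k))^*%C ^+ j *: y k) =
  q%:R *: (\sum_(k < n) x k * y k).
Proof.
under eq_bigr do rewrite big_distrlr /=.
rewrite exchange_big scaler_sumr; apply: eq_bigr => k _ /=.
rewrite exchange_big (bigD1 k) //= [X in _ + X]big1 ?addr0 => [|k' k'k].
  under eq_bigr do rewrite -scalerAl -scalerAr scalerA.
  rewrite -scaler_suml; congr (_ *: _).
  have := sum_theta_conj R (Defs.shift k) (Defs.shift k); rewrite eqxx mulr1 => <-.
  by apply: eq_bigr => j _; rewrite mulrC.
under eq_bigr do rewrite -scalerAl -scalerAr scalerA.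
rewrite -scaler_suml.
have := sum_theta_conj R (Defs.shift k) (Defs.shift k').
rewrite (_ : (_ == _) = false) ?mulr0 => [h|]; last first.
  by apply/eqP => /(congr1 val) /= [] /val_inj kk; rewrite kk eqxx in k'k.
by rewrite (_ : \sum_(j < q) _ = 0) ?scale0r // -[RHS]h.
Qed.

Let sum_sqr (D : comAlgType C) (x y : 'I_q -> D) (k : C) :
  k *: \sum_(j < q) (x j + y j) ^+ 2 =
  \sum_(j < q) k *: x j ^+ 2 + \sum_(j < q) k *: y j ^+ 2 +
  (2 : C) *: (k *: \sum_(j < q) x j * y j).
Proof.
rewrite -!scaler_sumr scalerA mulrC -scalerA -!scalerDr; congr (_ *: _).
rewrite scaler_sumr -!big_split; apply: eq_bigr => j _ /=.
by rewrite sqrrD scaler_nat addrAC.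
Qed.

Let inlU : inl_mpoly U = \sum_(j < q) (q%:R^-1 : C) *: inl_mpoly (wform R j) ^+ 2.
Proof.
by rewrite /U inl_mpoly_sum; apply: eq_bigr => j _; rewrite inl_mpolyZ rmorphXn.
Qed.

Let inrU : inr_mpoly (conjm U) = \sum_(j < q) (q%:R^-1 : C) *: inr_mpoly (conjm (wform R j)) ^+ 2.
Proof.
rewrite (_ : conjm U = \sum_(j < q) (q%:R^-1 : C) *: conjm (wform R j) ^+ 2).
  by rewrite inr_mpoly_sum; apply: eq_bigr => j _; rewrite inr_mpolyZ rmorphXn.
rewrite /U /conjm raddf_sum; apply: eq_bigr => j _.
by rewrite /= map_mpolyZ rmorphXn; congr (_ *: _); rewrite /= fmorphV rmorph_nat.
Qed.

Let sum_crossB : (q%:R^-1 : C) *: (\sum_(j < q) inl_mpoly (wform R j) * inr_mpoly (conjm (wform R j))) = B.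
Proof.
transitivity ((q%:R^-1 : C) *: (\sum_(j < q)
   (\sum_(k < n) theta R q (Defs.shift k) ^+ j *: inl_mpoly (mpolyX C (mnm1 k))) *
   (\sum_(k < n) (theta R q (Defs.shift k))^*%C ^+ j *: inr_mpoly (mpolyX C (mnm1 k))))).
  apply: f_equal; apply: eq_bigr => j _.
  by apply: f_equal2; [exact: inl_wformE|exact: inr_wformE].
apply: etrans (f_equal _ (sum_cross _ _)) _.
by rewrite scalerA mulVf ?scale1r // pnatr_eq0 -lt0n.
Qed.

(** The square of the sum of the variables vanishes by [sum_c]. In the squares of the [c j], the
    pure squares add up to [U2] and the cross terms to twice [B]. *)
Let phi_var : phi (var_mpoly R q) = U2 + (2 : C) *: B.
Proof.
have phiB p p' : phi (p - p') = phi p - phi p' by rewrite /phi raddfB.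
rewrite /var_mpoly phiB phi_expr !phiZ !phi_sum.
rewrite [X in _ - (_ *: X) ^+ _](_ : _ = 0); last first.
  by rewrite -[RHS]sum_c; apply: eq_bigr => j _; exact: phiX.
rewrite scaler0 expr0n subr0 fmorphV rmorph_nat.
rewrite (eq_bigr (fun j => (inl_mpoly (wform R j) + inr_mpoly (conjm (wform R j))) ^+ 2)) => [|j _]; last first.
  by rewrite phi_expr phiX.
apply: etrans (sum_sqr (fun j => inl_mpoly (wform R j))
  (fun j => inr_mpoly (conjm (wform R j))) _) _.
apply: f_equal2; last by apply: f_equal; exact: sum_crossB.
by apply: f_equal2; [rewrite -inlU|rewrite -inrU].
Qed.

(** The Gaussian expectation contributes exp ((U2 / 2 + B) z^2) and the deterministic factor exp (-
    U2 z^2 / 2), so that exp (B z^2) remains. *)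
Let isEM_H i : isEM P (fun w => H (X^~ w) i) (expseq2 B i).
Proof.
have -> : expseq2 B i = conv M (expseq2 (- (2^-1 : C) *: U2)) i.
  apply: (congr1 (fun f : nat -> A => f i)).
  have h1 := ode_conv (ode_expseq2 (- (U2 + (2 : C) *: B))) (ode_expseq2 U2).
  have h2 := ode_expseq2 (- ((2 : C) *: B)).
  rewrite [- _ + _]addrC opprD addrA subrr sub0r addr0 in h1.
  have -> : M = expseq2 (- (2^-1 : C) *: (- U2 - (2 : C) *: B)).
    apply/funext => k; rewrite ME phiZ phi_var fmorphV rmorph_nat.
    by rewrite -opprD scalerN scaleNr opprK.
  apply: etrans (ode_uniq h2 h1); apply: f_equal.
  by rewrite scalerN scaleNr opprK scalerA mulVf ?scale1r // pnatr_eq0.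
rewrite (_ : (fun w => _) = fun w => conv (expseq (\sum_(j < q) (X j w)%:C *: c j)) (expseq2 (- (2^-1 : C) *: U2)) i); last first.
  by apply/funext => w; rewrite HE.
by apply: isEM_sum => k _; apply: isEM_mulr; exact: isEM_expseq.
Qed.

Let mcoeff_hermite_seq m l i : i != mdeg l -> mcoeff l (hermite_seq (L m) U i) = 0.
Proof.
move=> il; rewrite hermite_wseries mcoeff_wseries big1 // => a /eqP ai.
by rewrite wcoeff_neq ?mulr0 // -mdegE ai.
Qed.

(** The monomial w^l occurs only in degree |l| of the first factor, which singles out one term of
    the convolution. *)
Let mcoeff_H m l l' : mcoeff (mjoin l l') (H m (mdeg l + mdeg l')) =
  gf_coeff m l * (gf_coeff m l')^*%C.
Proof.
have ll : (mdeg l < (mdeg l + mdeg l').+1)%N by rewrite ltnS leq_addr.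
transitivity (\sum_(i < (mdeg l + mdeg l').+1) mcoeff l (hermite_seq (L m) U i) *
    mcoeff l' (conjm (hermite_seq (L m) U (mdeg l + mdeg l' - i)))).
  rewrite /H /conv raddf_sum; apply: eq_bigr => i _; exact: mcoeff_tensor.
rewrite (bigD1 (Ordinal ll)) //= [X in _ + X]big1 ?addr0.
  by rewrite addKn /conjm mcoeff_map_mpoly !gf_coeffE.
by move=> i il; rewrite mcoeff_hermite_seq ?mul0r.
Qed.

Let mcoeff_expseqB l l' N : mcoeff (mjoin l l') (expseq B N) =
  ((l == l') && (mdeg l == N))%:R / (\prod_(k < n) (l k)`!)%:R.
Proof.
rewrite /B -(sum_expr_fact _ (ltnSn N)) raddf_sum /=.
have E (a : multinom n) : mcoeff (mjoin l l')
    (\prod_(k < n) expseq (inl_mpoly (mpolyX C (mnm1 k)) * inr_mpoly (mpolyX C (mnm1 k))) (a k)) =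
    ((\prod_k (a k)`!)%:R)^-1 * ((a == l)%:R * (a == l')%:R).
  by rewrite mcoeff_prod_expseq -mpolyXE_id !mcoeffX.
rewrite (eq_bigr _ (fun (a : bmultinom n N.+1) _ => E a)).
have [<-|ll'] /= := eqVneq l l'; last first.
  rewrite mul0r big1 // => a _; case: (eqVneq (val a) l) => [->|_]; last by rewrite mul0r mulr0.
  by rewrite (negbTE ll') !mulr0.
have [lN|lN] := eqVneq (mdeg l) N; last first.
  rewrite mul0r big1 // => a /eqP aN; case: (eqVneq (val a) l) => [al|_].
    by case/eqP: lN; rewrite -al.
  by rewrite mul0r mulr0.
have lN' : (mdeg l < N.+1)%N by rewrite lN.
rewrite (bigD1 (BMultinom lN')) ?lN //= eqxx !mul1r mulr1 [X in _ + X]big1 ?addr0 // => a /andP[_ al].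
by rewrite (negbTE (_ : _ != l)) ?mul0r ?mulr0.
Qed.

(** Each term of [B] pairs a variable with its copy, so only l = l' occurs, and exp (B z^2) reaches
    it at z^(2|l|). When |l| + |l'| is odd, l and l' differ and both sides are 0. *)
Let mcoeff_expseq2B l l' : mcoeff (mjoin l l') (expseq2 B (mdeg l + mdeg l')) =
  (l == l')%:R / (\prod_(k < n) (l k)`!)%:R.
Proof.
rewrite /expseq2; case: ifPn => [oddl|_]; last rewrite mcoeff_expseqB; case: (eqVneq l l') => [ll|ll] /=.
- by move: oddl; rewrite ll addnn odd_double.
- by rewrite mcoeff0 mul0r.
- by rewrite -ll addnn doubleK eqxx.
- by [].
Qed.

Lemma gf_coeff_orthogonal l l' :
  let f w := gf_coeff (X^~ w) l * (gf_coeff (X^~ w) l')^*%C in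
  cintegrable P f /\ cexpectation P f = (l == l')%:R / (\prod_(k < n) (l k)`!)%:R.
Proof.
apply: isEC_expectation; rewrite -mcoeff_expseq2B.
by under eq_fun do rewrite -mcoeff_H; exact: isEM_H.
Qed.

End Orthogonality.

(** * Weak convergence of the multinomial distribution *)

Section MultinomialLaw.
Context (R : realType) (q d : nat) dT (T : measurableType dT) (P : probability T R).
Hypothesis q0 : (0 < q)%N.
Variable M : 'I_q -> {RV P >-> R}.
Hypothesis hM : uniform_multinomial d M.
Local Notation idx := (bmultinom q d.+1).

Definition mult_weight (K : numFieldType) (a : multinom q) : K :=
  d`!%:R / (\prod_(j < q) (a j)`!)%:R * q%:R ^- d.

(** The field K is kept general because real exponentials x j give the moment generating function
    and complex ones the characteristic function. *)
Lemma sum_mult_weight (K : numFieldType) (x : 'I_q -> K) :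
  \sum_(a : idx | mdeg a == d) mult_weight K a * \prod_(j < q) x j ^+ a j =
  (q%:R^-1 * \sum_(j < q) x j) ^+ d.
Proof.
have h := @sum_expr_fact K K^o q x d.+1 d (ltnSn d).
have assoc (u v w z : K) : u / v * w * z = w * (u * (v^-1 * z)) by ring.
rewrite exprMn exprVn; transitivity (q%:R ^- d * (d`!%:R * expseq (\sum_(j < q) x j : K^o) d)).
  rewrite -h !big_distrr /=; apply: eq_bigr => a _.
  rewrite /expseq [in RHS](eq_bigr (fun j => (a j)`!%:R^-1 * x j ^+ a j)) //.
  rewrite big_split /= prodfV -natr_prod /mult_weight.
  exact: assoc.
by rewrite /expseq regular_scaleE mulVKf // pnatr_eq0 -lt0n fact_gt0.
Qed.

Let E (a : multinom q) : set T := [set w | forall j, M j w = (a j)%:R].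

Let mE a : measurable (E a).
Proof.
rewrite (_ : E a = \bigcap_(j in [set: 'I_q]) (M j @^-1` [set (a j)%:R])).
  apply: fin_bigcap_measurable => [|j _]; first exact: finite_finset.
  by rewrite -[_ @^-1` _]setTI; apply: measurable_funPT => //.
by apply/seteqP; split=> w /= h j; [move=> _|]; exact: h.
Qed.

Let PE (a : multinom q) : mdeg a = d -> P (E a) = (mult_weight R a)%:E.
Proof. by move=> ad; apply: (hM (m := fun j => a j)); rewrite -mdegE. Qed.

Let isE_indic (a : multinom q) : mdeg a = d -> isE P (\1_(E a)) (mult_weight R a).
Proof.
move=> ad; apply: isE_ge0 => //.
by rewrite integral_indic // setIT; exact: PE.
Qed.

(** The hypothesis only gives the masses of the disjoint events [E a]. Their indicators add up to 0
    or 1; as the masses sum to 1, the value is 1 almost surely, so that M almost surely takes one of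
    the values a. *)
Let cover w : R := \sum_(a : idx | mdeg a == d) \1_(E a) w.

Let coverP w : cover w = 0 \/ exists2 a : idx, mdeg a = d & forall (F : multinom q -> R),
  \sum_(b : idx | mdeg b == d) F b * \1_(E b) w = F a /\ (fun j => M j w) = (fun j => (a j)%:R).
Proof.
have [[a ad wa]|h] := pselect (exists2 a : idx, mdeg a = d & E a w).
  right; exists a => // F; split; last by apply/funext => j; exact: wa.
  rewrite (bigD1 a) ?ad //= indicE mem_set // mulr1 big1 ?addr0 // => b /andP[bd ba].
  rewrite indicE memNset ?mulr0 // => wb; case/eqP: ba; apply/val_inj/mnmP => j.
  by have := wa j; rewrite wb => /eqP; rewrite eqr_nat => /eqP.
left; rewrite /cover big1 // => a /eqP ad; rewrite indicE memNset // => wa.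
by apply: h; exists a.
Qed.

Lemma isE_multinomial (g : ('I_q -> R) -> R) :
  measurable_fun setT (fun w => g (fun j => M j w)) ->
  isE P (fun w => g (fun j => M j w))
    (\sum_(a : idx | mdeg a == d) mult_weight R a * g (fun j => (a j)%:R)).
Proof.
move=> mg.
pose h w := \sum_(a : idx | mdeg a == d) g (fun j => (a j)%:R) * \1_(E a) w.
have isEh : isE P h (\sum_(a : idx | mdeg a == d) mult_weight R a * g (fun j => (a j)%:R)).
  under [X in isE _ _ X]eq_bigr do rewrite mulrC.
  by apply: isE_sum => a /eqP ad; apply: isEZ; exact: isE_indic.
have isEc : isE P (fun w => 1 - cover w) 0.
  have -> : 0 = 1 - \sum_(a : idx | mdeg a == d) mult_weight R a.
    have := sum_mult_weight (fun _ : 'I_q => 1 : R).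
    under eq_bigr do under eq_bigr do rewrite expr1n.
    under eq_bigr do rewrite big1_eq mulr1.
    move=> ->; rewrite sumr_const card_ord -[1 *+ q]mulr_natr mul1r mulVf ?expr1n ?subrr //.
    by rewrite pnatr_eq0 -lt0n.
  apply: isEB; first exact: isE_cst.
  by apply: isE_sum => a /eqP ad; exact: isE_indic.
have [ci c0] := isEc.
have cov0 : ae_eq P setT (fun w => (1 - cover w)%:E) (cst 0%E).
  apply/ae_eq_integral_abs => //; first exact: measurable_int ci.
  apply: etrans c0; apply: eq_integral => w _; rewrite gee0_abs // lee_fin subr_ge0.
  have [->//|[a ad /(_ (fun=> 1))[]]] := coverP w.
  by under eq_bigr do rewrite mul1r; rewrite /cover => ->.
have gh : ae_eq P setT (fun w => (g (fun j => M j w))%:E) (EFin \o h).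
  apply: filterS cov0 => w /(_ I) [/eqP]; rewrite subr_eq0 => /eqP cw _ /=; congr EFin.
  have [c1|[a ad hF]] := coverP w; first by move: cw; rewrite c1 => /eqP; rewrite oner_eq0.
  have [e ->] := hF (fun b => g (fun j => (b j)%:R)).
  by rewrite /h e.
have mgE : measurable_fun setT (EFin \o (fun w => g (fun j => M j w))) by exact/measurable_EFinP.
have [hi hE] := isEh; split; last by rewrite -hE; apply: ae_eq_integral => //; exact: measurable_int hi.
have [mh fin] := integrableP _ _ _ hi; apply/integrableP; split=> //.
apply: le_lt_trans fin; rewrite le_eqVlt; apply/orP; left; apply/eqP.
apply: ae_eq_integral => //; first exact: measurableT_comp.
  exact: measurableT_comp.
by apply: filterS gh => w + Dw => /(_ Dw) /= [->].
Qed.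

End MultinomialLaw.

Section ScaledMultinomial.
Context (R : realType) (q d : nat) dT (T : measurableType dT) (P : probability T R).
Hypotheses (q0 : (0 < q)%N) (d0 : (0 < d)%N).
Variable M : 'I_q -> {RV P >-> R}.
Hypothesis hM : uniform_multinomial d M.

Let sd : R := Num.sqrt d%:R.
Let scaled (m : 'I_q -> R) (j : 'I_q) := (m j - d%:R / q%:R) / sd.

(** Since the counts sum to d, subtracting d / q from each of them amounts to subtracting from t its
    mean; the coefficients then sum to 0, which removes the first-order term of the expansions. *)
Definition centered (t : 'I_q -> R) (j : 'I_q) := t j - q%:R^-1 * \sum_(i < q) t i.

Lemma sum_centered t : \sum_(j < q) centered t j = 0.
Proof.
rewrite sumrB sumr_const card_ord -[(_ * _) *+ q]mulr_natl mulrA mulfV ?mul1r ?subrr //.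
by rewrite pnatr_eq0 -lt0n.
Qed.

Let scaledE t (a : multinom q) : mdeg a = d ->
  \sum_(j < q) t j * scaled (fun j => (a j)%:R) j =
  \sum_(j < q) (a j)%:R * (centered t j / sd).
Proof.
move=> ad; rewrite (eq_bigr (fun j => t j * (a j)%:R / sd - t j * (d%:R / q%:R / sd))); last first.
  by move=> j _; rewrite /scaled; ring.
rewrite [RHS](eq_bigr (fun j => t j * (a j)%:R / sd -
   (a j)%:R * (q%:R^-1 * (\sum_(i < q) t i) / sd))); last first.
  by move=> j _; rewrite /centered; ring.
rewrite !sumrB -!mulr_suml -natr_sum -mdegE ad; congr (_ - _); ring.
Qed.

Let measurable_lin t c : measurable_fun setT (fun w => \sum_(j < q) t j * scaled (fun j => M j w) j + c).
Proof.
apply: measurable_funD => //; apply: measurable_sum => j.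
by apply: measurable_funM => //; apply: measurable_funM => //; exact: measurable_funB.
Qed.

Lemma isE_exp_multinomial t :
  isE P (fun w => expR (\sum_(j < q) t j * ((M j w - d%:R / q%:R) / Num.sqrt d%:R)))
    ((q%:R^-1 * \sum_(j < q) expR (centered t j / sd)) ^+ d).
Proof.
rewrite -sum_mult_weight.
have mE : measurable_fun setT (fun w => expR (\sum_(j < q) t j * scaled (fun j => M j w) j)).
  apply: measurableT_comp => //; have := measurable_lin t 0.
  by under eq_fun do rewrite addr0.
have := isE_multinomial q0 hM (g := fun m => expR (\sum_(j < q) t j * scaled m j)) mE.
congr isE; apply: eq_bigr => a /eqP ad; congr (_ * _).
by rewrite scaledE // expR_sum; apply: eq_bigr => j _; rewrite expRM_natl.
Qed.

Lemma isE_cos_multinomial t c :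
  isE P (fun w => cos (\sum_(j < q) t j * ((M j w - d%:R / q%:R) / Num.sqrt d%:R) + c))
    (complex.Re ((q%:R^-1 * \sum_(j < q) cis (centered t j / sd)) ^+ d * cis c)).
Proof.
rewrite -sum_mult_weight mulr_suml Re_sum.
have mE : measurable_fun setT (fun w => cos (\sum_(j < q) t j * scaled (fun j => M j w) j + c)).
  exact: measurableT_comp (continuous_measurable_fun (@continuous_cos R)) (measurable_lin t c).
have := isE_multinomial q0 hM (g := fun m => cos (\sum_(j < q) t j * scaled m j + c)) mE.
congr isE; apply: eq_bigr => a /eqP ad.
have -> : mult_weight d R[i] a = (mult_weight d R a)%:C.
  by rewrite /mult_weight !rmorphM !fmorphV rmorphXn !rmorph_nat.
rewrite -[in RHS]mulrA [RHS]Re_realM; congr (_ * _).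
rewrite scaledE // -[LHS]/(complex.Re (cis _)) cisD cis_sum.
by congr (complex.Re (_ * _)); apply: eq_bigr => j _; rewrite cisX.
Qed.

(** For |x| <= 1 / sqrt d <= 1, exp x <= 1 + x + e / d. The linear terms average to 0, and (1 + e /
    d)^d <= exp e, a bound that does not depend on d. *)
Lemma exp_multinomial_le t : (forall j, `|centered t j| <= 1) ->
  (q%:R^-1 * \sum_(j < q) expR (centered t j / sd)) ^+ d <= expR (expR 1).
Proof.
move=> t1; have dR0 : (0 : R) < d%:R by rewrite ltr0n.
have qR0 : (0 : R) < q%:R by rewrite ltr0n.
have s0 : 0 < sd by rewrite sqrtr_gt0.
have s2 : sd ^- 2 = d%:R^-1 by rewrite sqr_sqrtr // ltW.
have s1 : sd^-1 <= 1 by rewrite -(@expr_le1 _ 2) ?invr_ge0 ?(ltW s0) // exprVn s2 invf_le1 // ler1n.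
apply: (@le_trans _ _ (expR (expR 1 / d%:R) ^+ d)); last first.
  by rewrite -expRM_natl mulrC divfK ?gt_eqF.
apply: lerXn2r; rewrite ?nnegrE ?expR_ge0 //.
  by rewrite mulr_ge0 ?invr_ge0 ?(ltW qR0) // sumr_ge0 // => j _; exact: expR_ge0.
apply: le_trans (expR_ge1Dx _).
rewrite mulrC ler_pdivrMr //.
apply: le_trans (_ : _ <= \sum_(j < q) (1 + centered t j / sd + expR 1 / d%:R)) _.
  apply: ler_sum => j _; have := expR_taylor (centered t j / sd) 2.
  rewrite /series /= !big_nat_recr // big_geq //= /exp_coeff /= expr0 expr1 !divr1 add0r.
  move/(le_trans (ler_norm _)); rewrite lerBlDl => /le_trans; apply; rewrite lerD2l.
  have ts : `|centered t j / sd| <= sd^-1.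
    by rewrite normrM normfV (gtr0_norm s0) ler_piMl ?invr_ge0 ?(ltW s0).
  rewrite mulrC ler_pM ?expR_ge0 ?exprn_ge0 //.
    by rewrite ler_expR (le_trans ts).
  by rewrite -s2 -exprVn lerXn2r ?nnegrE ?invr_ge0 ?(ltW s0).
rewrite !big_split /= -mulr_suml sum_centered mul0r addr0 !sumr_const !card_ord.
by rewrite -mulrnDl -[_ *+ q]mulr_natr addrC.
Qed.

End ScaledMultinomial.

Section CharLimit.
Variables (R : realType) (q : nat).
Hypothesis q0 : (0 < q)%N.
Implicit Types t : 'I_q -> R.

Lemma limit_var_centered t : q%:R^-1 * \sum_(j < q) centered t j ^+ 2 = limit_var t.
Proof.
rewrite limit_varE //; set m := q%:R^-1 * \sum_(j < q) t j.
rewrite (eq_bigr (fun j => t j ^+ 2 - 2 * m * t j + m ^+ 2)); last first.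
  by move=> j _; rewrite /centered -/m; ring.
rewrite big_split sumrB /= -mulr_sumr sumr_const card_ord -[m ^+ 2 *+ q]mulr_natl.
have -> : \sum_(j < q) t j = q%:R * m by rewrite /m mulVKf // pnatr_eq0 -lt0n.
by field; rewrite pnatr_eq0 -lt0n.
Qed.

Lemma cvg_cos_multinomial t c :
  (fun d : nat => complex.Re ((q%:R^-1 * \sum_(j < q) cis (centered t j / Num.sqrt d%:R)) ^+ d * cis c))
  @ \oo --> cos c * expR (- (limit_var t / 2)).
Proof.
have [K hK] := char_limit_bound q0 (sum_centered q0 t).
rewrite limit_var_centered in hK.
have h0 : (fun d : nat => K * (Num.sqrt d%:R)^-1) @ \oo --> (0 : R).
  by rewrite -[X in _ --> X](mulr0 K); apply: cvgM; [exact: cvg_cst|exact: cvg_sqrtV].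
apply/cvgrPdist_le => e e0; near=> d.
have d0 : (0 < d)%N by near: d; exact: nbhs_infty_gt.
have -> : cos c * expR (- (limit_var t / 2)) = complex.Re ((expR (- (limit_var t / 2)))%:C * cis c).
  by rewrite Re_realM mulrC.
rewrite distrC -raddfB -mulrBl -lecR; apply: le_trans (normc_ge_Re _) _.
rewrite normrM norm_cis mulr1; apply: le_trans (hK d d0) _; rewrite lecR.
apply: le_trans (ler_norm _) _; rewrite -[X in `|X|]subr0 distrC.
by near: d; move/cvgrPdist_le : h0; apply.
Unshelve. all: by end_near.
Qed.

End CharLimit.

(** The phase c makes sines and constants special cases, and the product of two such cosines is a
    combination of two others, whence [trigM]. *)
Inductive trigpoly (R : realType) (q : nat) : (('I_q -> R) -> R) -> Prop :=
| trig_cos t c : trigpoly (fun x => cos (\sum_(j < q) t j * x j + c))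
| trigD f g : trigpoly f -> trigpoly g -> trigpoly (fun x => f x + g x)
| trigZ a f : trigpoly f -> trigpoly (fun x => a * f x).

Section TrigPoly.
Variables (R : realType) (q : nat).
Implicit Types f g : ('I_q -> R) -> R.
Local Notation trigpoly := (@trigpoly R q).

Lemma trig_cst a : trigpoly (fun=> a).
Proof.
have := trigZ a (trig_cos (fun _ : 'I_q => 0 : R) 0); congr trigpoly; apply/funext => x.
by rewrite big1 ?addr0 ?cos0 ?mulr1 // => j _; rewrite mul0r.
Qed.

Lemma trig_sin_coord (j : 'I_q) (b : R) : trigpoly (fun x => sin (x j / b)).
Proof.
have := trig_cos (fun i : 'I_q => (i == j)%:R / b) (- (pi / 2)); congr trigpoly; apply/funext => x.
rewrite (bigD1 j) //= eqxx big1 => [|i /negbTE ->]; last by rewrite !mul0r.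
by rewrite addr0 cosBpihalf; congr sin; rewrite mulrAC mul1r mulrC.
Qed.

Lemma trigM f g : trigpoly f -> trigpoly g -> trigpoly (fun x => f x * g x).
Proof.
move=> hf; elim: hf g => {f} [t c g hg|f1 f2 _ IH1 _ IH2 g hg|a f _ IH g hg]; last 2 first.
- have := trigD (IH1 _ hg) (IH2 _ hg); congr trigpoly; apply/funext => x; ring.
- have := trigZ a (IH _ hg); congr trigpoly; apply/funext => x; ring.
elim: hg => {g} [u b|f1 f2 _ IH1 _ IH2|a f _ IH].
- have := trigZ 2^-1 (trigD (trig_cos (fun j => t j + u j) (c + b)) (trig_cos (fun j => t j - u j) (c - b))).
  congr trigpoly; apply/funext => x.
  set A := \sum_(j < q) t j * x j; set B := \sum_(j < q) u j * x j.
  have -> : \sum_(j < q) (t j + u j) * x j + (c + b) = (A + c) + (B + b).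
    rewrite (eq_bigr (fun j => t j * x j + u j * x j)) => [|j _]; last by ring.
    by rewrite big_split /= -/A -/B; ring.
  have -> : \sum_(j < q) (t j - u j) * x j + (c - b) = (A + c) - (B + b).
    rewrite (eq_bigr (fun j => t j * x j - u j * x j)) => [|j _]; last by ring.
    by rewrite sumrB -/A -/B; ring.
  by rewrite cosB cosD; field.
- have := trigD IH1 IH2; congr trigpoly; apply/funext => x; ring.
- have := trigZ a IH; congr trigpoly; apply/funext => x; ring.
Qed.

Lemma trigX f n : trigpoly f -> trigpoly (fun x => f x ^+ n).
Proof.
move=> hf; elim: n => [|n IH]; first exact: trig_cst.
by have := trigM hf IH; congr trigpoly; apply/funext => x; rewrite exprS.
Qed.

Lemma trig_sum (I : Type) (r : seq I) (p : pred I) (f : I -> ('I_q -> R) -> R) :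
  (forall i, trigpoly (f i)) -> trigpoly (fun x => \sum_(i <- r | p i) f i x).
Proof.
move=> h; elim: r => [|i r IH].
  by have := trig_cst 0; congr trigpoly; apply/funext => x; rewrite big_nil.
case pi : (p i); last by move: IH; congr trigpoly; apply/funext => x; rewrite big_cons pi.
by have := trigD (h i) IH; congr trigpoly; apply/funext => x; rewrite big_cons pi.
Qed.

Lemma trig_prod (I : Type) (r : seq I) (f : I -> ('I_q -> R) -> R) :
  (forall i, trigpoly (f i)) -> trigpoly (fun x => \prod_(i <- r) f i x).
Proof.
move=> h; elim: r => [|i r IH].
  by have := trig_cst 1; congr trigpoly; apply/funext => x; rewrite big_nil.
by have := trigM (h i) IH; congr trigpoly; apply/funext => x; rewrite big_cons.
Qed.

End TrigPoly.

(** * Bernstein polynomials and trigonometric approximation with exponential weights *)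

Section Bernstein.
Variable R : realType.
Implicit Types p : R.

Definition bernstein n k p := 'C(n, k)%:R * p ^+ k * (1 - p) ^+ (n - k).

(** Pascal's rule, that is, conditioning a binomial variable on one of its trials: a success shifts
    the argument of g. *)
Lemma bernstein_recr n p (g : nat -> R) :
  \sum_(k < n.+2) bernstein n.+1 k p * g k =
  p * (\sum_(k < n.+1) bernstein n k p * g k.+1) +
  (1 - p) * (\sum_(k < n.+1) bernstein n k p * g k).
Proof.
rewrite big_ord_recl /=.
rewrite (eq_bigr (fun k : 'I_n.+1 => p * (bernstein n k p * g k.+1) +
    (1 - p) * (bernstein n k.+1 p * g k.+1))) => [|k _].
  rewrite big_split /= -!mulr_sumr addrCA; congr (_ + _).
  rewrite [in RHS]big_ord_recl mulrDr; congr (_ + _).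
    by rewrite /bernstein !bin0 !expr0 !subn0 exprS; ring.
  have b0 : bernstein n n.+1 p = 0 by rewrite /bernstein bin_small // !mul0r.
  by rewrite big_ord_recr /= b0 mul0r addr0.
rewrite /bernstein /bump leq0n add1n binS natrD subSS exprS.
have [kn|nk] := ltnP k n; first by rewrite -(subnSK kn) [(1 - p) ^+ _.+1]exprS; ring.
by rewrite (@bin_small n k.+1) //; ring.
Qed.

Lemma sum_bernstein n p : \sum_(k < n.+1) bernstein n k p = 1.
Proof.
elim: n => [|n IH]; first by rewrite big_ord1 /bernstein bin0 !expr0 !mul1r.
have := bernstein_recr n p (fun=> 1).
have bern1 m : \sum_(k < m.+1) bernstein m k p * 1 = \sum_(k < m.+1) bernstein m k p.
  by apply: eq_bigr => k _; exact: mulr1.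
by rewrite !bern1 IH => ->; ring.
Qed.

(** The center a is arbitrary because a success in the recursion replaces a with a - 1. *)
Lemma bernstein_dispersion n p a :
  \sum_(k < n.+1) bernstein n k p * (k%:R - a) ^+ 2 = n%:R * p * (1 - p) + (n%:R * p - a) ^+ 2.
Proof.
elim: n a => [|n IH] a; first by rewrite big_ord1 /bernstein /= bin0 !expr0; ring.
rewrite (bernstein_recr n p (fun k => (k%:R - a) ^+ 2)) IH.
rewrite (eq_bigr (fun k : 'I_n.+1 => bernstein n k p * (k%:R - (a - 1)) ^+ 2)) => [|k _].
  by rewrite IH -natr1; ring.
by rewrite -natr1; congr (_ * _ ^+ 2); ring.
Qed.

Lemma bernstein_ge0 n k p : 0 <= p <= 1 -> 0 <= bernstein n k p.
Proof.
by move=> /andP[p0 p1]; rewrite !mulr_ge0 ?exprn_ge0 ?ler0n ?subr_ge0.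
Qed.

Lemma bernstein_variance n p : 0 <= p <= 1 ->
  \sum_(k < n.+2) bernstein n.+1 k p * (k%:R / n.+1%:R - p) ^+ 2 <= n.+1%:R^-1.
Proof.
move=> /andP[p0 p1].
rewrite (eq_bigr (fun k : 'I_n.+2 => bernstein n.+1 k p * (k%:R - n.+1%:R * p) ^+ 2 * (n.+1%:R ^- 2))) => [|k _].
  rewrite -mulr_suml bernstein_dispersion subrr expr0n addr0.
  rewrite -!mulrA mulrC -[leRHS]mul1r.
  have -> : p * ((1 - p) * n.+1%:R ^- 2) * n.+1%:R = p * (1 - p) * n.+1%:R^-1 by field.
  by rewrite ler_wpM2r ?invr_ge0 // mulr_ile1 ?subr_ge0 // gerBl.
by rewrite -mulrA -exprVn -exprMn; congr (_ * _ ^+ 2); field.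
Qed.

End Bernstein.

Section ProductWeights.
Variables (R : realType) (q n : nat) (w : 'I_q -> nat -> R).
Hypothesis w1 : forall j, \sum_(k < n) w j k = 1.

Lemma sum_prod_weights : \sum_(k : {ffun 'I_q -> 'I_n}) \prod_(j < q) w j (k j) = 1.
Proof. by rewrite -(bigA_distr_bigA (fun j (k : 'I_n) => w j k)) big1. Qed.

(** Independence: the factors other than the i-th one each sum to 1. *)
Lemma sum_prod_weights1 i (G : nat -> R) :
  \sum_(k : {ffun 'I_q -> 'I_n}) (\prod_(j < q) w j (k j)) * G (k i) = \sum_(k < n) w i k * G k.
Proof.
pose w' j (k : 'I_n) := w j k * (if j == i then G k else 1).
rewrite (eq_bigr (fun k : {ffun 'I_q -> 'I_n} => \prod_(j < q) w' j (k j))) => [|k _].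
  rewrite -(bigA_distr_bigA w') (bigD1 i) //= [X in _ * X]big1 ?mulr1 => [|j /negbTE ji].
    by apply: eq_bigr => k _; rewrite /w' eqxx.
  by rewrite /w' ji; under eq_bigr do rewrite mulr1; rewrite w1.
rewrite big_split /=; congr (_ * _); rewrite (bigD1 i) //= eqxx big1 ?mulr1 // => j /negbTE -> //.
Qed.

End ProductWeights.

Lemma compact_unif_continuous (R : realType) (U : pseudoMetricType R) (K : set U) (f : U -> R) e :
  compact K -> continuous f -> 0 < e ->
  exists2 del : R, 0 < del & forall x y, K x -> ball x del y -> `|f x - f y| <= e.
Proof.
move=> /compact_near_coveringP cK cf e0.
have near_cov x : K x -> \forall x' \near x & del \near 0^'+, forall y, ball x' del y -> `|f x' - f y| <= e.
  move=> _; have /cvgrPdist_lt/(_ (e / 2)) := cf x; rewrite divr_gt0 // => /(_ isT)/nbhs_ballP[r /= r0 hr].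
  have r20 : 0 < r / 2 by rewrite divr_gt0.
  exists (ball x (r / 2), [set del | del <= r / 2]) => /=.
    by split; [exact: nbhsx_ballx|exact: nbhs_right_le].
  move=> -[x' del] /= [xx' delr] y x'y.
  have hx' : `|f x - f x'| < e / 2 by apply: hr; apply: le_ball xx'; rewrite ler_pdivrMr // ler_pMr // ler1n.
  have hy : `|f x - f y| < e / 2.
    apply: hr; rewrite [r]splitr; apply: ball_triangle xx' _; exact: le_ball delr _ x'y.
  have -> : f x' - f y = (f x - f y) - (f x - f x') by ring.
  by apply: le_trans (ler_normB _ _) _; rewrite [leRHS]splitr lerD // ltW.
have h := cK _ _ _ _ near_cov.
have [del [del0 hdel]] : exists del, 0 < del /\ K `<=` (fun x => forall y, ball x del y -> `|f x - f y| <= e).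
  near (0 : R)^'+ => del; exists del; split; first by near: del; exact: nbhs_right_gt.
  by near: del; exact: h.
by exists del => // x y Kx; exact: hdel.
Unshelve. all: by end_near.
Qed.

Section TrigApprox.
Variables (R : realType) (q : nat).

(** An inverse of (1 + sin (x / L)) / 2 for |x| <= L, extended continuously to the whole line:
    clipping at sin 1 < 1 keeps the argument of asin inside the open interval (-1, 1). *)
Let clip_asin (L u : R) : R := L * asin (Num.max (- sin 1) (Num.min (sin 1) (2 * u - 1))).

Let sin1_01 : 0 < (sin 1 : R) < 1.
Proof.
have c1 := cos1_gt0 R; have h := cos2Dsin2 (1 : R).
have s0 : 0 < (sin 1 : R).
  by apply: sin_gt0_pi; rewrite ltr01 /= (lt_le_trans _ (pi_ge2 R)) // ltr1n.
rewrite s0 /=; nra.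
Qed.

Let continuous_clip_asin (L : R) : continuous (clip_asin L : R -> R).
Proof.
have /andP[s0 s1] := sin1_01.
move=> u; apply: cvgM; first exact: cvg_cst.
apply: (@continuous_comp _ _ _ (fun u : R => Num.max (- sin 1) (Num.min (sin 1) (2 * u - 1)) : R) (@asin R)); last first.
  apply: continuous_asin; rewrite /= lt_max ltrN2 s1 /= gt_max gt_min s1 /= andbT.
  by rewrite (lt_trans _ ltr01) // oppr_lt0.
apply: continuous_max; first exact: cst_continuous.
apply: continuous_min; first exact: cst_continuous.
apply: cvgB; last exact: cvg_cst.
by apply: cvgM; [exact: cvg_cst|exact: cvg_id].
Qed.

Let clip_asin_sin (L x : R) : 0 < L -> `|x| <= L -> clip_asin L ((1 + sin (x / L)) / 2) = x.
Proof.
move=> L0 xL; have p1 := pihalf_ge1 R.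
have : `|x / L| <= 1 by rewrite normrM normfV (gtr0_norm L0) ler_pdivrMr // mul1r.
rewrite ler_norml => /andP[h1 h2].
have in_ (y : R) : -1 <= y -> y <= 1 -> y \in `[- (pi / 2), pi / 2].
  by move=> y0 y1; rewrite in_itv /= (le_trans _ y0) ?lerN2 // (le_trans y1).
have le_sin (y z : R) : -1 <= y -> y <= z -> z <= 1 -> sin y <= sin z.
  by move=> y0 yz z1; rewrite leNgt ltr_sin ?in_ ?(le_trans yz) ?(le_trans y0) // -leNgt.
rewrite /clip_asin.
have -> : 2 * ((1 + sin (x / L)) / 2) - 1 = sin (x / L) by field.
rewrite min_r ?le_sin // ?lerN10 // max_r; last by rewrite -sinN le_sin.
by rewrite sinK ?in_ // mulrC divfK // gt_eqF.
Qed.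

(** The approximant averages values of f with non-negative weights of sum 1, so it keeps the bound B
    outside of the box; the error 2 B made there is absorbed by the exponentials. *)
Lemma trig_approx (f : 'rV[R]_q -> R) (B e : R) :
  continuous f -> (forall x, `|f x| <= B) -> 0 < e ->
  exists2 g, trigpoly g &
    forall x, `|f (\row_j x j) - g x| <= e * (1 + \sum_(j < q) (expR (x j) + expR (- x j))).
Proof.
move=> cf fB e0.
have B0 : 0 <= B by apply: le_trans (fB 0).
(* Ensures e * expR L >= e * (1 + L) >= 2 B, the bound for points outside of the box. *)
pose L := 2 * B / e + 1.
have L0 : 0 < L by rewrite ltr_wpDl // divr_ge0 ?mulr_ge0 ?(ltW e0).
have e20 : 0 < e / 2 by rewrite divr_gt0.
have cK : compact [set v : 'rV[R]_q | forall j, `[(- L), L]%classic (v ord0 j)].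
  exact: (@rV_compact R q (fun=> `[(- L), L]%classic) (fun=> @segment_compact R _ _)).
have [del1 del10 hf] := compact_unif_continuous cK cf e20.
(* Halved because the modulus of continuity gives a non-strict inequality, whereas membership in a
   ball is strict. *)
have del120 : 0 < del1 / 2 by rewrite divr_gt0.
have [del del0 hg] := compact_unif_continuous (@segment_compact R 0 1) (@continuous_clip_asin L) del120.
(* Chebyshev's bound: in each coordinate the weight of the grid points at distance at least del is
   at most 1 / ((n + 1) del^2). Over q coordinates and with differences of f up to 2 B, the
   contribution must not exceed e / 2. *)
have [n hn] : exists n : nat, q%:R * (2 * B / del ^+ 2) <= e / 2 * n.+1%:R.
  have A0 : 0 <= q%:R * (2 * B / del ^+ 2) / (e / 2).
    by rewrite divr_ge0 ?(ltW e20) // mulr_ge0 // divr_ge0 ?sqr_ge0 // mulr_ge0.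
  exists (Num.bound (q%:R * (2 * B / del ^+ 2) / (e / 2))).
  rewrite -ler_pdivrMl // mulrC; apply: ltW; apply: lt_trans (archi_boundP A0) _.
  by rewrite ltr_nat.
pose p (x : R) := (1 + sin (x / L)) / 2.
have p01 x : 0 <= p x <= 1.
  have := sin_geN1 (x / L); have := sin_le1 (x / L); rewrite /p => h1 h2.
  by apply/andP; split; lra.
pose y (k : {ffun 'I_q -> 'I_n.+2}) : 'rV[R]_q := \row_j clip_asin L ((k j)%:R / n.+1%:R).
pose W (k : {ffun 'I_q -> 'I_n.+2}) (x : 'I_q -> R) := \prod_(j < q) bernstein n.+1 (k j) (p (x j)).
have W0 k (x : 'I_q -> R) : 0 <= W k x by apply: prodr_ge0 => j _; exact: bernstein_ge0.
have w1 (x : 'I_q -> R) j : \sum_(k < n.+2) bernstein n.+1 k (p (x j)) = 1 by exact: sum_bernstein.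
have W1 (x : 'I_q -> R) : \sum_k W k x = 1 by exact: (@sum_prod_weights R q n.+2 (fun j k => bernstein n.+1 k (p (x j))) (w1 x)).
exists (fun x => \sum_k f (y k) * W k x).
  apply: trig_sum => k; apply: trigZ; apply: trig_prod => j.
  have tp : trigpoly (fun x : 'I_q -> R => p (x j)).
    have := trigZ 2^-1 (trigD (trig_cst q 1) (trig_sin_coord j L)); congr trigpoly.
    by apply/funext => x; rewrite /p mulrC.
  have tN : trigpoly (fun x : 'I_q -> R => 1 - p (x j)).
    have := trigD (trig_cst q 1) (trigZ (-1) tp); congr trigpoly.
    by apply/funext => x; rewrite mulN1r.
  apply: trigM; last exact: trigX.
  by apply: trigZ; exact: trigX.
move=> x.
have dist : `|f (\row_j x j) - \sum_k f (y k) * W k x| <= \sum_k W k x * `|f (\row_j x j) - f (y k)|.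
  rewrite -{1}[f _]mul1r -(W1 x) mulr_suml -sumrB; apply: le_trans (ler_norm_sum _ _ _) _.
  by apply: ler_sum => k _; rewrite [f _ * W _ _]mulrC -mulrBr normrM ger0_norm.
have far k : `|f (\row_j x j) - f (y k)| <= 2 * B.
  by rewrite mulrDl mul1r; apply: le_trans (ler_normB _ _) _; rewrite lerD.
apply: le_trans dist _.
have S0 : 0 <= \sum_(j < q) (expR (x j) + expR (- x j)).
  by apply: sumr_ge0 => j _; rewrite addr_ge0 ?expR_ge0.
have [xL|[j xj]] : (forall j, `|x j| <= L) \/ exists j, L < `|x j|.
- have [h|/existsNP[j /negP]] := pselect (forall j, `|x j| <= L); first by left.
  by rewrite -ltNge => h; right; exists j.
- apply: le_trans (_ : _ <= e) _; last by rewrite ler_pMr // lerDl.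
  (* If a grid point is del-close in all coordinates, uniform continuity gives e / 2; otherwise some
     squared deviation is at least del^2, and its term alone is at least 2 B. *)
  apply: le_trans (_ : _ <= \sum_k (W k x * (e / 2) +
     \sum_(j < q) 2 * B / del ^+ 2 * (W k x * ((k j)%:R / n.+1%:R - p (x j)) ^+ 2))) _.
    apply: ler_sum => k _; rewrite -mulr_sumr.
    have -> : 2 * B / del ^+ 2 * (\sum_(j < q) W k x * ((k j)%:R / n.+1%:R - p (x j)) ^+ 2) =
      W k x * (2 * B / del ^+ 2 * \sum_(j < q) ((k j)%:R / n.+1%:R - p (x j)) ^+ 2).
      by rewrite -mulr_sumr; ring.
    rewrite -mulrDr ler_wpM2l //.
    have c0 : 0 <= 2 * B / del ^+ 2 by rewrite divr_ge0 ?sqr_ge0 // mulr_ge0.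
    have [near|[j jfar]] : (forall j, `|(k j)%:R / n.+1%:R - p (x j)| < del) \/
        exists j, del <= `|(k j)%:R / n.+1%:R - p (x j)|.
    + have [h|/existsNP[j /negP]] := pselect (forall j, `|(k j)%:R / n.+1%:R - p (x j)| < del).
        by left.
      by rewrite -leNgt => h; right; exists j.
    + rewrite ler_wpDr //; first by rewrite mulr_ge0 // sumr_ge0 // => j _; exact: sqr_ge0.
      apply: hf => [j|]; first by rewrite /= in_itv /= mxE -ler_norml.
      split=> // i j; rewrite !mxE /ball /= -{1}(clip_asin_sin L0 (xL j)).
      apply: (@le_lt_trans _ _ (del1 / 2)); last by rewrite ltr_pdivrMr // ltr_pMr // ltr1n.
      by apply: hg; [rewrite /= in_itv /= p01|rewrite /ball /= distrC].
    + rewrite ler_wpDl ?(ltW e20) //; apply: le_trans (far k) _.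
      rewrite (bigD1 j) //= mulrDr ler_wpDr //.
        by rewrite mulr_ge0 // sumr_ge0 // => i _; exact: sqr_ge0.
      rewrite -mulrA ler_peMr ?mulr_ge0 // mulrC ler_pdivlMr ?exprn_gt0 // mul1r.
      by rewrite -[leRHS]real_normK ?num_real // lerXn2r ?nnegrE ?(ltW del0).
  rewrite big_split /= -mulr_suml W1 mul1r exchange_big /= [leRHS]splitr lerD2l.
  apply: le_trans (_ : _ <= \sum_(j < q) 2 * B / del ^+ 2 * n.+1%:R^-1) _.
    apply: ler_sum => j _; rewrite -mulr_sumr ler_wpM2l ?divr_ge0 ?sqr_ge0 ?mulr_ge0 //.
    rewrite (@sum_prod_weights1 R q n.+2 (fun j k => bernstein n.+1 k (p (x j))) (w1 x) j (fun k => (k%:R / n.+1%:R - p (x j)) ^+ 2)).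
    exact: bernstein_variance.
  by rewrite sumr_const card_ord -[_ *+ q]mulr_natl mulrA ler_pdivrMr.
- apply: le_trans (_ : _ <= \sum_k W k x * (2 * B)) _.
    by apply: ler_sum => k _; rewrite ler_wpM2l.
  rewrite -mulr_suml W1 mul1r.
  have BL : 2 * B <= e * expR L.
    rewrite -ler_pdivrMl // mulrC; apply: le_trans (expR_ge1Dx _).
    by rewrite /L; lra.
  apply: le_trans BL _; rewrite ler_wpM2l ?(ltW e0) // ler_wpDl //.
  rewrite (bigD1 j) //= ler_wpDr //.
    by apply: sumr_ge0 => i _; rewrite addr_ge0 ?expR_ge0.
  by apply: le_trans (expR_norm_le _); rewrite ler_expR ltW.
Qed.

End TrigApprox.

Section ExpWeight.
Variables (R : realType) (q : nat).

Definition exp_weight (x : 'I_q -> R) : R := 1 + \sum_(j < q) (expR (x j) + expR (- x j)).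

Lemma isE_exp_weight d (T : measurableType d) (P : probability T R) (Y : 'I_q -> T -> R)
    (a b : 'I_q -> R) :
  (forall j, isE P (fun w => expR (Y j w)) (a j)) ->
  (forall j, isE P (fun w => expR (- Y j w)) (b j)) ->
  isE P (fun w => exp_weight (Y^~ w)) (1 + \sum_(j < q) (a j + b j)).
Proof.
move=> ha hb; apply: isED; first exact: isE_cst.
by apply: isE_sum => j _; exact: isED.
Qed.

Lemma measurable_trig d (T : measurableType d) (Y : 'I_q -> T -> R) g :
  (forall j, measurable_fun setT (Y j)) -> trigpoly g ->
  measurable_fun setT (fun w => g (Y^~ w)).
Proof.
move=> mY; elim => {g} [t c|f g _ mf _ mg|a f _ mf].
- apply: (measurableT_comp (continuous_measurable_fun (@continuous_cos R))).
  by apply: measurable_funD => //; apply: measurable_sum => j; exact: measurable_funM.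
- exact: measurable_funD.
- exact: measurable_funM.
Qed.

(** By [trig_approx] with e = 1 / (n + 1), the composite is a pointwise limit of trigonometric
    polynomials in Y, whose measurability only involves the real coordinates. *)
Lemma measurable_continuous_rvec d (T : measurableType d) (Y : 'I_q -> T -> R) (f : 'rV[R]_q -> R) B :
  (forall j, measurable_fun setT (Y j)) -> continuous f -> (forall x, `|f x| <= B) ->
  measurable_fun setT (f \o rvec Y).
Proof.
move=> mY cf fB.
have approx n : exists g, trigpoly g /\
    forall x, `|f (\row_j x j) - g x| <= n.+1%:R^-1 * exp_weight x.
  have n0 : 0 < n.+1%:R^-1 :> R by rewrite invr_gt0.
  by have [g tg hg] := trig_approx cf fB n0; exists g.
have [g hg] := choice approx.
apply: (@measurable_fun_cvg _ _ _ _ (fun n w => g n (Y^~ w))).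
  by move=> n; apply: measurable_trig => //; exact: (hg n).1.
move=> w _; apply/cvgrPdist_le => e e0.
have h0 : (fun n => n.+1%:R^-1 * exp_weight (Y^~ w)) @ \oo --> (0 : R).
  by rewrite -[X in _ --> X](mul0r (exp_weight (Y^~ w))); apply: cvgM; [exact: cvg_harmonic|exact: cvg_cst].
near=> n; apply: le_trans ((hg n).2 (Y^~ w)) _.
apply: le_trans (ler_norm _) _; rewrite -[X in `|X|]subr0 distrC.
by near: n; move/cvgrPdist_le : h0; apply.
Unshelve. all: by end_near.
Qed.

End ExpWeight.

Section WeakConvergence.
Context (R : realType) (q : nat).
Hypothesis q0 : (0 < q)%N.
Context (dispM : nat -> measure_display) (TM : forall d, measurableType (dispM d))
  (PM : forall d, probability (TM d) R) (M : forall d, 'I_q -> {RV (PM d) >-> R}).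
Hypothesis hM : forall d, (1 <= d)%N -> uniform_multinomial d (M d).
Context (disp : measure_display) (T : measurableType disp) (P : probability T R)
  (X : 'I_q -> {RV P >-> R}).
Hypotheses (hX : multivariate_normal X) (hmean : forall a, ('E_P[X a] = 0)%E).
Hypothesis hcov : forall a b,
  covariance P (X a) (X b) = (q%:R^-1 * ((a == b)%:R - q%:R^-1))%:E.

Let S d j w := (M d j w - d%:R / q%:R) / Num.sqrt d%:R.

Let mS d j : measurable_fun setT (S (d := d) j).
Proof. by apply: measurable_funM => //; exact: measurable_funB. Qed.

(** By linearity a single cosine suffices; on the Gaussian side its phase is split off by the
    addition formula, the sine having expectation 0. *)
Let trig_cvg g : trigpoly g -> exists (a : nat -> R) l,
  [/\ forall d, (0 < d)%N -> isE (PM d) (fun w => g (S (d := d) ^~ w)) (a d),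
      isE P (fun w => g (X^~ w)) l & a @ \oo --> l].
Proof.
elim => {g} [t c|f g _ [a [k [ha hk ak]]] _ [b [l [hb hl bl]]]|c f _ [a [k [ha hk ak]]]].
- exists (fun d => complex.Re ((q%:R^-1 * \sum_(j < q) cis (centered t j / Num.sqrt d%:R)) ^+ d * cis c)).
  exists (cos c * expR (- (limit_var t / 2))); split.
  + by move=> d d0; apply: isE_cos_multinomial => //; exact: hM.
  + have [v0 mgf] := limit_varP hX hmean hcov t.
    have mL := measurable_lincomb X t.
    have := isEB (isEZ (cos c) (isE_cos_gaussian mL mgf v0)) (isEZ (sin c) (isE_sin_gaussian mL mgf v0)).
    rewrite mulr0 subr0; congr isE; apply/funext => w.
    by rewrite cosD /lincomb; ring.
  + exact: cvg_cos_multinomial.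
- exists (fun d => a d + b d), (k + l); split; last exact: cvgD.
    by move=> d d0; apply: isED; [exact: ha|exact: hb].
  exact: isED.
- exists (fun d => c * a d), (c * k); split; last by apply: cvgM => //; exact: cvg_cst.
    by move=> d d0; apply: isEZ; exact: ha.
  exact: isEZ.
Qed.

Let exp_coord_multinomial (s : R) j d : `|s| <= 1 -> (0 < d)%N ->
  exists2 e, isE (PM d) (fun w => expR (s * S (d := d) j w)) e & e <= expR (expR 1).
Proof.
move=> s1 d0; pose t i := s * (i == j)%:R : R.
exists ((q%:R^-1 * \sum_(j < q) expR (centered t j / Num.sqrt d%:R)) ^+ d).
  have := isE_exp_multinomial q0 (hM d0) t; congr isE; apply/funext => w; congr expR.
  rewrite (bigD1 j) //= /t eqxx mulr1 big1 ?addr0 // => i /negbTE ->.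
  by rewrite mulr0 mul0r.
apply: exp_multinomial_le => // i.
rewrite /centered /t (bigD1 j) //= eqxx mulr1 (eq_bigr (fun=> 0)) ?big1_eq ?addr0; last first.
  by move=> k /negbTE ->; rewrite mulr0.
rewrite [q%:R^-1 * s]mulrC -mulrBr normrM mulr_ile1 //.
have q1 : (1 : R) <= q%:R by rewrite ler1n.
have qV : 0 < (q%:R^-1 : R) <= 1 by rewrite invr_gt0 ltr0n q0 /= invf_le1 // ltr0n.
by move: qV => /andP[? ?]; rewrite ler_norml; case: (i == j) => /=; apply/andP; split; lra.
Qed.

Let exp_coord_gaussian (s : R) j : exists e, isE P (fun w => expR (s * X j w)) e.
Proof.
have [v0 mgf] := limit_varP hX hmean hcov (fun i => (i == j)%:R).
have := isE_exp (measurable_lincomb X _) mgf s => h; eexists; move: h; congr isE.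
apply/funext => w; rewrite /lincomb (bigD1 j) //= eqxx mul1r big1 ?addr0 // => i /negbTE ->.
by rewrite mul0r.
Qed.

Lemma multinomial_weak_cvg : weak_cvg PM S P X.
Proof.
move=> f cf [B0 [_ /(_ (B0 + 1))]]; rewrite ltrDl ltr01 => /(_ isT) fB'.
have fB x : `|f x| <= B0 + 1 by exact: fB'.
set B := B0 + 1 in fB.
have isEf dY (TY : measurableType dY) (PY : probability TY R) (Y : 'I_q -> TY -> R) :
    (forall j, measurable_fun setT (Y j)) ->
    isE PY (f \o rvec Y) (fine (\int[PY]_w ((f \o rvec Y) w)%:E)%E).
  move=> mY; apply: (@isE_dominated _ _ _ _ _ (cst B) B); last by move=> w; exact: fB.
    exact: measurable_continuous_rvec mY cf fB.
  exact: isE_cst.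
have fX := isEf _ _ P _ (fun j => measurable_funP (X j)).
have fS d := isEf _ _ (PM d) _ (mS (d := d)).
rewrite unlock fX.2; under eq_fun do rewrite (fS _).2.
apply: cvg_EFin; first exact: nearW.
have [wX hwX] : exists wX, isE P (fun w => exp_weight (X^~ w)) wX.
  have [a ha] := choice (exp_coord_gaussian 1); have [b hb] := choice (exp_coord_gaussian (- 1)).
  exists (1 + \sum_(j < q) (a j + b j)); apply: isE_exp_weight => j.
    by have := ha j; under eq_fun do rewrite mul1r.
  by have := hb j; under eq_fun do rewrite mulN1r.
pose wS := 1 + \sum_(j < q) (expR (expR 1) + expR (expR 1)) : R.
have hwS d : (0 < d)%N -> exists2 v, isE (PM d) (fun w => exp_weight (S (d := d) ^~ w)) v & v <= wS.
  move=> d0.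
  have c1 (s : R) : `|s| <= 1 -> exists a, forall j, isE (PM d) (fun w => expR (s * S (d := d) j w)) (a j)
      /\ a j <= expR (expR 1).
    move=> s1.
    have ex j : exists a, isE (PM d) (fun w => expR (s * S (d := d) j w)) a /\ a <= expR (expR 1).
      by have [a ha a1] := exp_coord_multinomial j s1 d0; exists a.
    by have [a ha] := choice ex; exists a.
  have [a ha] := c1 1 (eq_ind_r (fun x => x <= 1) (lexx 1) (normr1 _)).
  have [b hb] := c1 (- 1) (eq_ind_r (fun x => x <= 1) (lexx 1) (normrN1 _)).
  exists (1 + \sum_(j < q) (a j + b j)).
    apply: isE_exp_weight => j; first by have [] := ha j; under eq_fun do rewrite mul1r.
    by have [] := hb j; under eq_fun do rewrite mulN1r.
  by rewrite lerD2l; apply: ler_sum => j _; rewrite lerD ?(ha j).2 ?(hb j).2.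
have wX0 : 0 <= wX.
  apply: isE_le (isE_cst P 0) hwX _ => w; apply: addr_ge0 => //; apply: sumr_ge0 => j _.
  by rewrite addr_ge0 ?expR_ge0.
have wS0 : 0 <= wS by rewrite addr_ge0 // sumr_ge0 // => j _; rewrite addr_ge0 ?expR_ge0.
apply/cvgrPdist_le => e e0.
(* The errors are at most e' * wX for the approximation under P, e' for the trigonometric
   polynomial, and e' * wS for the approximation under [PM d], uniformly in d. *)
pose e' := e / (1 + wX + wS).
have w0 : 0 < 1 + wX + wS by lra.
have e'0 : 0 < e' by rewrite divr_gt0.
have [g tg hg] := trig_approx cf fB e'0.
have [a [l [ha hl al]]] := trig_cvg tg.
near=> d; have d0 : (0 < d)%N by near: d; exact: nbhs_infty_gt.
have [v hv vS] := hwS d d0.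
set eX := fine _; pose eS := fine (\int[PM d]_w ((f \o rvec (S (d := d))) w)%:E)%E.
rewrite -[(fine \o _) d]/eS.
have h1 : `|eX - l| <= e' * wX.
  by apply: isE_abs_le (isEB fX hl) (isEZ e' hwX) _ => w; exact: hg.
have h2 : `|eS - a d| <= e' * v.
  by apply: isE_abs_le (isEB (fS d) (ha d d0)) (isEZ e' hv) _ => w; exact: hg.
have h3 : `|l - a d| <= e' by near: d; move/cvgrPdist_le : al; apply.
have -> : eX - eS = (eX - l) + (l - a d) - (eS - a d) by ring.
apply: le_trans (ler_normB _ _) _; apply: le_trans (lerD (ler_normD _ _) (lexx _)) _.
apply: le_trans (lerD (lerD h1 h3) h2) _.
apply: (@le_trans _ _ (e' * (1 + wX + wS))); last by rewrite /e' divfK // gt_eqF.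
have : e' * v <= e' * wS by rewrite ler_wpM2l // ltW.
lra.
Unshelve. all: by end_near.
Qed.

End WeakConvergence.

(** * Polynomiality of the limits, and conclusion *)

Section PolynomialFunctions.
Variables (R : realType) (q : nat).
Implicit Types F G : ('I_q -> R) -> R[i].

Definition polyfun F := exists p : mpoly q R[i], forall m, F m = meval (fun j => (m j)%:C) p.

Lemma polyfun_cst c : polyfun (fun=> c).
Proof. by exists (mpolyC q c) => m; rewrite mevalC. Qed.

Lemma polyfun_coord j : polyfun (fun m => (m j)%:C).
Proof. by exists (mpolyX R[i] (mnm1 j)) => m; rewrite mevalXU. Qed.

Lemma polyfunM F G : polyfun F -> polyfun G -> polyfun (fun m => F m * G m).
Proof. by move=> [p hp] [r hr]; exists (p * r) => m; rewrite mevalM hp hr. Qed.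

Lemma polyfunX F n : polyfun F -> polyfun (fun m => F m ^+ n).
Proof. by move=> [p hp]; exists (p ^+ n) => m; rewrite rmorphXn hp. Qed.

Lemma polyfun_sum (I : Type) (r : seq I) (P : pred I) (F : I -> ('I_q -> R) -> R[i]) :
  (forall i, polyfun (F i)) -> polyfun (fun m => \sum_(i <- r | P i) F i m).
Proof.
move=> /choice[p hp]; exists (\sum_(i <- r | P i) p i) => m.
by rewrite raddf_sum; apply: eq_bigr => i _; exact: hp.
Qed.

Lemma polyfun_prod (I : Type) (r : seq I) (P : pred I) (F : I -> ('I_q -> R) -> R[i]) :
  (forall i, polyfun (F i)) -> polyfun (fun m => \prod_(i <- r | P i) F i m).
Proof.
move=> /choice[p hp]; exists (\prod_(i <- r | P i) p i) => m.
by rewrite rmorph_prod; apply: eq_bigr => i _; exact: hp.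
Qed.

(** In the expansion that serves (iii), the weights [wcoeff] are constants and each coordinate of m
    enters through a Hermite polynomial. *)
Lemma polyfun_gf_coeff l : polyfun (fun m => gf_coeff m l).
Proof.
under eq_fun do rewrite gf_coeffE hermite_wseries mcoeff_wseries.
apply: polyfun_sum => a; apply: polyfunM; last exact: polyfun_cst.
apply: polyfun_prod => j; under eq_fun do rewrite hermiteE.
rewrite /hermite_seq /conv; under eq_fun do rewrite rmorph_sum.
apply: polyfun_sum => i; under eq_fun do rewrite rmorphM rmorphM rmorphXn.
apply: polyfunM; last exact: polyfun_cst.
by apply: polyfunM; [exact: polyfun_cst|apply: polyfunX; exact: polyfun_coord].
Qed.

End PolynomialFunctions.

Theorem lemma14 (R : realType) (q : nat) (hq : (2 <= q)%N)
  (dispM : nat -> measure_display) (TM : forall d, measurableType (dispM d))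
  (PM : forall d, probability (TM d) R)
  (M : forall d, 'I_q -> {RV (PM d) >-> R})
  (hM : forall d, (1 <= d)%N -> uniform_multinomial d (M d))
  (disp : measure_display) (T : measurableType disp) (P : probability T R)
  (X : 'I_q -> {RV P >-> R})
  (hX : multivariate_normal X)
  (hmean : forall a, ('E_P[X a] = 0)%E)
  (hcov : forall a b,
     covariance P (X a) (X b) = (q%:R^-1 * ((a == b)%:R - q%:R^-1))%:E) :
  [/\ weak_cvg PM (fun d j w => (M d j w - d%:R / q%:R) / Num.sqrt d%:R) P X,
      forall (l : multinom q.-1) (m : 'I_q -> R), \sum_(j < q) m j = 0 ->
        cvg (krawtchouk_seq l m @ \oo),
      (forall l : multinom q.-1, exists p : mpoly q R[i],
         forall m : 'I_q -> R, \sum_(j < q) m j = 0 ->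
           krawtchouk_lim l m = meval (fun j => (m j)%:C) p) /\
      (forall l l' : multinom q.-1,
         let f w := krawtchouk_lim l (X^~ w) * (krawtchouk_lim l' (X^~ w))^* in
         cintegrable P f /\
         cexpectation P f = (l == l')%:R / (\prod_(k < q.-1) (l k)`!)%:R),
      forall (l : multinom q.-1) (m : 'I_q -> R), \sum_(j < q) m j = 0 ->
        krawtchouk_lim l m = gf_coeff m l
    & forall (l : multinom q.-1) (m : 'I_q -> R), \sum_(j < q) m j = 0 ->
        krawtchouk_lim l m = krawtchouk_lim_formula l m].
Proof.
have q0 : (0 < q)%N by exact: leq_trans hq.
split.
- exact: multinomial_weak_cvg.
- by move=> l m _; apply/cvg_ex; exists (gf_coeff m l); exact: cvg_krawtchouk_seq.
- split=> [l|l l' f].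
    have [p hp] := polyfun_gf_coeff R l.
    by exists p => m _; rewrite krawtchouk_limE.
  have -> : f = fun w => gf_coeff (X^~ w) l * (gf_coeff (X^~ w) l')^*%C.
    by apply/funext => w; rewrite /f !krawtchouk_limE.
  exact: gf_coeff_orthogonal.
- by move=> l m _; exact: krawtchouk_limE.
- by move=> l m _; rewrite krawtchouk_lim_formulaE // krawtchouk_limE.
Qed.
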